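(* Let $0<s<1$, $p>1$ and let $d\ge 2$ be an integer. Let $\tau$ satisfy $0<\tau<\frac{p(sp+1)}{2(p-1)}$ if $p\ge 2$, and $0<\tau<2\min\{sp,1\}$ if $1<p<2$. Then there exists a positive constant $C_{d,s,p,\tau}$ (depending only on $d,s,p,\tau$) such that for all $u\in C_c(\mathbb{R}^d_+)$ if $sp\ge 1$, or for all $u\in C_c(\overline{\mathbb{R}^d_+})$ if $sp<1$, $$\int_{\mathbb{R}^d_+}\int_{\mathbb{R}^d_+}\frac{|u(x)-u(y)|^p}{|x-y|^{d+sp}}\,dy\,dx\ \ge\ \mathcal{D}_{d,s,p}\int_{\mathbb{R}^d_+}\frac{|u(x)|^p}{x_d^{sp}}\,dx+C_{d,s,p,\tau}\int_{\mathbb{R}^d_+}\frac{|u(x)|^p}{x_d^{sp-\tau}\left(x_{d-1}^2+x_d^2\right)^{\tau/2}}\,dx,$$ where $$\mathcal{D}_{d,s,p}=2\pi^{\frac{d-1}{2}}\frac{\Gamma\left(\frac{1+sp}{2}\right)}{\Gamma\left(\frac{d+sp}{2}\right)}\int_{0}^{1}\frac{\left|1-t^{(sp-1)/p}\right|^p}{(1-t)^{1+sp}}\,dt .$$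
   Context: $\mathbb{R}^d_+=\{x=(x_1,\dots,x_d)\in\mathbb{R}^d: x_d>0\}$ and $\overline{\mathbb{R}^d_+}$ is its closure. $C_c(\Omega)$ denotes the (real-valued) continuous functions with compact support contained in $\Omega$; functions in $C_c(\overline{\mathbb{R}^d_+})$ need not vanish on $\{x_d=0\}$. The left-hand side may be $+\infty$. $\Gamma$ is the Euler Gamma function. (The constant $\mathcal{D}_{d,s,p}$ is the sharp constant in the fractional Hardy inequality on the half-space; it equals $0$ when $sp=1$.) *)

(* Defs.v *)
From HB Require Import structures.
From mathcomp Require Import all_boot all_order all_algebra.
From mathcomp Require Import all_classical all_reals all_analysis.

Set Implicit Arguments.
Unset Strict Implicit.
Unset Printing Implicit Defensive.

Import Order.TTheory GRing.Theory Num.Theory.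
Import numFieldNormedType.Exports.

Local Open Scope classical_set_scope.
Local Open Scope ring_scope.

(** Euclidean space is ['rV[R]_d], with the library's topology; its
    sigma-algebra is the one generated by the coordinates, exactly as the
    library does for [n.-tuple]. *)

Section rV_measurable.
Variables (R : realType) (n : nat).

Definition rV_coors (i : 'I_n) (x : 'rV[R]_n) : measurableTypeR R := x ord0 i.

Definition rV_measurable : set (set 'rV[R]_n) := g_sigma_preimage rV_coors.

Let rV_set0 : rV_measurable set0.
Proof. exact: sigma_algebra0. Qed.

Let rV_setC A : rV_measurable A -> rV_measurable (~` A).
Proof. exact: sigma_algebraC. Qed.

Let rV_bigcup (F : (set 'rV[R]_n)^nat) :
  (forall i, rV_measurable (F i)) -> rV_measurable (\bigcup_i (F i)).
Proof. exact: sigma_algebra_bigcup. Qed.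

HB.instance Definition _ := @isMeasurable.Build default_measure_display
  'rV[R]_n rV_measurable rV_set0 rV_setC rV_bigcup.

End rV_measurable.

Section rV_measurable_fun.
Variable R : realType.

Lemma measurable_rV_coors n (i : 'I_n) :
  measurable_fun [set: 'rV[R]_n] (@rV_coors R n i).
Proof.
move=> _ Y mY; rewrite setTI; apply: sub_sigma_algebra => /=.
rewrite -bigcup_seq/=; exists i => /=; first by rewrite mem_index_enum.
by exists Y => //; rewrite setTI.
Qed.

Lemma measurable_fun_rV_coorsP d (T : measurableType d) n (f : T -> 'rV[R]_n) :
  measurable_fun [set: T] f <->
  forall i, measurable_fun [set: T] (@rV_coors R n i \o f).
Proof.
apply: (@iff_trans _ (g_sigma_preimage
    (fun i => @rV_coors R n i \o f) `<=` measurable)).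
  rewrite g_sigma_preimage_comp; split=> [mf A [/= C preC <-]|prefS].
    exact: mf.
  by move=> _ A mA; apply: prefS; exists A.
split=> [cfS i|mf].
- move=> _ A mA.
  apply: cfS; apply: sub_sigma_algebra.
  case: n i => [[] []//|n i] in f *.
  rewrite -bigcup_mkord_ord.
  exists i; first exact: ltn_ord.
  by exists A => //; rewrite inord_val.
- apply: smallest_sub; first exact: sigma_algebra_measurable.
  case: n => [|n] in f mf *; first by rewrite big_ord0.
  rewrite -bigcup_mkord_ord; apply: bigcup_sub => i Ii.
  by move=> A [B mB <-]; exact: mf.
Qed.

Definition rV_cons n (z : measurableTypeR R * 'rV[R]_n) : 'rV[R]_n.+1 :=
  \row_i oapp (z.2 ord0) z.1 (unlift ord0 i).

Definition rV_uncons n (x : 'rV[R]_n.+1) : measurableTypeR R * 'rV[R]_n :=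
  (x ord0 ord0, \row_i x ord0 (lift ord0 i)).

Lemma rV_cons0 n (z : measurableTypeR R * 'rV[R]_n) :
  rV_cons z ord0 ord0 = z.1.
Proof. by rewrite mxE unlift_none. Qed.

Lemma rV_consS n (z : measurableTypeR R * 'rV[R]_n) i :
  rV_cons z ord0 (lift ord0 i) = z.2 ord0 i.
Proof. by rewrite mxE liftK. Qed.

Lemma rV_consK n : cancel (@rV_cons n) (@rV_uncons n).
Proof.
move=> [a x]; rewrite /rV_uncons rV_cons0; congr pair.
by apply/rowP => i; rewrite mxE rV_consS.
Qed.

Lemma measurable_rV_cons n : measurable_fun setT (@rV_cons n).
Proof.
apply/measurable_fun_rV_coorsP => i.
have [j ->|->] := unliftP ord0 i.
- rewrite (_ : _ \o _ = @rV_coors R n j \o snd); last first.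
    by apply/funext => z; rewrite /= /rV_coors rV_consS.
  by apply: measurableT_comp => //; exact: measurable_rV_coors.
- rewrite (_ : _ \o _ = fst)//.
  by apply/funext => z; rewrite /= /rV_coors rV_cons0.
Qed.

Lemma measurable_rV_uncons n : measurable_fun setT (@rV_uncons n).
Proof.
apply: measurable_fun_pair; first exact: (measurable_rV_coors (ord0 : 'I_n.+1)).
apply/measurable_fun_rV_coorsP => i.
rewrite (_ : _ \o _ = @rV_coors R n.+1 (lift ord0 i)); last first.
  by apply/funext => x; rewrite /= /rV_coors mxE.
exact: measurable_rV_coors.
Qed.

End rV_measurable_fun.

(** Lebesgue measure on R^n, by recursion on n: a point mass on R^0, and on
    R^(n+1) the image of the product of the Lebesgue measures of R and R^n
    under [(t, x) |-> (t, x_1, ..., x_n)]. *)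

Section rV_lebesgue_step.
Variables (R : realType) (n : nat).
Variable mu : {sigma_finite_measure set 'rV[R]_n -> \bar R}.
Local Open Scope ereal_scope.

Definition rV_lebesgue_step : set 'rV[R]_n.+1 -> \bar R :=
  pushforward (lebesgue_measure \x mu) (@rV_cons R n).

Let step0 : rV_lebesgue_step set0 = 0.
Proof. by apply: measure0; exact: measurable_rV_cons. Qed.

Let step_ge0 A : 0 <= rV_lebesgue_step A.
Proof. by apply: measure_ge0; exact: measurable_rV_cons. Qed.

Let step_sigma_additive : semi_sigma_additive rV_lebesgue_step.
Proof. by apply: measure_semi_sigma_additive; exact: measurable_rV_cons. Qed.

HB.instance Definition _ := isMeasure.Build _ _ _
  rV_lebesgue_step step0 step_ge0 step_sigma_additive.

Let step_sigma_finite : sigma_finite setT rV_lebesgue_step.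
Proof.
have /sigma_finiteP[F [TF ndF Foo]] :=
  sigma_finiteT (@lebesgue_measure R : {sigma_finite_measure set _ -> \bar R}).
have /sigma_finiteP[G [TG ndG Goo]] := sigma_finiteT mu.
exists (fun k => @rV_uncons R n @^-1` (F k `*` G k)).
  rewrite -preimage_bigcup -[LHS](preimage_setT (@rV_uncons R n)).
  congr (_ @^-1` _); rewrite -setXTT TF TG predeqE => -[x y]; split.
    move=> [/= [i _ Fix] [k _ Gky]]; exists (maxn i k) => //; split.
    - by move: x Fix; exact/subsetPset/ndF/leq_maxl.
    - by move: y Gky; exact/subsetPset/ndG/leq_maxr.
  by move=> [i _ []/= ? ?]; split; exists i.
move=> k; have [mF ?] := Foo k; have [mG ?] := Goo k; split.
  rewrite -[X in measurable X]setTI.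
  by apply: measurable_rV_uncons => //; exact: measurableX.
rewrite /rV_lebesgue_step /pushforward -comp_preimage.
rewrite (_ : _ \o _ = id); last by apply/funext => z /=; rewrite rV_consK.
rewrite preimage_id product_measure1E// lte_mul_pinfty// ge0_fin_numE//.
Qed.

HB.instance Definition _ := Measure_isSigmaFinite.Build _ _ _
  rV_lebesgue_step step_sigma_finite.

End rV_lebesgue_step.

Section rV_lebesgue.
Variable R : realType.
Local Open Scope ereal_scope.

Fixpoint rV_lebesgue (n : nat) :
    {sigma_finite_measure set 'rV[R]_n -> \bar R} :=
  match n with
  | 0 => \d_ (0%R : 'rV[R]_0)
  | m.+1 => rV_lebesgue_step (rV_lebesgue m)
  end.

Lemma rV_lebesgue_box n (A : 'I_n -> set (measurableTypeR R)) :
  (forall i, measurable (A i)) ->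
  rV_lebesgue n [set x | forall i, A i (x ord0 i)] =
  \prod_(i < n) lebesgue_measure (A i).
Proof.
elim: n A => [|n IH] A mA.
  rewrite big_ord0 (_ : [set _ | _] = setT); first by rewrite [LHS]diracE in_setT.
  by apply/seteqP; split => // x _ [].
rewrite big_ord_recl -IH; last by move=> i; exact: mA.
rewrite /= /rV_lebesgue_step /pushforward.
rewrite (_ : _ @^-1` _ = A ord0 `*`
    [set x : 'rV[R]_n | forall i, A (lift ord0 i) (x ord0 i)]); last first.
  apply/seteqP; split => z /=.
    by move=> Az; split=> [|i]; [rewrite -(rV_cons0 z)|rewrite -(rV_consS z)].
  move=> [A0 AS] i; have [j ->|->] := unliftP ord0 i.
    by rewrite rV_consS.
  by rewrite rV_cons0.
rewrite product_measure1E//.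
rewrite (_ : [set _ | _] = \bigcap_(i in [set: 'I_n])
    (@rV_coors R n i @^-1` A (lift ord0 i))); last first.
  by apply/seteqP; split => x /= Ax => [i _|i]; exact: Ax.
apply: fin_bigcap_measurable => // i _.
by rewrite -[X in measurable X]setTI; exact: measurable_rV_coors.
Qed.

End rV_lebesgue.

Section half_space.
Variables (R : realType) (d : nat).
Implicit Types x y : 'rV[R]_d.

(** The coordinates are numbered from 1: [xcoord x k] is the k-th coordinate of
    [x] for 1 <= k <= d. *)
Definition xcoord x (k : nat) : R := oapp (x ord0) 0 (insub k.-1).

(** The norm of the library on ['rV[R]_d] is the sup norm, hence: *)
Definition enorm x : R := Num.sqrt (\sum_(i < d) (x ord0 i) ^+ 2).

Definition half_space : set 'rV[R]_d := [set x | 0 < xcoord x d].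

(** Functions on [Omega] are represented by functions on the whole space, whose
    values outside of [Omega] are irrelevant. *)
Definition fun_support (Omega : set 'rV[R]_d) (u : 'rV[R]_d -> R) :=
  closure [set x | Omega x /\ u x != 0].

Definition Cc (Omega : set 'rV[R]_d) : set ('rV[R]_d -> R) :=
  [set u | [/\ {within Omega, continuous u},
               compact (fun_support Omega u) &
               fun_support Omega u `<=` Omega]].

End half_space.

Arguments half_space R d _ : clear implicits.

Section sharp_constant.
Variable R : realType.

(** Meaningful for [0 < z]. *)
Definition Gamma (z : R) : R :=
  \int[lebesgue_measure]_(t in `]0, +oo[) (t `^ (z - 1) * expR (- t)).

(** Extended-real valued so that finiteness of the integral is not presupposed. *)
Definition hardy_const (d : nat) (s p : R) : \bar R :=
  ((2 * pi `^ ((d%:R - 1) / 2) *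
      (Gamma ((1 + s * p) / 2) / Gamma ((d%:R + s * p) / 2)))%:E *
   \int[lebesgue_measure]_(t in `]0%R, 1%R[)
      (`|1 - t `^ ((s * p - 1) / p)| `^ p / (1 - t) `^ (1 + s * p))%:E)%E.

End sharp_constant.

(* Main.v *)
(** Write [l x] and [m x] for the last two coordinates of [x], and let
    [a = (s p - 1) / p]. Taking [G t] = [picG p t] and [K t] = [picK p t], with
    [K t = G t * t `^ (1 - p)] decreasing in [t], Picone's inequality says that
    [G t X^p - K t Y^p <= |X - Y|^p], with equality at [Y = t X]. With
    [t = (l y / l x)^a], integrating it over the slab [e l x <= l y <= (1 - e) l x]
    gives the sharp Hardy inequality as [e] tends to 0: the integrals in [y], resp.
    [x], of the two terms on the left reduce to integrals in the ratio [l y / l x].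

    For the remainder, on the set [box] of pairs with [l x] close to [5 l y] and
    [m x - m y] between [2 l y] and [3 l y] in absolute value, Picone's inequality
    is used with a slightly larger parameter than [t]. Compared with the original
    parameter this gains [h(y) (Y^p - theta X^p t^p)] with [theta] close to 1, for a
    weight [h = hw (m / l)], namely [max(1, |m / l|)^(- tau)], which dominates the
    weight of the theorem. After integration the gain in [Y] beats the loss in [X]
    because averaging [h] over the points [y] in the box of [x] multiplies it by
    [(1 + 2^(- tau)) / 2 < 1]: in one of the two horizontal directions [|m / l|] at
    least doubles. *)

Require Import Defs.
From HB Require Import structures.
From mathcomp Require Import all_boot all_order all_algebra.
From mathcomp Require Import all_classical all_reals all_analysis.
From mathcomp Require Import measurable_realfun ring lra.

Set Implicit Arguments.
Unset Strict Implicit.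
Unset Printing Implicit Defensive.

Import Order.TTheory GRing.Theory Num.Theory.
Import numFieldNormedType.Exports.

Local Open Scope classical_set_scope.
Local Open Scope ring_scope.

(** * Picone's inequality and the weight *)

(** The Hardy constant is sharp, so a gain weighted by a function of [l] alone cannot survive: with
    [h] constant, the gain in [Y] and the loss in [X] have essentially the same mass over the box.
    Only the horizontal variable [m] can break this tie. The number 5 serves that purpose: a walk
    [z -> 5 z +- w] with [w] in [2, 3] satisfies 5 |z| - 3 >= 2 |z| once |z| >= 1, and the shift
    alone reaches 2 when |z| <= 1. The slab is forced by the fact that the integrals of the [G] and
    [K] terms may diverge separately at ratio 1; only their combination |1 - t|^p enters the
    constant. Every inequality is therefore kept as a comparison of sums of nonnegative functions,
    and terms are cancelled only inside the slab, where they are finite. The cancellation also needs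
    a finite integral of |u|^p / l^(s p), which is what compact support provides. When s p = 1 the
    parameter [t] is 1 and the Hardy part vanishes, but [K] still drops strictly between two larger
    parameters, so the gain remains and the same estimate applies. *)

Section picone.
Variables (R : realType) (p : R).
Hypothesis p1 : 1 < p.
Implicit Types X Y t : R.

Definition pospow (z : R) : R := Num.max z 0 `^ (p - 1).

(** The odd power |1 - t|^(p - 2) (1 - t). At most one of the two terms is nonzero; they return as
    [phi1] and [phi2], integrated separately so that only nonnegative functions occur. *)
Definition picG t : R := pospow (1 - t) - pospow (t - 1).

Definition picK t : R := picG t * t `^ (1 - p).

Let p0 : 0 < p. Proof. exact: lt_trans ltr01 p1. Qed.
Let pm0 : 0 < p - 1. Proof. by rewrite subr_gt0. Qed.

Lemma pospow_ge0 z : 0 <= pospow z.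
Proof. exact: powR_ge0. Qed.

Lemma pospow_npos z : z <= 0 -> pospow z = 0.
Proof. by move=> z0; rewrite /pospow (max_idPr z0) powR0// gt_eqF. Qed.

Lemma pospow_nneg z : 0 <= z -> pospow z = z `^ (p - 1).
Proof. by move=> z0; rewrite /pospow (max_idPl z0). Qed.

Lemma pospow_le z w : z <= w -> pospow z <= pospow w.
Proof.
move=> zw; apply: ge0_ler_powR; rewrite ?nnegrE ?(ltW pm0)//.
- by rewrite le_max lexx orbT.
- by rewrite le_max lexx orbT.
- by rewrite ge_max !le_max zw lexx orbT.
Qed.

Lemma pospow_lt z w : 0 <= z -> z < w -> pospow z < pospow w.
Proof.
move=> z0 zw; rewrite !pospow_nneg ?(le_trans z0 (ltW zw))//.
by apply: gt0_ltr_powR; rewrite ?nnegrE// (le_trans z0 (ltW zw)).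
Qed.

Lemma powR_conv X Y t : 0 <= X -> 0 <= Y -> 0 <= t <= 1 ->
  ((1 - t) * X + t * Y) `^ p <= (1 - t) * X `^ p + t * Y `^ p.
Proof.
move=> X0 Y0 /andP[t0 t1].
have := @convex_powR R p (ltW p1) (Itv01 t0 t1) Y X.
rewrite !inE/= !in_itv/= !andbT => /(_ Y0 X0).
rewrite !convRE/= => H; have -> : (1 - t) * X + t * Y = t * Y + (1 - t) * X by ring.
by rewrite [leRHS]addrC.
Qed.

Lemma picK_lt1 t : 0 < t < 1 -> picK t = pospow (t^-1 - 1).
Proof.
move=> /andP[t0 t1]; rewrite /picK /picG (@pospow_npos (t - 1)) ?subr0; last lra.
have ti : 1 < t^-1 by rewrite invf_gt1.
rewrite !pospow_nneg; [|lra|lra].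
rewrite -(opprB p 1) powRN -powR_inv1 ?powR_ge0// -powRrM mulrN1 -(mulN1r (p - 1)).
rewrite powRrM powR_inv1 ?ltW// -powRM ?invr_ge0; [|lra|lra].
by congr (_ `^ _); field; rewrite gt_eqF.
Qed.

Lemma picK_gt1 t : 1 < t -> picK t = - pospow (1 - t^-1).
Proof.
move=> t1; rewrite /picK /picG (@pospow_npos (1 - t)) ?sub0r; last lra.
have t0 : 0 < t by lra.
have ti : t^-1 < 1 by rewrite invf_lt1.
rewrite !pospow_nneg; [|lra|lra].
rewrite -(opprB p 1) powRN -powR_inv1 ?powR_ge0// -powRrM mulrN1 -(mulN1r (p - 1)).
rewrite powRrM powR_inv1 ?ltW// mulNr -powRM ?invr_ge0; [|lra|lra].
by congr (- (_ `^ _)); field; rewrite gt_eqF.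
Qed.

Lemma picK1 : picK 1 = 0.
Proof. by rewrite /picK /picG !subrr mul0r. Qed.

Lemma picG1 : picG 1 = 0.
Proof. by rewrite /picG !subrr. Qed.

(** In [picK_lt1] and [picK_gt1] the variable enters only through [t^-1], inside an increasing
    power, and 1 separates the positive values from the negative ones. Strictness is what makes
    [gain] positive. *)
Lemma picK_decr t t' : 0 < t -> t < t' -> picK t' < picK t.
Proof.
move=> t0 tt'; have t'0 := lt_trans t0 tt'.
have itt' : t'^-1 < t^-1 by rewrite ltf_pV2.
have Kle1 (s : R) : 0 < s < 1 -> 0 < picK s.
  move=> s01; rewrite picK_lt1//; rewrite -(@pospow_npos 0)//.
  by apply: pospow_lt => //; rewrite subr_gt0 invf_gt1; lra.
have Kge1 s : 1 < s -> picK s < 0.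
  move=> s1; rewrite picK_gt1// oppr_lt0 -(@pospow_npos 0)//.
  by apply: pospow_lt => //; rewrite subr_gt0 invf_lt1; lra.
have [t1|t1|t1] := ltgtP t 1; last first.
- by rewrite t1 picK1; apply: Kge1; rewrite -t1.
- rewrite (picK_gt1 t1) picK_gt1 ?(lt_trans t1)// ltrN2.
  apply: pospow_lt; last lra.
  by rewrite subr_ge0 invf_le1 ?ltW.
have [t'1|t'1|t'1] := ltgtP t' 1; last first.
- by rewrite t'1 picK1; apply: Kle1; rewrite t0.
- by apply: (lt_trans (Kge1 _ t'1)); apply: Kle1; rewrite t0.
rewrite !picK_lt1 ?t0 ?t'0 ?t'1//; apply: pospow_lt; last lra.
by rewrite subr_ge0 invf_ge1// ltW.
Qed.

(** Since [K t] times t^p is [G t] times t, the right side is [G t] times 1 - t. This is the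
    equality case X = 1, Y = t of Picone's inequality, and the source of the sharp constant. *)
Lemma picG_eq t : 0 < t -> `|1 - t| `^ p = picG t - picK t * t `^ p.
Proof.
move=> t0; rewrite /picK -mulrA -powRD; last by rewrite (gt_eqF t0) implybT.
rewrite subrK powRr1 ?ltW//.
rewrite (_ : picG t - _ = picG t * (1 - t)); last by rewrite mulrBr mulr1.
rewrite /picG.
have [t1|t1|->] := ltgtP t 1.
- rewrite (@pospow_npos (t - 1)) ?subr0; last lra.
  rewrite pospow_nneg ?subr_ge0 ?ltW// ger0_norm ?subr_ge0 ?ltW//.
  by rewrite [RHS]mulrC mulr_powRB1// subr_ge0 ltW.
- rewrite (@pospow_npos (1 - t)) ?sub0r; last lra.
  rewrite pospow_nneg ?subr_ge0 ?ltW// distrC ger0_norm ?subr_ge0 ?ltW//.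
  by rewrite mulNr -mulrN opprB [RHS]mulrC mulr_powRB1// subr_ge0 ltW.
- by rewrite !subrr normr0 powR0 ?gt_eqF// mulr0.
Qed.

Let picone_lt1 X Y t : 0 <= X -> 0 <= Y -> 0 < t < 1 ->
  (1 - t) `^ (p - 1) * X `^ p <=
  `|X - Y| `^ p + (1 - t) `^ (p - 1) * t `^ (1 - p) * Y `^ p.
Proof.
move=> X0 Y0 /andP[t0 t1].
have s0 : 0 < 1 - t by rewrite subr_gt0.
have := @powR_conv (`|X - Y| / (1 - t)) (Y / t) t.
rewrite (ltW t0) (ltW t1) !divr_ge0// ?(ltW t0) ?(ltW s0)// => /(_ isT isT isT).
rewrite (mulrC (1 - t)) divfK ?gt_eqF// (mulrC t) divfK ?gt_eqF//.
(* The triangle inequality brings in the absolute value, so both signs of X - Y are covered at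
   once. *)
have XY : X `^ p <= (`|X - Y| + Y) `^ p.
  apply: ge0_ler_powR; rewrite ?nnegrE ?addr_ge0 ?(ltW p0)//.
  by rewrite -lerBlDr ler_norm.
move=> /(le_trans XY); rewrite !powRM ?invr_ge0// ?(ltW t0) ?(ltW s0)//.
have pE z : 0 < z -> z * (z^-1) `^ p = z `^ (1 - p).
  move=> z0; rewrite -powR_inv1 ?ltW// -powRrM mulN1r.
  by rewrite -{1}(powRr1 (ltW z0)) -powRD// (gt_eqF z0) implybT.
rewrite mulrCA pE// mulrCA pE// => H.
have := ler_wpM2l (powR_ge0 (1 - t) (p - 1)) H; rewrite mulrDr.
rewrite mulrCA -powRD ?(gt_eqF s0) ?implybT//.
rewrite (_ : p - 1 + (1 - p) = 0); last by ring.
rewrite powRr0 mulr1.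
by move=> ?; rewrite -mulrA [_ * Y `^ p]mulrC.
Qed.

(** Convexity of [z `^ p] on [X = (1 - t) ((X - Y) / (1 - t)) + t (Y / t)];
    the case [1 < t] is the case [t^-1] with [X] and [Y] exchanged. *)
Lemma picone X Y t : 0 <= X -> 0 <= Y -> 0 < t ->
  picG t * X `^ p - picK t * Y `^ p <= `|X - Y| `^ p.
Proof.
move=> X0 Y0 t0; have [t1|t1|->] := ltgtP t 1.
- have t01 : 0 < t < 1 by rewrite t0.
  have := picone_lt1 X0 Y0 t01; rewrite lerBlDr.
  rewrite /picK /picG (@pospow_npos (t - 1)) ?subr0; last lra.
  by rewrite pospow_nneg// subr_ge0 ltW.
- have ti : 0 < t^-1 < 1 by rewrite invr_gt0 t0 invf_lt1.
  have := picone_lt1 Y0 X0 ti; rewrite distrC picK_gt1//.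
  rewrite pospow_nneg; last lra.
  rewrite /picG (@pospow_npos (1 - t)) ?sub0r; last lra.
  rewrite pospow_nneg; last lra.
  have -> : (1 - t^-1) `^ (p - 1) * t^-1 `^ (1 - p) = (t - 1) `^ (p - 1).
    have -> : t^-1 `^ (1 - p) = t `^ (p - 1).
      by rewrite -powR_inv1 ?ltW// -powRrM; congr (_ `^ _); ring.
    rewrite -powRM; try lra.
    by congr (_ `^ _); field; rewrite gt_eqF.
  by move=> ?; lra.
- by rewrite picG1 picK1 !mul0r subrr powR_ge0.
Qed.

(** Picone's inequality at the parameter [t'] instead of [t]; the identity
    [picG_eq] at [t'] bounds the loss in [picG] by the gain in [picK]. *)
Lemma picone_gain X Y t t2 t' th c : 0 <= X -> 0 <= Y -> 0 < t ->
  t <= t2 -> t2 < t' -> t' <= th * t -> 0 <= c <= picK t2 - picK t' ->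
  c * (Y `^ p - th `^ p * t `^ p * X `^ p) + picG t * X `^ p - picK t * Y `^ p
  <= `|X - Y| `^ p.
Proof.
move=> X0 Y0 t0 tt2 t2t' t'th /andP[c0 cK].
set B := Y `^ p - _.
(* In this case the term in [c] only lowers the left side, and Picone at [t] itself suffices. *)
have [B0|B0] := leP B 0.
  apply: le_trans (picone X0 Y0 t0); rewrite -addrA gerDr.
  exact: mulr_ge0_le0.
have tt' : t < t' := le_lt_trans tt2 t2t'.
have t'0 : 0 < t' := lt_trans t0 tt'.
have Kt : picK t2 <= picK t.
  by move: tt2; rewrite le_eqVlt => /predU1P[->//|/(picK_decr t0)/ltW].
apply: le_trans (picone X0 Y0 t'0).
(* Picone at the parameter [t] for the pair (1, t'), which is an equality pair for the parameter
   [t']. *)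
have GK : picG t - picG t' <= (picK t - picK t') * t' `^ p.
  have := @picone 1 t' t ler01 (ltW t'0) t0; rewrite picG_eq// powR1 /=; lra.
have t'p : t' `^ p <= th `^ p * t `^ p.
  have th0 : 0 <= th by rewrite -(pmulr_lge0 _ t0) (le_trans (ltW t'0)).
  by rewrite -powRM ?(ltW t0)//; apply: ge0_ler_powR; rewrite ?nnegrE ?mulr_ge0// ?ltW.
have GK' : (picG t - picG t') * X `^ p <=
    (picK t - picK t') * (th `^ p * t `^ p * X `^ p).
  rewrite mulrA; apply: ler_wpM2r; first exact: powR_ge0.
  apply: le_trans GK _; apply: ler_wpM2l => //; lra.
have cB : c * B <= (picK t - picK t') * B.
  by apply: ler_wpM2r; [exact: ltW|lra].
rewrite /B in cB *; lra.
Qed.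

End picone.

Section weight.
Variables (R : realType) (tau : R).
Hypothesis tau0 : 0 < tau.
Implicit Types z w L : R.

Definition hw z : R := Num.max 1 `|z| `^ (- tau).

Lemma hw_gt0 z : 0 < hw z.
Proof. by rewrite powR_gt0// lt_max ltr01. Qed.

Lemma hw_le z w : Num.max 1 `|z| <= Num.max 1 `|w| -> hw w <= hw z.
Proof.
have m0 (x : R) : 0 < Num.max 1 `|x| by rewrite lt_max ltr01.
move=> zw; rewrite /hw !powRN lef_pV2 ?posrE ?powR_gt0//.
by apply: ge0_ler_powR; rewrite ?nnegrE// ltW// m0.
Qed.

Lemma hw_le1 z : hw z <= 1.
Proof.
rewrite -[leRHS](_ : hw 0 = 1); first by apply: hw_le; rewrite normr0 ge_max !le_max lexx ler01.
by rewrite /hw normr0 (max_idPl _)// powR1.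
Qed.

Lemma hw_double z w : 2 * Num.max 1 `|z| <= `|w| -> hw w <= 2 `^ (- tau) * hw z.
Proof.
move=> zw; have m0 (x : R) : 0 < Num.max 1 `|x| by rewrite lt_max ltr01.
rewrite /hw -powRM ?(ltW (m0 _))// !powRN lef_pV2 ?posrE ?powR_gt0 ?mulr_gt0//.
apply: ge0_ler_powR; rewrite ?nnegrE ?mulr_ge0 ?(ltW tau0) ?(ltW (m0 _))//.
by rewrite le_max zw orbT.
Qed.

(** The walk [z -> L z +- w] at least doubles [`|z|] in one of its two directions,
    whence the loss of a factor. The bounds [a], [b] do not depend on [w], so that
    both can be integrated. *)
Lemma hw_pair L z : 5 <= L -> exists a b : R,
  [/\ a + b <= (1 + 2 `^ (- tau)) * hw z,
      forall w, 2 <= w <= 3 -> hw (L * z + w) <= a &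
      forall w, 2 <= w <= 3 -> hw (L * z - w) <= b].
Proof.
move=> L5; set e := 2 `^ (- tau).
have e1 : e <= 1.
  rewrite /e powRN invf_le1 ?powR_gt0// -[leLHS](powRr0 (2 : R)).
  by apply: ler_powR; rewrite ?ler1n// ltW.
have e0 : 0 < e by rewrite powR_gt0.
have hz0 := hw_gt0 z.
(* For |z| > 1 both directions double, by 5 |z| - 3 >= 2 |z|. For |z| <= 1 the direction given by
   the sign of [z] is sure to, because the shift alone is at least 2 there; the other one gets the
   trivial bound 1. *)
have [z1|z1] := leP `|z| 1; last first.
  exists (e * hw z), (e * hw z); split.
  - by rewrite -mulrDl ler_pM2r// lerD2r.
  - move=> w w23; apply: hw_double; rewrite (max_idPr (ltW z1)).
    move: z1; case: (ger0P z) => z0 z1; case: (ger0P (L * z + w)) => H; nra.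
  - move=> w w23; apply: hw_double; rewrite (max_idPr (ltW z1)).
    move: z1; case: (ger0P z) => z0 z1; case: (ger0P (L * z - w)) => H; nra.
have hz1 : hw z = 1 by rewrite /hw (max_idPl z1) powR1.
have [z0|z0] := leP 0 z.
  exists e, 1; split => [|w w23|w w23]; [by rewrite hz1 mulr1 addrC| |exact: hw_le1].
  rewrite -[e]mulr1 -hz1; apply: hw_double; rewrite (max_idPl z1).
  by case: (ger0P (L * z + w)) => H; nra.
exists 1, e; split => [|w w23|w w23]; [by rewrite hz1 mulr1|exact: hw_le1|].
rewrite -[e]mulr1 -hz1; apply: hw_double; rewrite (max_idPl z1).
by case: (ger0P (L * z - w)) => H; nra.
Qed.

End weight.

(** * One-dimensional integrals *)

Section measurable_comp.
Context d (T : measurableType d) (R : realType).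
Implicit Types f g : T -> R.

Lemma measurable_fun_powR D f (a : R) : measurable_fun D f ->
  measurable_fun D (fun x => f x `^ a).
Proof. by move=> mf; exact: (measurableT_comp (measurable_powR a)). Qed.

Lemma measurable_fun_expR D f : measurable_fun D f ->
  measurable_fun D (fun x => expR (f x)).
Proof. by move=> mf; exact: (measurableT_comp (@measurable_expR R)). Qed.

Lemma measurable_fun_normr D f : measurable_fun D f ->
  measurable_fun D (fun x => `|f x|).
Proof. by move=> mf; apply: measurableT_comp => //; exact: normr_measurable. Qed.

End measurable_comp.

Section ge0_integral.
Context d (T : measurableType d) (R : realType) (mu : {measure set T -> \bar R}).
Local Open Scope ereal_scope.

Lemma ge0_integral_fctZ (k : R) (f : T -> R) : (0 <= k)%R ->
  measurable_fun setT f -> (forall x, (0 <= f x)%R) ->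
  \int[mu]_x (k * f x)%:E = k%:E * \int[mu]_x (f x)%:E.
Proof.
move=> k0 mf f0; under eq_integral do rewrite EFinM.
rewrite ge0_integralZl_EFin//; first by move=> x _; rewrite lee_fin.
exact/measurable_EFinP.
Qed.

Lemma ge0_integral_fctD (f g : T -> R) :
  measurable_fun setT f -> (forall x, (0 <= f x)%R) ->
  measurable_fun setT g -> (forall x, (0 <= g x)%R) ->
  \int[mu]_x (f x + g x)%:E = \int[mu]_x (f x)%:E + \int[mu]_x (g x)%:E.
Proof.
move=> mf f0 mg g0; under eq_integral do rewrite EFinD.
rewrite ge0_integralD//; try exact/measurable_EFinP.
- by move=> x _; rewrite lee_fin.
- by move=> x _; rewrite lee_fin.
Qed.

Lemma ge0_integral_fct_le (f g : T -> R) :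
  measurable_fun setT f -> (forall x, (0 <= f x)%R) ->
  measurable_fun setT g -> (forall x, (f x <= g x)%R) ->
  \int[mu]_x (f x)%:E <= \int[mu]_x (g x)%:E.
Proof.
move=> mf f0 mg fg; apply: ge0_le_integral => //.
- by move=> x _; rewrite lee_fin.
- exact/measurable_EFinP.
- exact/measurable_EFinP.
- by move=> x _; rewrite lee_fin.
Qed.

End ge0_integral.

(** Measurability by recursion on the body of the function. The clauses on partially applied
    operations catch the eta-reduced functions that earlier steps leave behind. *)
Ltac mfun_step :=
  match goal with
  | |- measurable_fun _ _ => first [ assumption | exact: measurable_cst
      | exact: measurable_id | exact: measurable_fst | exact: measurable_snd ]
  | |- measurable_fun _ (fun x => EFin (@?f x)) =>
      apply: (measurableT_comp (@EFin_measurable _ _))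
  | |- measurable_fun _ (fun x => @?f x && @?g x) => apply: measurable_and
  | |- measurable_fun _ (fun x => (@?f x < @?g x)%R) => apply: measurable_fun_ltr
  | |- measurable_fun _ (fun x => (@?f x <= @?g x)%R) => apply: measurable_fun_ler
  | |- measurable_fun _ (fun x => powR (@?f x) _) => apply: measurable_fun_powR
  | |- measurable_fun _ (fun x => expR (@?f x)) => apply: measurable_fun_expR
  | |- measurable_fun _ (fun x => Num.norm (@?f x)) => apply: measurable_fun_normr
  | |- measurable_fun _ (fun x => Num.max (@?f x) (@?g x)) => apply: measurable_maxr
  | |- measurable_fun _ (fun x => (@?f x ^+ _)%R) => apply: measurable_funX
  | |- measurable_fun _ (fun x => (@?f x - @?g x)%R) => apply: measurable_funB
  | |- measurable_fun _ (fun x => (- @?f x)%R) => apply: measurable_funN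
  | |- measurable_fun _ (fun x => (@?f x + @?g x)%R) => apply: measurable_funD
  | |- measurable_fun _ (fun x => (@?f x * @?g x)%R) => apply: measurable_funM
  | |- measurable_fun _ (@Order.lt _ _ ?a) =>
      apply: (measurable_fun_ltr (f := cst a) (g := id))
  | |- measurable_fun _ (@Order.le _ _ ?a) =>
      apply: (measurable_fun_ler (f := cst a) (g := id))
  | |- measurable_fun _ ( *%R ?a) => exact: mulrl_measurable
  | |- measurable_fun _ ( -%R) => exact: oppr_measurable
  | |- measurable_fun _ ( +%R ?a) => apply: (measurable_funD (f := cst a) (g := id))
  | |- measurable_fun _ _ => apply: measurable_fun_ifT
  end.

Ltac mfun := repeat mfun_step.

Section lebesgue_scale.
Variable R : realType.
Notation mu := (@lebesgue_measure R).
Local Open Scope ereal_scope.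

Let scaleR (c : R) : measurableTypeR R -> measurableTypeR R := fun x => (c * x)%R.

Let mscaleR c : measurable_fun setT (scaleR c).
Proof. exact: (@mulrl_measurable R setT c). Qed.

(** Uniqueness of Lebesgue measure: [c] times its image under multiplication by [c] gives half-open
    intervals their length. *)
Lemma ge0_integral_scale (c : R) (f : R -> \bar R) : (0 < c)%R ->
  measurable_fun setT f -> (forall x, 0 <= f x) ->
  \int[mu]_x f x = c%:E * \int[mu]_x f (c * x)%R.
Proof.
move=> c0 mf f0.
pose P := measure_function_pushforward__canonical__measure_function_Measure
  mu (@mscaleR c).
pose nu := mscale (NngNum (ltW c0)) P.
have muE A : measurable A -> mu A = nu A.
  apply: lebesgue_measure_unique => _ [[a b]] _ <-.
  have E : pushforward mu (scaleR c) `]a, b] = mu `](a / c)%R, (b / c)%R].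
    congr (mu _); apply/seteqP; split => x /=;
      by rewrite !in_itv/= ltr_pdivrMr// ler_pdivlMr// /scaleR mulrC.
  change (mu `]a, b] = c%:E * pushforward mu (scaleR c) `]a, b]).
  rewrite E !lebesgue_measure_itv/= !lte_fin ltr_pM2r ?invr_gt0//.
  case: ifP => _; last by rewrite mule0.
  rewrite -!EFinD -EFinM; congr (_%:E); field; exact: lt0r_neq0.
transitivity (\int[nu]_x f x).
  by apply: eq_measure_integral => A mA _; exact: muE.
rewrite ge0_integral_mscale//=; congr (_ * _).
by rewrite ge0_integral_pushforward// preimage_setT.
Qed.

End lebesgue_scale.

(** * The Gamma function and Gaussian integrals *)

Section Gamma_facts.
Variable R : realType.
Notation mu := (@lebesgue_measure R).
Implicit Types a b q s z A L : R.

Let gfun z A (t : R) : R := if 0 < t then t `^ (z - 1) * expR (- (t * A)) else 0.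

Let measurable_gfun z A : measurable_fun setT (gfun z A).
Proof. by rewrite /gfun; mfun. Qed.

Let gfun_ge0 z A t : 0 <= gfun z A t.
Proof. by rewrite /gfun; case: ifP => // _; rewrite mulr_ge0 ?powR_ge0 ?expR_ge0. Qed.

(** The fundamental theorem of calculus is applied away from 0, on intervals exhausting ]0, L]; the
    primitive bounds all their integrals by its value at [L]. The shift by 2 keeps the left endpoint
    strictly below [L]. *)
Lemma integral_powR_lty a L : -1 < a -> 0 < L ->
  (\int[mu]_t (if 0 < t <= L then t `^ a else 0)%:E < +oo)%E.
Proof.
move=> a1 L0; have a10 : 0 < a + 1 by lra.
pose F (n : nat) := `[L / n.+2%:R, L]%classic : set R.
have Fn0 n : 0 < L / n.+2%:R by rewrite divr_gt0.
have -> : (\int[mu]_t (if 0 < t <= L then t `^ a else 0)%:E =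
    \int[mu]_(t in \bigcup_n F n) (t `^ a)%:E)%E.
  rewrite [RHS]integral_mkcond; apply: eq_integral => t _; rewrite patchE.
  case: ifPn => [/andP[t0 tL]|H].
    rewrite mem_set//; exists (Num.trunc (L / t)) => //.
    rewrite /F/= in_itv/= tL andbT ler_pdivrMr// mulrC -ler_pdivrMr//.
    rewrite -natr1 (le_trans (ltW (truncnS_gt _)))// -natr1 lerDl//.
  rewrite memNset// => -[n _]; rewrite /F/= in_itv/= => /andP[t0 tL].
  by move/negP : H; apply; rewrite tL (lt_le_trans (Fn0 n)).
have H : (fun n => \int[mu]_(t in F n) (t `^ a)%:E)%E @ \oo -->
    (\int[mu]_(t in \bigcup_n F n) (t `^ a)%:E)%E.
  apply: ge0_nondecreasing_set_cvg_integral => //.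
  - move=> m n mn; rewrite subsetEset /F; apply: subset_itvr; rewrite bnd_simp.
    by rewrite ler_pM2l// lef_pV2 ?posrE// ler_nat.
  - by move=> n; rewrite /F; exact: measurable_itv.
  - move=> n; apply/measurable_EFinP; apply: (@measurable_funS _ _ _ _ setT) => //.
  - by move=> n t _; rewrite lee_fin powR_ge0.
rewrite -(cvg_lim _ H)//; apply: (@le_lt_trans _ _ (L `^ (a + 1) / (a + 1))%:E); last exact: ltry.
apply: lime_le; first by apply/cvg_ex; exists (\int[mu]_(t in \bigcup_n F n) (t `^ a)%:E)%E.
apply: nearW => n.
have nL : L / n.+2%:R < L by rewrite ltr_pdivrMr// ltr_pMr// ltr1n.
pose G (t : R) := t `^ (a + 1) / (a + 1).
have dG (t : R) : 0 < t -> is_derive t 1 G (t `^ a).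
  move=> t0; rewrite /G; have := is_derive1_powR (a + 1) t0; rewrite addrK => H1.
  have -> : (fun t => t `^ (a + 1) / (a + 1)) =
     (a + 1)^-1 \*: ((fun x => x `^ (a + 1)) : R -> R^o).
    by apply/funext => x; rewrite mulrC.
  have H2 := @is_deriveZ _ _ _ (fun x : R => x `^ (a + 1) : R^o) (a + 1)^-1 t 1 _ H1.
  apply: is_derive_eq H2 _.
  by rewrite /GRing.scale/= mulrA mulVf ?mul1r// gt_eqF.
have cG (t : R) : 0 < t -> {for t, continuous G}.
  move=> t0; apply: differentiable_continuous; apply/derivable1_diffP.
  by apply: ex_derive; exact: dG.
rewrite /F (@continuous_FTC2 _ (fun t => t `^ a) G)//.
- rewrite -EFinB lee_fin /G gerBl divr_ge0 ?powR_ge0 ?ltW//.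
- apply: continuous_in_subspaceT => t; rewrite inE/= in_itv/= => /andP[t0 _].
  apply: differentiable_continuous; apply/derivable1_diffP.
  by apply: derivable_powR; rewrite in_itv/= andbT (lt_le_trans (Fn0 n)).
- split.
  + move=> t; rewrite in_itv/= => /andP[t0 _]; apply: ex_derive.
    by apply: dG; exact: lt_trans (Fn0 n) t0.
  + by apply: cvg_at_right_filter; exact: cG.
  + by apply: cvg_at_left_filter; exact: cG.
- move=> t; rewrite in_itv/= => /andP[t0 _]; rewrite derive1E.
  by have [_ ->] := dG _ (lt_trans (Fn0 n) t0).
Qed.

(** The inequality ln x <= x - 1 at x = t / (2 z) bounds z ln t by t / 2 plus a constant: half of
    the exponential decay absorbs the power. *)
Lemma powR_expR_bound z : 0 < z -> exists2 C : R, 0 < C &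
  forall t, 1 <= t -> t `^ (z - 1) * expR (- t) <= C * expR (- 2^-1 * t).
Proof.
move=> z0; exists (expR (z * ln (2 * z))); first exact: expR_gt0.
move=> t t1; have t0 : 0 < t by lra.
apply: (@le_trans _ _ (t `^ z * expR (- t))).
  by rewrite ler_wpM2r ?expR_ge0//; apply: ler_powR => //; lra.
rewrite /powR gt_eqF// -!expRD ler_expR.
have z20 : 0 < 2 * z by lra.
have : ln (t / (2 * z)) <= t / (2 * z) - 1.
  have := @le_ln1Dx _ (t / (2 * z) - 1); rewrite addrCA subrr addr0; apply.
  by rewrite ltrBrDr addNr divr_gt0.
rewrite ln_div ?posrE// => H.
have : z * (ln t - ln (2 * z)) <= z * (t / (2 * z) - 1) by rewrite ler_wpM2l// ltW.
have -> : z * (t / (2 * z) - 1) = t / 2 - z by field; rewrite gt_eqF.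
lra.
Qed.

(** Cut at 1: below, the power alone is integrable; above, the integrand is at most a multiple of
    the exponential density of rate 1/2, of total mass 1. *)
Lemma Gamma_integral_lty z : 0 < z -> (\int[mu]_t (gfun z 1 t)%:E < +oo)%E.
Proof.
move=> z0; have [C C0 HC] := powR_expR_bound z0.
pose f1 (t : R) := if 0 < t <= 1 then t `^ (z - 1) else 0.
pose f2 (t : R) := 2 * C * exponential_pdf 2^-1 t.
have half0 : 0 <= 2^-1 :> R by rewrite invr_ge0.
have f10 t : 0 <= f1 t by rewrite /f1; case: ifP => // _; exact: powR_ge0.
have f20 t : 0 <= f2 t.
  by rewrite /f2 mulr_ge0// ?mulr_ge0 ?(ltW C0)//; exact: exponential_pdf_ge0.
have mf1 : measurable_fun setT f1.
  by rewrite /f1; mfun.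
have mf2 : measurable_fun setT f2.
  by apply: measurable_funM => //; exact: measurable_exponential_pdf.
apply: (@le_lt_trans _ _ (\int[mu]_t (f1 t + f2 t)%:E)%E).
  apply: ge0_integral_fct_le => //; first exact: measurable_gfun.
    exact: measurable_funD.
  move=> t; rewrite /gfun; case: ifPn => [t0|_]; last by rewrite addr_ge0.
  have [t1|t1] := leP t 1.
    rewrite ler_wpDr// /f1 t0 t1/= ler_piMr ?powR_ge0//.
    by rewrite -[leRHS]expR0 ler_expR; lra.
  rewrite ler_wpDl// mulr1 (le_trans (HC _ (ltW t1)))// /f2.
  rewrite exponential_pdfE; last exact: ltW.
  have -> : 2 * C * (2^-1 * expR (- 2^-1 * t)) = C * expR (- 2^-1 * t) by field.
  by [].
rewrite ge0_integral_fctD//.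
rewrite lte_add_pinfty//; first by apply: integral_powR_lty => //; lra.
rewrite /f2 ge0_integral_fctZ//; last 3 first.
- by rewrite mulr_ge0// ltW.
- exact: measurable_exponential_pdf.
- by move=> t; exact: exponential_pdf_ge0.
by rewrite integral_exponential_pdf ?invr_gt0// mule1 ltry.
Qed.

(** [Gamma] is the finite part of its integral, so finiteness is needed before the two can be
    identified. *)
Lemma Gamma_integralE z : 0 < z -> (\int[mu]_t (gfun z 1 t)%:E = (Gamma z)%:E)%E.
Proof.
move=> z0; rewrite /Gamma /Rintegral.
rewrite (_ : (\int[mu]_(t in _) _)%E = \int[mu]_t (gfun z 1 t)%:E)%E.
  rewrite fineK// ge0_fin_numE ?Gamma_integral_lty//.
  by apply: integral_ge0 => t _; rewrite lee_fin.
rewrite integral_mkcond; apply: eq_integral => t _; rewrite patchE /gfun mulr1.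
by rewrite mem_setE in_itv/= andbT; case: ifP.
Qed.

Lemma Gamma_gt0 z : 0 < z -> 0 < Gamma z.
Proof.
move=> z0; rewrite -lte_fin -Gamma_integralE//.
have [c c0 Hc] : exists2 c : R, 0 < c & forall t, 1 <= t <= 2 -> c <= gfun z 1 t.
  exists (expR (- 2) * Num.min 1 (2 `^ (z - 1))).
    by rewrite mulr_gt0 ?expR_gt0// lt_min ltr01 powR_gt0.
  move=> t /andP[t1 t2]; rewrite /gfun (lt_le_trans ltr01 t1) mulr1 mulrC.
  apply: ler_pM; rewrite ?expR_ge0//.

  - have [z1|z1] := leP 1 z.
      rewrite ge_min -[X in X <= _](congr1 (@^~ (z - 1)) (@powR1 R)); apply/orP; left.
      by apply: ge0_ler_powR; rewrite ?nnegrE; lra.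
    rewrite ge_min; apply/orP; right.
    have e x : x `^ (z - 1) = (x `^ (1 - z))^-1 by rewrite -powRN opprB.
    rewrite !e lef_pV2 ?posrE ?powR_gt0 ?(lt_le_trans ltr01 t1)//.
    by apply: ge0_ler_powR; rewrite ?nnegrE; lra.
  - by rewrite ler_expR; lra.
apply: (@lt_le_trans _ _ (\int[mu]_(t in `[1%R, 2%R]) (c%:E))%E).
  rewrite integral_cst//= lebesgue_measure_itv/= lte_fin ltr1n/= -EFinB -EFinM lte_fin.
  by rewrite mulr_gt0//; lra.
apply: (@le_trans _ _ (\int[mu]_(t in `[1%R, 2%R]) (gfun z 1 t)%:E)%E).
  apply: ge0_le_integral => //=.
  - by move=> t _; rewrite lee_fin ltW.
  - by apply/measurable_EFinP; apply: measurable_funTS; exact: measurable_gfun.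
apply: ge0_subset_integral => //=.
  by apply/measurable_EFinP; exact: measurable_gfun.
by move=> x _; rewrite lee_fin.
Qed.

Lemma Gamma_integral_scale z A : 0 < z -> 0 < A ->
  (\int[mu]_t (gfun z A t)%:E = (A `^ (- z) * Gamma z)%:E)%E.
Proof.
move=> z0 A0; rewrite [RHS]EFinM -Gamma_integralE//.
rewrite (ge0_integral_scale A0 (f := fun t => (gfun z 1 t)%:E)); last 2 first.
- exact/measurable_EFinP.
- by move=> t; rewrite lee_fin.
rewrite muleA -EFinM.
have -> : (fun t => (gfun z 1 (A * t))%:E) =
    (fun t => (A `^ (z - 1) * gfun z A t)%:E)%E.
  apply/funext => t; rewrite /gfun pmulr_rgt0//; case: ifPn => [t0|_].
    by rewrite powRM ?ltW// mulr1 (mulrC A t) mulrA.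
  by rewrite mulr0.
rewrite ge0_integral_fctZ ?powR_ge0//; last exact: measurable_gfun.
rewrite !muleA -!EFinM [X in X%:E](_ : _ = 1) ?mul1e//.
rewrite -mulrA mulr_powRB1 ?ltW// -powRD ?addNr ?powRr0//.
by rewrite (gt_eqF A0) implybT.
Qed.

(** The integrand is a multiple of the normal density of mean [b] and variance 1 / (2 s), whose
    total mass is 1. *)
Lemma integral_gauss_shift b s : 0 < s ->
  (\int[mu]_t (expR (- (s * (b - t) ^+ 2)))%:E = (Num.sqrt pi * s `^ (- 2^-1))%:E)%E.
Proof.
move=> s0; pose sg := Num.sqrt ((2 * s)^-1).
have s20 : 0 < (2 * s)^-1 by rewrite invr_gt0 mulr_gt0.
have sg0 : sg != 0 by rewrite gt_eqF// sqrtr_gt0.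
have sg2 : sg ^+ 2 = (2 * s)^-1 by rewrite sqr_sqrtr// ltW.
have pk : normal_peak sg = (Num.sqrt pi * s `^ (- 2^-1))^-1.
  rewrite /normal_peak sg2; congr (_^-1).
  have -> : (2 * s)^-1 * pi *+ 2 = pi / s by rewrite -mulr_natr; field; rewrite gt_eqF.
  rewrite sqrtrM ?pi_ge0//; congr (_ * _).
  by rewrite powRN powR12_sqrt ?(ltW s0)// sqrtrV// ltW.
have D0 : 0 < Num.sqrt pi * s `^ (- 2^-1) :> R.
  by rewrite mulr_gt0 ?sqrtr_gt0 ?pi_gt0 ?powR_gt0.
have -> : (fun t => (expR (- (s * (b - t) ^+ 2)))%:E) =
    (fun t => (Num.sqrt pi * s `^ (- 2^-1) * normal_pdf b sg t)%:E).
  apply/funext => t; rewrite /normal_pdf (negbTE sg0) /normal_fun pk.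
  rewrite mulVKf ?gt_eqF//; congr ((expR _)%:E).
  rewrite sg2 -[(b - t) ^+ 2]sqrrN opprB -mulr_natr; field.
  by rewrite gt_eqF.
rewrite ge0_integral_fctZ//; last 3 first.
- exact: ltW.
- exact: measurable_normal_pdf.
- by move=> t; exact: normal_pdf_ge0.
by rewrite integral_normal_pdf mule1.
Qed.

(** [((b - t)^2 + A) `^ (- q)] is a Gamma integral; exchanging the integrals makes
    the integral in [t] Gaussian. *)
Lemma integral_japanese b q A : 2^-1 < q -> 0 < A ->
  (\int[mu]_t (((b - t) ^+ 2 + A) `^ (- q))%:E =
   (Num.sqrt pi * (Gamma (q - 2^-1) / Gamma q) * A `^ (- (q - 2^-1)))%:E)%E.
Proof.
move=> q2 A0; have q0 : 0 < q by lra.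
have q20 : 0 < q - 2^-1 by lra.
have Gq := Gamma_gt0 q0.
pose f (z : measurableTypeR R * measurableTypeR R) :=
  ((Gamma q)^-1 * gfun q ((b - z.1) ^+ 2 + A) z.2)%:E.
have f0 (z : measurableTypeR R * measurableTypeR R) : (0 <= f z)%E by rewrite lee_fin mulr_ge0// invr_ge0 ltW.
have mf : measurable_fun setT f.
  by rewrite /f /gfun; mfun.
transitivity (\int[mu]_x \int[mu]_y f (x, y))%E.
  apply: eq_integral => t _; rewrite /f/=.
  rewrite ge0_integral_fctZ//; last 2 first.
  - by rewrite invr_ge0 ltW.
  - exact: measurable_gfun.
  rewrite Gamma_integral_scale//; last by rewrite ltr_wpDl// sqr_ge0.
  by rewrite -EFinM mulrCA mulVf ?mulr1// gt_eqF.
rewrite (fubini_tonelli f)//.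
transitivity (\int[mu]_s ((Gamma q)^-1 * Num.sqrt pi * gfun (q - 2^-1) A s)%:E)%E.
  apply: eq_integral => s _; rewrite /f/= /gfun.
  case: ifPn => [s0|_]; last by rewrite !mulr0 integral0.
  have -> : (fun x : R => ((Gamma q)^-1 * (s `^ (q - 1) * expR (- (s * ((b - x) ^+ 2 + A)))))%:E) =
    (fun x => ((Gamma q)^-1 * (s `^ (q - 1) * expR (- (s * A))) *
               expR (- (s * (b - x) ^+ 2)))%:E).
    apply/funext => x; congr (_%:E).
    by rewrite mulrDr opprD expRD; ring.
  rewrite ge0_integral_fctZ//; last 2 first.
  - by rewrite mulr_ge0 ?invr_ge0 ?(ltW Gq)// mulr_ge0 ?powR_ge0 ?expR_ge0.
  - by mfun.
  rewrite integral_gauss_shift// -!EFinM; congr (_%:E).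
  rewrite (_ : q - 2^-1 - 1 = (q - 1) + - 2^-1); last by ring.
  by rewrite [s `^ (q - 1 - 2^-1)]powRD ?(gt_eqF s0) ?implybT//; ring.
rewrite ge0_integral_fctZ//; last 2 first.
- by rewrite mulr_ge0 ?sqrtr_ge0// invr_ge0 ltW.
- exact: measurable_gfun.
rewrite Gamma_integral_scale// -EFinM; congr (_%:E); ring.
Qed.

End Gamma_facts.

(** * Kernel integrals over R^n *)

Section rV_integral.
Variable R : realType.
Notation leb := (@lebesgue_measure R).
Implicit Types (n k : nat) (t : R).

Lemma measurable_xcoord n k :
  measurable_fun setT (fun x : 'rV[R]_n => xcoord x k).
Proof.
rewrite /xcoord; case: insubP => [i _ _|_] /=; last exact: measurable_cst.
exact: (measurable_rV_coors i).
Qed.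

Definition dist2 n (x y : 'rV[R]_n) : R := \sum_(i < n) (x ord0 i - y ord0 i) ^+ 2.

Lemma dist2_ge0 n (x y : 'rV[R]_n) : 0 <= dist2 x y.
Proof. by apply: sumr_ge0 => i _; exact: sqr_ge0. Qed.

Lemma dist2C n (x y : 'rV[R]_n) : dist2 x y = dist2 y x.
Proof. by apply: eq_bigr => i _; rewrite -sqrrN opprB. Qed.

Lemma enorm_dist2 n (x y : 'rV[R]_n) : enorm (x - y) = Num.sqrt (dist2 x y).
Proof. by congr (Num.sqrt _); apply: eq_bigr => i _; rewrite !mxE. Qed.

Lemma measurable_dist2 n d (T : measurableType d) (f g : T -> 'rV[R]_n) :
  measurable_fun setT f -> measurable_fun setT g ->
  measurable_fun setT (fun z => dist2 (f z) (g z)).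
Proof.
move=> mf mg; apply: measurable_sum => i; apply: measurable_funX.
apply: measurable_funB.
  exact: (measurableT_comp (measurable_rV_coors i) mf).
exact: (measurableT_comp (measurable_rV_coors i) mg).
Qed.

Lemma rV_unconsK n : cancel (@rV_uncons R n) (@rV_cons R n).
Proof.
move=> x; apply/rowP => i; have [j ->|->] := unliftP ord0 i.
  by rewrite rV_consS mxE.
by rewrite rV_cons0.
Qed.

(** New coordinates are prepended, so the last two keep their role while the recursion on the
    dimension integrates the others out. *)
Lemma xcoord_cons n k (z : measurableTypeR R * 'rV[R]_n) :
  xcoord (rV_cons z) k.+2 = xcoord z.2 k.+1.
Proof.
rewrite /xcoord /=; case: insubP => [i|]; last first.
  by case: insubP => // j; rewrite ltnS => ->.
rewrite ltnS => kn ik; rewrite insubT /=.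
rewrite -(rV_consS z); congr (rV_cons z ord0 _); apply: val_inj.
by rewrite /= ik /bump leq0n.
Qed.

Lemma dist2_cons n (z w : measurableTypeR R * 'rV[R]_n) :
  dist2 (rV_cons z) (rV_cons w) = (z.1 - w.1) ^+ 2 + dist2 z.2 w.2.
Proof.
rewrite /dist2 big_ord_recl !rV_cons0; congr (_ + _).
by apply: eq_bigr => i _; rewrite !rV_consS.
Qed.

Lemma integral_rV0 (f : 'rV[R]_0 -> \bar R) : measurable_fun setT f ->
  (\int[rV_lebesgue R 0]_x f x = f 0%R)%E.
Proof. by move=> mf; rewrite integral_dirac// diracE in_setT mul1e. Qed.

Lemma ge0_integral_rVS n (f : 'rV[R]_n.+1 -> \bar R) :
  measurable_fun setT f -> (forall x, 0 <= f x)%E ->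
  (\int[rV_lebesgue R n.+1]_x f x =
   \int[leb]_t \int[rV_lebesgue R n]_x f (rV_cons (t, x)))%E.
Proof.
move=> mf f0.
pose g (z : measurableTypeR R * 'rV[R]_n) := f (rV_cons z).
have mg : measurable_fun setT g by apply: measurableT_comp => //; exact: measurable_rV_cons.
rewrite -(@fubini_tonelli1 _ _ _ _ R leb (rV_lebesgue R n) g)//.
pose P := measure_function_pushforward__canonical__measure_function_Measure
  (leb \x rV_lebesgue R n)%E (@measurable_rV_cons R n).
transitivity (\int[P]_x f x)%E; first exact: eq_measure_integral.
  rewrite (ge0_integral_pushforward (@measurable_rV_cons R n)
    (leb \x rV_lebesgue R n)%E measurableT mf); last by move=> x _.
  by rewrite preimage_setT.
by move=> z; exact: f0.
Qed.

(** The constant of [integral_rV_kernel]: the integral of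
    [(|y|^2 + 1) `^ (- q)] over [R^n]. *)
Definition kernel_const n (q : R) : R :=
  pi `^ (n%:R / 2) * (Gamma (q - n%:R / 2) / Gamma q).

Lemma kernel_const_gt0 n q : n%:R / 2 < q -> 0 < kernel_const n q.
Proof.
move=> nq; rewrite mulr_gt0 ?powR_gt0 ?pi_gt0// divr_gt0// Gamma_gt0 ?subr_gt0//.
by apply: le_lt_trans nq; rewrite divr_ge0.
Qed.

(** Each coordinate integrated out lowers the exponent by 1/2 and contributes the Gamma quotient of
    [integral_japanese]; these quotients telescope. *)
Lemma kernel_constS n q : n.+1%:R / 2 < q ->
  kernel_const n q * (Num.sqrt pi *
    (Gamma (q - n%:R / 2 - 2^-1) / Gamma (q - n%:R / 2))) = kernel_const n.+1 q.
Proof.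
move=> nq; rewrite /kernel_const.
have -> : q - n%:R / 2 - 2^-1 = q - n.+1%:R / 2 by rewrite -natr1; field.
have n1 : n%:R / 2 < n.+1%:R / 2 :> R by rewrite ltr_pM2r ?invr_gt0// ltr_nat.
have G1 : 0 < Gamma (q - n%:R / 2) by rewrite Gamma_gt0// subr_gt0 (lt_trans n1).
have G2 : 0 < Gamma q.
  by rewrite Gamma_gt0// (le_lt_trans _ nq)// divr_ge0.
have -> : pi `^ (n.+1%:R / 2) = pi `^ (n%:R / 2) * Num.sqrt pi :> R.
  rewrite -powR12_sqrt ?pi_ge0// -powRD ?(gt_eqF (pi_gt0 R)) ?implybT//.
  by congr (_ `^ _); rewrite -natr1; field.
by rewrite mulrACA; congr (_ * _); rewrite mulrC mulrA divfK ?gt_eqF.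
Qed.

Section japanese_fubini.
Context d (Z : measurableType d) (nu : {sigma_finite_measure set Z -> \bar R}).
Variables (b q : R) (F r : Z -> R).
Hypotheses (q2 : 2^-1 < q) (mF : measurable_fun setT F) (F0 : forall z, 0 <= F z).
Hypotheses (mr : measurable_fun setT r) (Fr : forall z, F z != 0 -> 0 < r z).

Let f (w : measurableTypeR R * Z) : \bar R :=
  (F w.2 * ((b - w.1) ^+ 2 + r w.2) `^ (- q))%:E.

Let mf : measurable_fun setT f.
Proof.
rewrite /f; mfun.
- by apply: measurableT_comp => //; exact: measurable_snd.
- by apply: measurableT_comp => //; exact: measurable_snd.
Qed.

Let f0 w : (0 <= f w)%E.
Proof. by rewrite lee_fin mulr_ge0 ?powR_ge0. Qed.

Lemma measurable_japanese :
  measurable_fun setT (fun t : measurableTypeR R =>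
    \int[nu]_z (F z * ((b - t) ^+ 2 + r z) `^ (- q))%:E)%E.
Proof. exact: (measurable_fun_fubini_tonelli_F f). Qed.

(** Tonelli, then [integral_japanese] for each z. Positivity of [r] is asked only where [F] is
    nonzero, because [r] will be a squared distance that vanishes at the pole of the kernel. *)
Lemma japanese_fubini :
  (\int[leb]_t \int[nu]_z (F z * ((b - t) ^+ 2 + r z) `^ (- q))%:E =
   (Num.sqrt pi * (Gamma (q - 2^-1) / Gamma q))%:E *
     \int[nu]_z (F z * r z `^ (- (q - 2^-1)))%:E)%E.
Proof.
pose D := Num.sqrt pi * (Gamma (q - 2^-1) / Gamma q) : R.
have D0 : 0 <= D.
  rewrite /D mulr_ge0 ?sqrtr_ge0// divr_ge0// ltW// Gamma_gt0 ?subr_gt0//.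
  by rewrite (lt_trans _ q2)// invr_gt0.
rewrite (fubini_tonelli f)// -/D -ge0_integral_fctZ//; last 2 first.
- by mfun.
- by move=> z; rewrite mulr_ge0 ?powR_ge0.
apply: eq_integral => z _; rewrite /f/=.
have [Fz|Fz] := eqVneq (F z) 0.
  under eq_integral do rewrite Fz mul0r.
  by rewrite integral0 Fz mul0r mulr0.
rewrite ge0_integral_fctZ//; last 2 first.
- by mfun.
- by move=> t; exact: powR_ge0.
by rewrite integral_japanese ?Fr// -EFinM -/D mulrCA.
Qed.

End japanese_fubini.

Let R2 := (measurableTypeR R * measurableTypeR R)%type.

Lemma xcoord_cons1 n (z : measurableTypeR R * 'rV[R]_n) : xcoord (rV_cons z) 1 = z.1.
Proof.
by rewrite /xcoord /= insubT/= -(rV_cons0 z); congr (rV_cons z ord0 _); exact: val_inj.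
Qed.

Lemma dist2_rV2 (x y : 'rV[R]_2) : dist2 x y =
  (xcoord x 1 - xcoord y 1) ^+ 2 + (xcoord x 2 - xcoord y 2) ^+ 2.
Proof.
rewrite -(rV_unconsK x) -(rV_unconsK y).
case: (rV_uncons x) => x0 x'; case: (rV_uncons y) => y0 y'.
rewrite -(rV_unconsK x') -(rV_unconsK y').
case: (rV_uncons x') => x1 x2; case: (rV_uncons y') => y1 y2.
by rewrite !xcoord_cons/= !xcoord_cons1/= !dist2_cons/= /dist2 big_ord0 addr0.
Qed.

Lemma measurable_xcoord_pair n j k (F : R2 -> R) : measurable_fun setT F ->
  measurable_fun setT (fun y : 'rV[R]_n => F (xcoord y j, xcoord y k)).
Proof.
move=> mF; apply: (measurableT_comp mF).
by apply: measurable_fun_pair; exact: measurable_xcoord.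
Qed.

(** The parameter [A] is there for the induction: fixing the first coordinate of [y] adds its
    squared difference to [A]. [F] is required to vanish at the height of [x], so that the base of
    the power stays positive where [F] is not 0, even for [A = 0]. *)
Lemma integral_rV_kernel2 n (F : R2 -> R) (q A : R) (x : 'rV[R]_n.+2) :
  n%:R / 2 < q -> 0 <= A -> measurable_fun setT F -> (forall z, 0 <= F z) ->
  (forall a, F (a, xcoord x n.+2) = 0) ->
  (\int[rV_lebesgue R n.+2]_y
     (F (xcoord y n.+1, xcoord y n.+2) * (dist2 x y + A) `^ (- q))%:E =
   (kernel_const n q)%:E * \int[rV_lebesgue R 2]_z
     (F (xcoord z 1, xcoord z 2) *
      ((xcoord x n.+1 - xcoord z 1) ^+ 2 + (xcoord x n.+2 - xcoord z 2) ^+ 2 + A)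
        `^ (- (q - n%:R / 2)))%:E)%E.
Proof.
elim: n A x => [|n IH] A x nq A0 mF F0 Fx.
  rewrite /kernel_const mul0r subr0 powRr0 mul1r divff; last first.
    by rewrite gt_eqF// Gamma_gt0// (le_lt_trans _ nq)// mul0r.
  by rewrite mul1e; apply: eq_integral => y _; rewrite dist2_rV2.
rewrite ge0_integral_rVS; last 2 first.
- mfun; first exact: measurable_xcoord_pair.
  by apply: measurable_dist2 => //; exact: measurable_cst.
- by move=> y; rewrite lee_fin mulr_ge0 ?powR_ge0.
have n1 : n%:R / 2 < n.+1%:R / 2 :> R by rewrite ltr_pM2r ?invr_gt0// ltr_nat.
have nq' := lt_trans n1 nq.
move: Fx; rewrite -(rV_unconsK x); case: (rV_uncons x) => x0 x'.
rewrite !xcoord_cons/= => Fx.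
pose G (z : 'rV[R]_2) := F (xcoord z 1, xcoord z 2).
pose r2 (z : 'rV[R]_2) := (xcoord x' n.+1 - xcoord z 1) ^+ 2 +
  (xcoord x' n.+2 - xcoord z 2) ^+ 2 + A.
have mG : measurable_fun setT G by exact: measurable_xcoord_pair.
have mr2 : measurable_fun setT r2 by rewrite /r2; mfun; exact: measurable_xcoord.
have Gr2 z : G z != 0 -> 0 < r2 z.
  move=> Fz; rewrite ltr_wpDr// ltr_wpDl ?sqr_ge0// exprn_even_gt0//= subr_eq0.
  apply/eqP => e; move/eqP : Fz; apply.
  by rewrite /G -e.
have C0 := ltW (kernel_const_gt0 nq').
have nq2 : 2^-1 < q - n%:R / 2.
  by rewrite ltrBrDr addrC -[X in _ + X]mul1r -mulrDl natr1.
rewrite -(kernel_constS nq) EFinM -muleA.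
have -> : q - n.+1%:R / 2 = q - n%:R / 2 - 2^-1 by rewrite -natr1; field.
have G0 z : 0 <= G z by exact: F0.
have H := japanese_fubini (rV_lebesgue R 2) x0 nq2 mG G0 mr2 Gr2.
rewrite -H -ge0_integralZl_EFin//; last 2 first.
- by move=> t _; apply: integral_ge0 => z _; rewrite lee_fin mulr_ge0 ?powR_ge0.
- exact: measurable_japanese.
apply: eq_integral => t _.
have At : 0 <= A + (x0 - t) ^+ 2 by rewrite addr_ge0// sqr_ge0.
have := IH (A + (x0 - t) ^+ 2) x' nq' At mF F0 Fx => IHt.
transitivity (\int[rV_lebesgue R n.+2]_y
     (F (xcoord y n.+1, xcoord y n.+2) * (dist2 x' y + (A + (x0 - t) ^+ 2)) `^ (- q))%:E)%E.
  apply: eq_integral => y _; rewrite !xcoord_cons dist2_cons/=.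
  by congr (_ * _ `^ _)%:E; ring.
rewrite [LHS]IHt; congr (_ * _)%E; apply: eq_integral => z _; rewrite /r2 /G /=.
by congr (_ * _ `^ _)%:E; ring.
Qed.

Lemma integral_rV2 (f : R2 -> \bar R) : measurable_fun setT f ->
  (forall z, 0 <= f z)%E ->
  (\int[rV_lebesgue R 2]_z f (xcoord z 1, xcoord z 2) =
   \int[leb]_b \int[leb]_a f (a, b))%E.
Proof.
move=> mf f0; rewrite -(fubini_tonelli f)//.
have mg : measurable_fun setT (fun y : 'rV[R]_2 => f (xcoord y 1, xcoord y 2)).
  apply: (measurableT_comp mf).
  by apply: measurable_fun_pair; exact: measurable_xcoord.
rewrite ge0_integral_rVS//; apply: eq_integral => a _.
have m1 : measurable_fun setT (fun z : 'rV[R]_1 =>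
    f (xcoord (rV_cons (a : measurableTypeR R, z)) 1,
       xcoord (rV_cons (a : measurableTypeR R, z)) 2)).
  apply: (measurableT_comp mg); apply: (measurableT_comp (@measurable_rV_cons R 1)).
  exact: measurable_fun_pair.
rewrite ge0_integral_rVS//; apply: eq_integral => b _.
rewrite integral_rV0; last first.
  apply: (measurableT_comp m1); apply: (measurableT_comp (@measurable_rV_cons R 0)).
  exact: measurable_fun_pair.
by rewrite xcoord_cons !xcoord_cons1.
Qed.

Lemma integral_rV_kernel n (F : R2 -> R) (q : R) (x : 'rV[R]_n.+2) :
  n%:R / 2 < q -> measurable_fun setT F -> (forall z, 0 <= F z) ->
  (forall a, F (a, xcoord x n.+2) = 0) ->
  (\int[rV_lebesgue R n.+2]_y
     (F (xcoord y n.+1, xcoord y n.+2) * dist2 x y `^ (- q))%:E =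
   (kernel_const n q)%:E * \int[leb]_b \int[leb]_a
     (F (a, b) * ((xcoord x n.+1 - a) ^+ 2 + (xcoord x n.+2 - b) ^+ 2)
        `^ (- (q - n%:R / 2)))%:E)%E.
Proof.
move=> nq mF F0 Fx; have := integral_rV_kernel2 nq (lexx 0) mF F0 Fx.
under eq_integral do rewrite addr0.
move=> ->; congr (_ * _)%E.
pose f (z : R2) := (F z *
  ((xcoord x n.+1 - z.1) ^+ 2 + (xcoord x n.+2 - z.2) ^+ 2) `^ (- (q - n%:R / 2)))%:E.
rewrite -(integral_rV2 (f := f)); last 2 first.
- by rewrite /f; mfun.
- by move=> z; rewrite lee_fin mulr_ge0 ?powR_ge0.
by apply: eq_integral => z _; rewrite addr0.
Qed.

(** With a weight in the last coordinate alone, the coordinate before it can be integrated out as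
    well, by one more use of [kernel_constS]. *)
Lemma integral_rV_kernel_last n (g : measurableTypeR R -> R) (q : R) (x : 'rV[R]_n.+2) :
  n.+1%:R / 2 < q -> measurable_fun setT g -> (forall b, 0 <= g b) ->
  g (xcoord x n.+2) = 0 ->
  (\int[rV_lebesgue R n.+2]_y
     (g (xcoord y n.+2) * dist2 x y `^ (- q))%:E =
   (kernel_const n.+1 q)%:E * \int[leb]_b
     (g b * `|xcoord x n.+2 - b| `^ (n.+1%:R - 2 * q))%:E)%E.
Proof.
move=> nq mg g0 gx.
have n1 : n%:R / 2 < n.+1%:R / 2 :> R by rewrite ltr_pM2r ?invr_gt0// ltr_nat.
have nq' := lt_trans n1 nq.
have C0 := ltW (kernel_const_gt0 nq').
have nq2 : 2^-1 < q - n%:R / 2.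
  by rewrite ltrBrDr addrC -[X in _ + X]mul1r -mulrDl natr1.
have mg2 : measurable_fun setT (fun z : R2 => g z.2).
  by apply: measurableT_comp => //; exact: measurable_snd.
have H := @integral_rV_kernel n (fun z : R2 => g z.2) q x nq' mg2 (fun z => g0 z.2)
  (fun=> gx).
rewrite [LHS]H -(kernel_constS nq) (EFinM (kernel_const n q)) -muleA.
congr (_ * _)%E.
pose D := Num.sqrt pi * (Gamma (q - n%:R / 2 - 2^-1) / Gamma (q - n%:R / 2)) : R.
have D0 : 0 <= D.
  by rewrite /D mulr_ge0 ?sqrtr_ge0// divr_ge0// ltW// Gamma_gt0 ?subr_gt0//
    (lt_trans _ nq2)// invr_gt0.
rewrite -/D -ge0_integral_fctZ//; last 2 first.
- by mfun.
- by move=> b; rewrite mulr_ge0 ?powR_ge0.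
apply: eq_integral => b _ /=.
have [gb|gb] := eqVneq (g b) 0.
  under eq_integral do rewrite gb mul0r.
  by rewrite integral0 gb mul0r mulr0.
rewrite ge0_integral_fctZ//; last 2 first.
- by mfun.
- by move=> t; exact: powR_ge0.
have xb : 0 < `|xcoord x n.+2 - b|.
  by rewrite normr_gt0 subr_eq0; apply: contra gb => /eqP <-; rewrite gx.
rewrite integral_japanese//; last by rewrite -real_normK ?num_real// exprn_gt0.
rewrite -EFinM -/D mulrCA; congr (_ * (_ * _))%:E.
rewrite -real_normK ?num_real// -powR_mulrn// -powRrM; congr (_ `^ _).
by rewrite -natr1; field.
Qed.

End rV_integral.

Lemma measurable_inv (R : realType) : measurable_fun setT (@GRing.inv R).
Proof.
have -> : @GRing.inv R =
    (fun x : R => if 0 <= x then x `^ (- 1) else - ((- x) `^ (- 1))).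
  apply/funext => x; case: ifPn => x0; first by rewrite powR_inv1.
  by rewrite powR_inv1 ?invrN ?opprK// oppr_ge0 ltW// ltNge.
by mfun.
Qed.

(** * Reduction to integrals in the ratio of the heights *)

Section ratio_integrals.
Variable R : realType.
Notation leb := (@lebesgue_measure R).
Variables (e sigma : R).
Hypothesis e01 : 0 < e < 1.
Implicit Types (phi : R -> R) (x y l : R).

Let e0 : 0 < e. Proof. by case/andP: e01. Qed.
Let e1 : 0 < 1 - e. Proof. by rewrite subr_gt0; case/andP: e01. Qed.

(** What remains of the kernel integral after scaling. The cut at [1 - e] avoids the singularity at
    ratio 1, where the separate Picone terms may fail to be integrable; the cut at [e] avoids ratio
    0. *)
Definition ratio_integral phi : \bar R := (\int[leb]_l
  ((if (e <= l) && (l <= 1 - e) then phi l else 0) * (1 - l) `^ (- 1 - sigma))%:E)%E.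

Lemma measurable_ratio phi : measurable_fun setT phi -> measurable_fun setT (fun l : R =>
  (if (e <= l) && (l <= 1 - e) then phi l else 0) * (1 - l) `^ (- 1 - sigma)).
Proof. by move=> mphi; mfun. Qed.

Let scale_absorb x (C : \bar R) : 0 < x ->
  (x%:E * ((x `^ (- 1 - sigma))%:E * C) = (x `^ (- sigma))%:E * C)%E.
Proof.
move=> x0; rewrite muleA -EFinM; congr (_%:E * _)%E.
rewrite -{1}(powRr1 (ltW x0)) -powRD ?(gt_eqF x0) ?implybT//; congr (_ `^ _); ring.
Qed.

Lemma integral_ratio_below phi x : 0 < x -> measurable_fun setT phi ->
  (forall l, 0 <= phi l) ->
  (\int[leb]_b ((if (e * x <= b) && (b <= (1 - e) * x) then phi (b / x) else 0) *
     `|x - b| `^ (- 1 - sigma))%:E = (x `^ (- sigma))%:E * ratio_integral phi)%E.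
Proof.
move=> x0 mphi phi0.
rewrite (ge0_integral_scale x0 (f := fun b => ((if (e * x <= b) && (b <= (1 - e) * x)
  then phi (b / x) else 0) * `|x - b| `^ (- 1 - sigma))%:E)); last 2 first.
- mfun; apply: (measurableT_comp mphi); exact: mulrr_measurable.
- by move=> b; rewrite lee_fin mulr_ge0 ?powR_ge0//; case: ifP.
rewrite -scale_absorb//; congr (_ * _)%E.
rewrite /ratio_integral -ge0_integral_fctZ ?powR_ge0//; last 2 first.
- exact: measurable_ratio.
- by move=> l; rewrite mulr_ge0 ?powR_ge0//; case: ifP.
apply: eq_integral => /= l _; move: (l : R) => {}l.
rewrite (mulrC e) (mulrC (1 - e)) !ler_pM2l//.
case: ifPn => [/andP[l1 l2]|_]; last by rewrite !mul0r mulr0.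
have l10 : 0 <= 1 - l by rewrite subr_ge0 (le_trans l2)// gerBl ltW.
have xl : `|x - x * l| = x * (1 - l).
  rewrite (_ : x - x * l = x * (1 - l)); last by ring.
  by rewrite ger0_norm// mulr_ge0// ltW.
rewrite xl powRM ?(ltW x0)//.
rewrite (mulrC x l) mulfK ?gt_eqF//; congr (_%:E); ring.
Qed.

(** Substitution c = 1 / l. The Jacobian l^(-2) and the factor l^(1 + sigma) coming from |1 -
    1/l|^(-1 - sigma) combine to l^(sigma - 1). Continuity of [phi] is a demand of the substitution
    theorem. *)
Let integral_inversion phi : (forall l, 0 < l < 1 -> {for l, continuous phi}) ->
  (\int[leb]_c ((if (e * c <= 1) && (1 <= (1 - e) * c) then phi c^-1 else 0) *
     `|1 - c| `^ (- 1 - sigma))%:E =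
   ratio_integral (fun l => phi l * l `^ (sigma - 1))%R)%E.
Proof.
move=> cphi; have E0 := e0; have E1 := e1.
(* For [e > 1 - e] the ranges of integration are empty and both sides are 0. *)
have [ee|ee] := leP e (1 - e); last first.
  rewrite /ratio_integral !integral0_eq// => /= l _; move: (l : R) => {}l;
    rewrite ifF ?mul0r//; apply/negbTE/negP => /andP[a b]; first by lra.
  have [l0|l0] := leP l 0.
    have : (1 - e) * l <= 0 by rewrite pmulr_rle0.
    by move=> /(le_trans b); rewrite leNgt ltr01.
  have : (1 - e) * l < e * l by rewrite ltr_pM2r.
  by move=> /(lt_le_trans)/(_ a)/(le_lt_trans b); rewrite ltxx.
pose G (c : R) := phi c^-1 * (c - 1) `^ (- 1 - sigma).
pose F (l : R) := l^-1.
have dF (l : R) : 0 < l -> is_derive l 1 F (- (l ^- 2)).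
  move=> l0; have := @is_deriveV R id l 1 1; rewrite gt_eqF// => /(_ isT).
  by move=> /(_ (is_derive_id _ _)); rewrite /GRing.scale/= mulr1.
have F'E (l : R) : 0 < l -> derive1 F l = - (l ^- 2).
  by move=> l0; rewrite derive1E; have [_ ->] := dF _ l0.
have cF (l : R) : 0 < l -> {for l, continuous F}.
  by move=> l0; apply: inv_continuous; rewrite gt_eqF.
have cF' (l : R) : 0 < l -> {for l, continuous (derive1 F)}.
  move=> l0; have : {for l, continuous (fun l : R => - (l ^- 2))}.
    apply: continuousN; apply: continuousV; first by rewrite gt_eqF// exprn_gt0.
    exact: exprn_continuous.
  rewrite /prop_for /continuous_at F'E// => H; apply: cvg_trans H; apply: near_eq_cvg.
  near=> z; rewrite F'E//; near: z; exact: lt_nbhsr.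
have sub : (\int[leb]_(c in `[F (1 - e)%R, F e]) (G c)%:E =
   \int[leb]_(l in `[e, (1 - e)%R]) (((G \o F) * - derive1 F)%R l)%:E)%E.
  apply: integration_by_substitution_decreasing => //.
  - move=> a b; rewrite !in_itv/= => /andP[a1 _] /andP[b1 _] ba.
    by rewrite /F ltf_pV2// posrE; lra.
  - by move=> a; rewrite in_itv/= => /andP[a1 _]; apply: cF'; lra.
  - by apply/cvg_ex; exists (derive1 F e); apply: cvg_at_right_filter; exact: cF'.
  - by apply/cvg_ex; exists (derive1 F (1 - e)); apply: cvg_at_left_filter; exact: cF'.
  - split.
    + by move=> a; rewrite in_itv/= => /andP[a1 _]; apply: ex_derive; apply: dF; lra.
    + by apply: cvg_at_right_filter; exact: cF.
    + by apply: cvg_at_left_filter; exact: cF.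
  - apply: continuous_in_subspaceT => c; rewrite inE/= in_itv/= => /andP[c1 c2].
    have c11 : 1 < c by apply: lt_le_trans c1; rewrite /F invf_gt1//; lra.
    rewrite /continuous_at /G; apply: cvgM.
      apply: (@continuous_comp _ _ _ (@GRing.inv R) phi).
        by apply: inv_continuous; rewrite gt_eqF//; lra.
      by apply: cphi; rewrite invr_gt0 invf_lt1//; lra.
    apply: (@continuous_comp _ _ _ (fun c : R => c - 1) (fun z => z `^ (- 1 - sigma))).
      by apply: continuousB; [exact: cvg_id|exact: cvg_cst].
    apply: differentiable_continuous; apply/derivable1_diffP.
    by apply: derivable_powR; rewrite in_itv/= andbT subr_gt0.
transitivity (\int[leb]_(c in `[F (1 - e)%R, F e]) (G c)%:E)%E.
  rewrite [RHS]integral_mkcond; apply: eq_integral => /= c _; move: (c : R) => {}c; rewrite patchE mem_setE in_itv/=.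
  have -> : (e * c <= 1) && (1 <= (1 - e) * c) = (F (1 - e) <= c <= F e).
    rewrite /F andbC -[in RHS]div1r ler_pdivrMr// mulrC; congr (_ && _).
    by rewrite -[e^-1]mul1r ler_pdivlMr// mulrC.
  case: ifPn => [/andP[c1 c2]|_]; last by rewrite mul0r.
  have c11 : 1 <= c by apply: le_trans c1; rewrite /F invf_ge1//; lra.
  by rewrite /G distrC ger0_norm// subr_ge0.
rewrite sub integral_mkcond; apply: eq_integral => /= l _; move: (l : R) => {}l; rewrite patchE mem_setE in_itv/=.
case: ifPn => [/andP[l1 l2]|_]; last by rewrite mul0r.
have l0 : 0 < l by lra.
have l1' : 0 < 1 - l by lra.
rewrite !fctE /G F'E// /F invrK opprK.
have -> : l^-1 - 1 = (1 - l) / l by field; rewrite gt_eqF.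
rewrite powRM ?invr_ge0 ?(ltW l0) ?(ltW l1')//.
have -> : l^-1 `^ (- 1 - sigma) = l `^ (1 + sigma).
  by rewrite -powR_inv1 ?(ltW l0)// -powRrM; congr (_ `^ _); ring.
have -> : l `^ (sigma - 1) = l `^ (1 + sigma) * l ^- 2.
  rewrite -powR_invn ?(ltW l0)// -powRD ?(gt_eqF l0) ?implybT//.
  by congr (_ `^ _); ring.
by congr (_%:E); ring.
Unshelve. all: end_near. Qed.

Lemma integral_ratio_above phi y : 0 < y -> measurable_fun setT phi ->
  (forall l, 0 <= phi l) -> (forall l, 0 < l < 1 -> {for l, continuous phi}) ->
  (\int[leb]_b ((if (e * b <= y) && (y <= (1 - e) * b) then phi (y / b) else 0) *
     `|y - b| `^ (- 1 - sigma))%:E =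
   (y `^ (- sigma))%:E * ratio_integral (fun l => phi l * l `^ (sigma - 1))%R)%E.
Proof.
move=> y0 mphi phi0 cphi.
have minv : measurable_fun setT (fun b : R => phi b^-1).
  exact: (measurableT_comp mphi (@measurable_inv R)).
rewrite -integral_inversion//.
have myb : measurable_fun setT (fun b : R => phi (y / b)).
  have -> : (fun b : R => phi (y / b)) = (fun b => phi (b / y)^-1).
    by apply/funext => b; rewrite invf_div.
  by apply: (measurableT_comp minv); exact: mulrr_measurable.
rewrite (ge0_integral_scale y0 (f := fun b => ((if (e * b <= y) && (y <= (1 - e) * b)
  then phi (y / b) else 0) * `|y - b| `^ (- 1 - sigma))%:E)); last 2 first.
- by mfun.
- by move=> b; rewrite lee_fin mulr_ge0 ?powR_ge0//; case: ifP.
rewrite -scale_absorb//; congr (_ * _)%E.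
rewrite -ge0_integral_fctZ ?powR_ge0//; last 2 first.
- by mfun.
- by move=> l; rewrite mulr_ge0 ?powR_ge0//; case: ifP.
apply: eq_integral => c _.
have -> : (e * (y * c) <= y) = (e * c <= 1) by rewrite mulrCA -{2}(mulr1 y) ler_pM2l.
have -> : (y <= (1 - e) * (y * c)) = (1 <= (1 - e) * c).
  by rewrite mulrCA -{1}(mulr1 y) ler_pM2l.
case: ifPn => [_|_]; last by rewrite !mul0r mulr0.
have -> : `|y - y * c| = y * `|1 - c|.
  by rewrite -{1}(mulr1 y) -mulrBr normrM gtr0_norm.
have -> : y / (y * c) = c^-1 by rewrite invfM mulrA mulfV ?gt_eqF// mul1r.
rewrite powRM ?(ltW y0)//.
by congr (_%:E); ring.
Qed.

End ratio_integrals.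

(** * The fractional kernel between points of given height *)

Section kernel_integrals.
Variables (R : realType) (n : nat) (sigma : R).
Hypothesis sigma0 : 0 < sigma.
Notation leb := (@lebesgue_measure R).
Notation mu := (rV_lebesgue R n.+2).
Implicit Types (x y : 'rV[R]_n.+2) (phi : R -> R).

Definition lst x : R := xcoord x n.+2.
Definition prv x : R := xcoord x n.+1.

(** Half of d + s p, with [n.+2] for d and [sigma] for s p, since [ker] is a power of the squared
    distance. *)
Definition kexp : R := (n.+2%:R + sigma) / 2.
Definition ker x y : R := dist2 x y `^ (- kexp).

Lemma kexp_gt : n.+1%:R / 2 < kexp.
Proof.
rewrite /kexp ltr_pM2r ?invr_gt0// -[n.+2%:R]natr1.
by rewrite -addrA ltrDl addr_gt0.
Qed.

Lemma kexp_gt' : n%:R / 2 < kexp.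
Proof. by apply: lt_trans kexp_gt; rewrite ltr_pM2r ?invr_gt0// ltr_nat. Qed.

Let kexpE1 : n.+1%:R - 2 * kexp = - 1 - sigma.
Proof. by rewrite /kexp -[n.+2%:R]natr1; field. Qed.

Let kexpE2 : kexp - n%:R / 2 = 1 + sigma / 2.
Proof. by rewrite /kexp -[n.+2%:R]natr1 -[n.+1%:R]natr1; field. Qed.

Lemma ker_ge0 x y : 0 <= ker x y. Proof. exact: powR_ge0. Qed.

Lemma kerC x y : ker x y = ker y x. Proof. by rewrite /ker dist2C. Qed.

(** Half of the factor in front of the integral in [hardy_const]; the missing 2 comes from the two
    orderings of a pair of points. *)
Definition cker : R := kernel_const n.+1 kexp.

Lemma cker_gt0 : 0 < cker. Proof. exact/kernel_const_gt0/kexp_gt. Qed.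

Lemma integral_ker_below e phi x : 0 < e < 1 -> 0 < lst x ->
  measurable_fun setT phi -> (forall l, 0 <= phi l) ->
  (\int[mu]_y ((if (e * lst x <= lst y) && (lst y <= (1 - e) * lst x)
      then phi (lst y / lst x) else 0) * ker x y)%:E =
   (cker * lst x `^ (- sigma))%:E * ratio_integral e sigma phi)%E.
Proof.
move=> e01 x0 mphi phi0; have /andP[e0 e1] := e01.
pose g (b : measurableTypeR R) : R := if (e * lst x <= b) && (b <= (1 - e) * lst x)
  then phi (b / lst x) else 0.
have mg : measurable_fun setT g.
  by rewrite /g; mfun; apply: (measurableT_comp mphi); exact: mulrr_measurable.
have g0 b : 0 <= g b by rewrite /g; case: ifP.
have gx : g (xcoord x n.+2) = 0.
  rewrite /g ifF//; apply/negbTE; rewrite negb_and -!ltNge; apply/orP; right.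
  by rewrite -/(lst x) gtr_pMl// gtrBl.
have H := integral_rV_kernel_last kexp_gt mg g0 gx.
rewrite [LHS]H kexpE1 (EFinM cker) -muleA.
by rewrite -(integral_ratio_below sigma e01 x0 mphi phi0).
Qed.

Lemma integral_ker_above e phi y : 0 < e < 1 -> 0 < lst y ->
  measurable_fun setT phi -> (forall l, 0 <= phi l) ->
  (forall l, 0 < l < 1 -> {for l, continuous phi}) ->
  (\int[mu]_x ((if (e * lst x <= lst y) && (lst y <= (1 - e) * lst x)
      then phi (lst y / lst x) else 0) * ker x y)%:E =
   (cker * lst y `^ (- sigma))%:E *
     ratio_integral e sigma (fun l => phi l * l `^ (sigma - 1))%R)%E.
Proof.
move=> e01 y0 mphi phi0 cphi; have /andP[e0 e1] := e01.
pose g (b : measurableTypeR R) : R := if (e * b <= lst y) && (lst y <= (1 - e) * b)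
  then phi (lst y / b) else 0.
have mg : measurable_fun setT g.
  rewrite /g; mfun.
  have -> : (fun b : R => phi (lst y / b)) = (fun b : R => phi (lst y * b^-1)) by [].
  apply: (measurableT_comp mphi); apply: measurable_funM; first exact: measurable_cst.
  exact: measurable_inv.
have g0 b : 0 <= g b by rewrite /g; case: ifP.
have gy : g (xcoord y n.+2) = 0.
  rewrite /g ifF//; apply/negbTE; rewrite negb_and -!ltNge; apply/orP; right.
  by rewrite -/(lst y) gtr_pMl// gtrBl.
have H := integral_rV_kernel_last kexp_gt mg g0 gy.
rewrite (EFinM cker) -muleA -(integral_ratio_above sigma e01 y0 mphi phi0 cphi).
rewrite kexpE1 in H; rewrite -[RHS]H; apply: eq_integral => x _.
by rewrite kerC.
Qed.

Lemma integral_itv_cst (u v K : R) : u <= v -> 0 <= K ->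
  (\int[leb]_a (if (u <= a) && (a <= v) then K else 0)%:E = (K * (v - u))%:E)%E.
Proof.
move=> uv K0; transitivity (\int[leb]_(a in `[u, v]) K%:E)%E.
  rewrite [RHS]integral_mkcond; apply: eq_integral => a _.
  by rewrite patchE mem_setE in_itv/=; case: ifP.
rewrite integral_cst//= lebesgue_measure_itv/= lte_fin EFinM.
case: ifPn => [_|]; first by rewrite -EFinB.
by rewrite -leNgt => vu; rewrite (@le_anti _ _ u v) ?uv// subrr.
Qed.

Variable rho : R.
Hypothesis rho12 : 1 < rho <= 2.

Definition annulus (s m a : R) := (2 * s <= `|a - m|) && (`|a - m| <= 3 * s).

Let annulusE (s m a : R) : 0 < s -> annulus s m a =
  ((m + 2 * s <= a) && (a <= m + 3 * s)) || ((m - 3 * s <= a) && (a <= m - 2 * s)).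
Proof.
move=> s0; rewrite /annulus; have [am|am] := ger0P (a - m).
  rewrite [X in _ || X]andbC (_ : (a <= m - 2 * s) = false) /= ?orbF; last first.
    by apply/negbTE; rewrite -ltNge; lra.
  by congr (_ && _); apply/idP/idP => ?; lra.
rewrite (_ : (m + 2 * s <= a) = false) /=; last first.
  by apply/negbTE; rewrite -ltNge; lra.
by rewrite andbC; congr (_ && _); apply/idP/idP => ?; lra.
Qed.

Let annulus2 (s m A B : R) : 0 < s -> 0 <= A -> 0 <= B ->
  (\int[leb]_a ((if (m + 2 * s <= a)%R && (a <= m + 3 * s)%R then A else 0) +
     (if (m - 3 * s <= a)%R && (a <= m - 2 * s)%R then B else 0))%:E = ((A + B) * s)%:E)%E.
Proof.
move=> s0 A0 B0; rewrite ge0_integral_fctD; last 4 first.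
- by mfun.
- by move=> a; case: ifP.
- by mfun.
- by move=> a; case: ifP.
rewrite integral_itv_cst//; last by lra.
rewrite integral_itv_cst//; last by lra.
by rewrite -EFinD; congr (_%:E); ring.
Qed.

Let measurable_annulus s m : measurable_fun setT (annulus s m).
Proof. by rewrite /annulus; mfun. Qed.

Lemma integral_annulus_cst (s m K : R) : 0 < s -> 0 <= K ->
  (\int[leb]_a (if annulus s m a then K else 0)%:E = (2 * K * s)%:E)%E.
Proof.
move=> s0 K0; rewrite mulrDl mul1r -(annulus2 m)//; apply: eq_integral => a _.
move: (a : R) => {}a.
rewrite annulusE//; case: (boolP ((m + 2 * s <= a) && _)) => h1;
  case: (boolP ((m - 3 * s <= a) && _)) => h2 /=; rewrite ?addr0 ?add0r//.
by exfalso; move: h1 h2 => /andP[? ?] /andP[? ?]; lra.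
Qed.

(** The two intervals get separate bounds because [hw_pair] controls only the sum of its two bounds
    by a factor below 2. *)
Lemma integral_annulus_le (s m A B : R) (f : R -> R) : 0 < s -> 0 <= A -> 0 <= B ->
  measurable_fun setT f -> (forall a, 0 <= f a) ->
  (forall w, 2 * s <= w <= 3 * s -> f (m + w) <= A) ->
  (forall w, 2 * s <= w <= 3 * s -> f (m - w) <= B) ->
  (\int[leb]_a (if annulus s m a then f a else 0)%:E <= ((A + B) * s)%:E)%E.
Proof.
move=> s0 A0 B0 mf f0 fA fB; rewrite -(annulus2 m)//.
apply: ge0_integral_fct_le => [||  |a]; first by mfun.
- by move=> a; case: ifP.
- by mfun.
move: (a : R) => {}a.
rewrite annulusE//; case: (boolP ((m + 2 * s <= a) && _)) => h1;
  case: (boolP ((m - 3 * s <= a) && _)) => h2 /=; rewrite ?addr0 ?add0r//.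
- by exfalso; move: h1 h2 => /andP[? ?] /andP[? ?]; lra.
- have {1}-> : a = m + (a - m) by ring.
  by apply: fA; move: h1 => /andP[? ?]; apply/andP; split; lra.
- have {1}-> : a = m - (m - a) by ring.
  by apply: fB; move: h2 => /andP[? ?]; apply/andP; split; lra.
Qed.

(** [y] is a point whose last coordinate is about five times smaller than that of
    [x], and which is shifted horizontally by two to three times that amount. *)
Definition box (mx lx my ly : R) : bool :=
  [&& 0 < ly, 5 * ly <= lx, lx <= 5 * rho * ly & annulus ly my mx].

(** The first factor cancels the planar kernel left after integrating out the other coordinates, so
    that box integrals become explicit. The power of [ly] makes the weight homogeneous of degree 0,
    hence bounded. *)
Definition bwt (mx lx my ly : R) : R := if box mx lx my ly then
  ((mx - my) ^+ 2 + (lx - ly) ^+ 2) `^ (1 + sigma / 2) * ly `^ (- 2 - sigma) else 0.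

Definition cker2 : R := kernel_const n kexp.

Lemma cker2_gt0 : 0 < cker2. Proof. exact/kernel_const_gt0/kexp_gt'. Qed.

Lemma bwt_ge0 mx lx my ly : 0 <= bwt mx lx my ly.
Proof. by rewrite /bwt; case: ifP => // _; rewrite mulr_ge0 ?powR_ge0. Qed.

Lemma annulusC s m a : annulus s m a = annulus s a m.
Proof. by rewrite /annulus distrC. Qed.

Lemma measurable_bwt d (T : measurableType d) (f1 f2 f3 f4 : T -> R) :
  measurable_fun setT f1 -> measurable_fun setT f2 ->
  measurable_fun setT f3 -> measurable_fun setT f4 ->
  measurable_fun setT (fun z => bwt (f1 z) (f2 z) (f3 z) (f4 z)).
Proof. by move=> m1 m2 m3 m4; rewrite /bwt /box /annulus; mfun. Qed.

Let bwt_ker mx lx my ly : bwt mx lx my ly *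
    ((mx - my) ^+ 2 + (lx - ly) ^+ 2) `^ (- (1 + sigma / 2)) =
  if box mx lx my ly then ly `^ (- 2 - sigma) else 0.
Proof.
rewrite /bwt; case: ifPn => [/and4P[ly0 l5 _ _]|_]; last by rewrite mul0r.
rewrite mulrAC powRN mulfV ?mul1r//; apply: lt0r_neq0; apply: powR_gt0.
by rewrite ltr_wpDl ?sqr_ge0// exprn_gt0//; lra.
Qed.

(** The annulus has length 2 [lst y] and the admissible heights of [x] fill an interval of length 5
    (rho - 1) [lst y], whence the factor 10 (rho - 1). *)
Lemma integral_box_above y : 0 < lst y ->
  (\int[mu]_x (bwt (prv x) (lst x) (prv y) (lst y) * ker x y)%:E =
   (cker2 * (10 * (rho - 1)) * lst y `^ (- sigma))%:E)%E.
Proof.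
move=> y0; have /andP[rho1 _] := rho12.
pose F (z : measurableTypeR R * measurableTypeR R) := bwt z.1 z.2 (prv y) (lst y).
have mF : measurable_fun setT F by apply: measurable_bwt => //; mfun.
have F0 z : 0 <= F z by exact: bwt_ge0.
have Fy a : F (a, xcoord y n.+2) = 0.
  by rewrite /F/= /bwt ifF// /box -/(lst y); apply/negbTE/negP => /and4P[_ ? _ _]; lra.
have H := integral_rV_kernel kexp_gt' mF F0 Fy.
transitivity (\int[mu]_x (F (xcoord x n.+1, xcoord x n.+2) * dist2 y x `^ (- kexp))%:E)%E.
  by apply: eq_integral => x _; rewrite kerC.
rewrite [LHS]H -/cker2 kexpE2 -[in RHS]mulrA (EFinM cker2); congr (_ * _)%E.
transitivity (\int[leb]_b (if (5 * lst y <= b) && (b <= 5 * rho * lst y)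
    then 2 * lst y `^ (- 2 - sigma) * lst y else 0)%:E)%E.
  apply: eq_integral => b _.
  rewrite -/(prv y) -/(lst y).
  transitivity (\int[leb]_a (if box a b (prv y) (lst y) then lst y `^ (- 2 - sigma) else 0)%:E)%E.
    apply: eq_integral => a _; rewrite -bwt_ker /F/=.
    by rewrite -(sqrrN (prv y - a)) -(sqrrN (lst y - b)) !opprB.
  rewrite /box y0/=; case: ifPn => [/andP[-> ->]|nb] /=.
    by rewrite integral_annulus_cst// powR_ge0.
  rewrite integral0_eq// => a _; rewrite ifF//; apply/negbTE.
  by rewrite andbA negb_and nb.
rewrite integral_itv_cst; last 2 first.
- by rewrite -mulrA ler_pM2l// ler_pMl// ltW.
- by rewrite mulr_ge0 ?(ltW y0)// mulr_ge0 ?powR_ge0.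
congr (_%:E).
have -> : lst y `^ (- sigma) = lst y `^ (- 2 - sigma) * lst y ^+ 2.
  rewrite -powR_mulrn ?(ltW y0)// -powRD ?(gt_eqF y0) ?implybT//.
  by congr (_ `^ _); ring.
ring.
Qed.

Variable tau : R.
Hypothesis tau0 : 0 < tau.

(** The loss of the improved Picone inequality, with (ly / lx)^(sigma - 1) in the role of t^p.
    Compared with [integral_box_above] there are two new factors: the average (1 + 2^(-tau)) / 2
    from [hw_pair], and [rho], the price of replacing the height of [y] by its least value. *)
Lemma integral_box_below x : 0 < lst x ->
  (\int[mu]_y (bwt (prv x) (lst x) (prv y) (lst y) *
      (hw tau (prv y / lst y) * (lst y / lst x) `^ (sigma - 1)) * ker x y)%:E <=
   (cker2 * (10 * (rho - 1)) * (rho * ((1 + 2 `^ (- tau)) / 2)) *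
     (hw tau (prv x / lst x) * lst x `^ (- sigma)))%:E)%E.
Proof.
move=> x0; have /andP[rho1 rho2] := rho12.
have rho0 : 0 < rho by lra.
pose G (z : measurableTypeR R * measurableTypeR R) :=
  hw tau (z.1 / z.2) * (z.2 / lst x) `^ (sigma - 1).
pose F (z : measurableTypeR R * measurableTypeR R) :=
  bwt (prv x) (lst x) z.1 z.2 * G z.
have minv2 : measurable_fun setT
    (fun z : measurableTypeR R * measurableTypeR R => z.2^-1).
  by apply: measurableT_comp; [exact: measurable_inv|exact: measurable_snd].
have mG : measurable_fun setT G.
  rewrite /G /hw; mfun.
have mF : measurable_fun setT F.
  by rewrite /F; apply: measurable_funM => //; apply: measurable_bwt; mfun.
have G0 z : 0 <= G z by rewrite mulr_ge0 ?powR_ge0// ltW// hw_gt0.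
have F0 z : 0 <= F z by rewrite mulr_ge0// bwt_ge0.
have Fx a : F (a, xcoord x n.+2) = 0.
  rewrite /F/= /bwt ifF ?mul0r// /box -/(lst x).
  by apply/negbTE/negP => /and4P[_ ? _ _]; lra.
have H := integral_rV_kernel kexp_gt' mF F0 Fx.
rewrite [leLHS]H -/cker2 kexpE2.
rewrite (_ : cker2 * _ * _ * _ = cker2 * (10 * (rho - 1) * (rho *
    ((1 + 2 `^ (- tau)) / 2)) * (hw tau (prv x / lst x) * lst x `^ (- sigma)))); last first.
  by rewrite !mulrA.
rewrite (EFinM cker2).
rewrite lee_wpmul2l ?lee_fin ?(ltW cker2_gt0)//.
set Q := (1 + 2 `^ (- tau)) / 2; set hx := hw tau (prv x / lst x).
have hx0 : 0 < hx by exact: hw_gt0.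
have Q0 : 0 < Q by rewrite divr_gt0// addr_gt0// powR_gt0.
have r51 : 0 < (5 * rho)^-1 by rewrite invr_gt0; lra.
(* For a height [b] of [y] the powers of [b] collapse to b^(-2), which is at most (5 rho / lx)^2 on
   the box. Multiplied by the length lx (rho - 1) / (5 rho), this leaves 10 (rho - 1) rho. *)
pose K := (lst x `^ (1 - sigma)) * (2 * Q * hx) * (5 * rho / lst x) ^+ 2.
have K0 : 0 <= K.
  by rewrite /K mulr_ge0 ?sqr_ge0// mulr_ge0 ?powR_ge0// !mulr_ge0// ltW.
apply: (@le_trans _ _ (\int[leb]_b (if (lst x / (5 * rho) <= b) && (b <= lst x / 5)
    then K else 0)%:E)%E); last first.
  rewrite integral_itv_cst//; last first.
    by rewrite ler_pM2l// lef_pV2 ?posrE//; lra.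
  rewrite lee_fin /K.
  have -> : lst x `^ (1 - sigma) = lst x `^ (- sigma) * lst x.
    by rewrite addrC powRD ?(gt_eqF x0) ?implybT// powRr1// ltW.
  rewrite le_eqVlt; apply/orP; left; apply/eqP; field.
  by rewrite !gt_eqF.
apply: ge0_le_integral => //.
- by move=> b _; apply: integral_ge0 => a _; rewrite lee_fin mulr_ge0 ?powR_ge0.
- apply: (measurable_fun_fubini_tonelli_G (m1 := leb)
    (fun z : measurableTypeR R * measurableTypeR R => (F z *
      ((xcoord x n.+1 - z.1) ^+ 2 + (xcoord x n.+2 - z.2) ^+ 2) `^ (- (1 + sigma / 2)))%:E)).
  + by mfun.
  + by move=> z; rewrite lee_fin mulr_ge0 ?powR_ge0.
- by apply/measurable_EFinP; mfun.
move=> /= b _; move: (b : R) => {}b; rewrite -/(prv x) -/(lst x).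
have bE a : F (a, b) * ((prv x - a) ^+ 2 + (lst x - b) ^+ 2) `^ (- (1 + sigma / 2)) =
    (if box (prv x) (lst x) a b then b `^ (- 2 - sigma) else 0) * G (a, b).
  by rewrite -bwt_ker /F/= mulrAC.
under eq_integral do rewrite bE.
have [b0|b0] := leP b 0.
  rewrite integral0_eq; last first.
    by move=> a _; rewrite /box ltNge b0/= mul0r.
  by rewrite lee_fin; case: ifP.
have bx1 : (5 * b <= lst x) = (b <= lst x / 5) by rewrite ler_pdivlMr// mulrC.
have bx2 : (lst x <= 5 * rho * b) = (lst x / (5 * rho) <= b).
  by rewrite ler_pdivrMr ?mulrA 1?mulrC//; lra.
case: ifPn => [/andP[b1 b2]|nb]; last first.
  rewrite integral0_eq// => a _; rewrite ifF ?mul0r//; apply/negbTE.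
  rewrite /box bx1 bx2 b0/= andbA negb_and; apply/orP; left.
  by rewrite andbC.
have xb5 : 5 <= lst x / b by rewrite ler_pdivlMr// bx1.
(* The walk of [hw_pair] with L = lx / b starts at z = mx / lx, so L z = mx / b, and the points a =
   mx +- w b of the annulus have a / b = L z +- w. *)
have [A [B [AB fA fB]]] := hw_pair tau0 (prv x / lst x) xb5.
have E a : (if box (prv x) (lst x) a b then b `^ (- 2 - sigma) else 0) * G (a, b) =
  (b `^ (- 2 - sigma) * (b / lst x) `^ (sigma - 1)) *
  (if annulus b (prv x) a then hw tau (a / b) else 0).
  rewrite /box b0 bx1 bx2 b1 b2/= annulusC; case: ifP => _; last by rewrite mul0r mulr0.
  by rewrite /G/=; ring.
under eq_integral do rewrite E.
have mh : measurable_fun setT (fun a : R => hw tau (a / b)) by rewrite /hw; mfun.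
have h0 a : 0 <= hw tau (a / b) by exact/ltW/hw_gt0.
have mha : measurable_fun setT (fun a : R => if annulus b (prv x) a then hw tau (a / b) else 0).
  by apply: measurable_fun_ifT => //; exact: measurable_annulus.
rewrite ge0_integral_fctZ//; last 2 first.
- by rewrite mulr_ge0 ?powR_ge0.
- by move=> a; case: ifP.
have A0 : 0 <= A by apply: le_trans (fA 2 _); [exact/ltW/hw_gt0|apply/andP; split; lra].
have B0 : 0 <= B by apply: le_trans (fB 2 _); [exact/ltW/hw_gt0|apply/andP; split; lra].
have xz : lst x / b * (prv x / lst x) = prv x / b by field; rewrite !gt_eqF.
have I := @integral_annulus_le b (prv x) A B (fun a => hw tau (a / b)) b0 A0 B0 mh h0.
apply: (@le_trans _ _ ((b `^ (- 2 - sigma) * (b / lst x) `^ (sigma - 1))%:E *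
    ((A + B) * b)%:E)%E).
  apply: lee_wpmul2l; first by rewrite lee_fin mulr_ge0 ?powR_ge0.
  apply: I => w /andP[w1 w2].
    have := fA (w / b); rewrite xz -mulrDl; apply.
    by rewrite ler_pdivlMr// ler_pdivrMr// w1 w2.
  have := fB (w / b); rewrite xz -mulrBl; apply.
  by rewrite ler_pdivlMr// ler_pdivrMr// w1 w2.
rewrite -EFinM lee_fin.
have -> : b `^ (- 2 - sigma) * (b / lst x) `^ (sigma - 1) * ((A + B) * b) =
    lst x `^ (1 - sigma) * (A + B) * (b^-1) ^+ 2.
  rewrite powRM ?(ltW b0) ?invr_ge0 ?(ltW x0)//.
  have -> : (lst x)^-1 `^ (sigma - 1) = lst x `^ (1 - sigma).
    by rewrite -powR_inv1 ?(ltW x0)// -powRrM; congr (_ `^ _); ring.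
  have -> : b `^ (- 2 - sigma) * (b `^ (sigma - 1) * lst x `^ (1 - sigma)) * ((A + B) * b)
     = lst x `^ (1 - sigma) * (A + B) * (b `^ (- 2 - sigma) * b `^ (sigma - 1) * b) by ring.
  congr (_ * _); rewrite -{3}(powRr1 (ltW b0)) -!powRD ?(gt_eqF b0) ?implybT//.
  rewrite (_ : - 2 - sigma + (sigma - 1) + 1 = - 2%:R); last by ring.
  by rewrite powR_invn ?(ltW b0)// exprVn.
rewrite /K; apply: ler_pM.
- by rewrite mulr_ge0 ?powR_ge0 ?addr_ge0.
- exact: sqr_ge0.
- apply: ler_wpM2l; first exact: powR_ge0.
  rewrite (le_trans AB)// -/hx le_eqVlt; apply/orP; left; apply/eqP.
  by rewrite /Q; field.
- rewrite ler_sqr ?nnegrE ?invr_ge0 ?(ltW b0)//; last by rewrite divr_ge0// ltW// mulr_gt0.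
  by rewrite -[leRHS]invf_div lef_pV2 ?posrE// divr_gt0// mulr_gt0.
Qed.

End kernel_integrals.

(** * Iterated integrals of nonnegative functions *)

Section double_integral.
Context d (T : measurableType d) (R : realType).
Variable nu : {sigma_finite_measure set T -> \bar R}.
Implicit Types (f g : T * T -> R) (w : T -> R).
Local Open Scope ereal_scope.

Definition dint f : \bar R := \int[nu]_x \int[nu]_y (f (x, y))%:E.

Definition nnmf f := measurable_fun setT f /\ forall z, (0 <= f z)%R.

Let mE f : nnmf f -> measurable_fun setT (fun z => (f z)%:E).
Proof. by move=> [mf _]; exact/measurable_EFinP. Qed.

Let gE f : nnmf f -> forall z, 0 <= (f z)%:E.
Proof. by move=> [_ f0] z; rewrite lee_fin. Qed.

Lemma dint_ge0 f : nnmf f -> 0 <= dint f.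
Proof.
by move=> nf; apply: integral_ge0 => x _; apply: integral_ge0 => y _; exact: gE.
Qed.

Lemma dint_swap f : nnmf f -> dint f = dint (fun z => f (z.2, z.1)).
Proof. by move=> nf; rewrite /dint (fubini_tonelli (fun z => (f z)%:E))//; [exact: mE|exact: gE]. Qed.

Lemma nnmf_swap f : nnmf f -> nnmf (fun z => f (z.2, z.1)).
Proof. by move=> [mf f0]; split=> //; exact: (measurableT_comp mf (@measurable_swap _ _ T T)). Qed.

Lemma nnmfD f g : nnmf f -> nnmf g -> nnmf (fun z => f z + g z)%R.
Proof.
by move=> [mf f0] [mg g0]; split=> [|z]; [exact: measurable_funD|exact: addr_ge0].
Qed.

Lemma nnmfZ (k : R) f : (0 <= k)%R -> nnmf f -> nnmf (fun z => k * f z)%R.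
Proof.
by move=> k0 [mf f0]; split=> [|z]; [exact: measurable_funM|exact: mulr_ge0].
Qed.

Let dintE f : nnmf f -> dint f = \int[nu \x nu]_z (f z)%:E.
Proof. by move=> nf; rewrite fubini_tonelli1//; [exact: mE|exact: gE]. Qed.

Lemma dintD f g : nnmf f -> nnmf g -> dint (fun z => f z + g z)%R = dint f + dint g.
Proof.
move=> nf ng; rewrite !dintE//; last exact: nnmfD.
by case: nf ng => [mf f0] [mg g0]; rewrite ge0_integral_fctD.
Qed.

Lemma dintZ (k : R) f : (0 <= k)%R -> nnmf f -> dint (fun z => k * f z)%R = k%:E * dint f.
Proof.
move=> k0 nf; rewrite !dintE//; last exact: nnmfZ.
by case: nf => [mf f0]; rewrite ge0_integral_fctZ.
Qed.

Lemma dint_le f g : nnmf f -> nnmf g -> (forall z, (f z <= g z)%R) -> dint f <= dint g.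
Proof.
move=> nf ng fg; rewrite !dintE//.
by case: nf ng => [mf f0] [mg g0]; exact: ge0_integral_fct_le.
Qed.

Lemma measurable_sec f x : measurable_fun setT f -> measurable_fun setT (fun y => f (x, y)).
Proof. by move=> mf; exact: (measurableT_comp mf (pair1_measurable x)). Qed.

Lemma dint_weight_le (c : T -> bool) w f (g : T -> R) (C : R) :
  measurable_fun setT c -> measurable_fun setT w -> (forall x, (0 <= w x)%R) ->
  measurable_fun setT g -> (forall x, (0 <= g x)%R) -> (0 <= C)%R -> nnmf f ->
  (forall x, c x -> \int[nu]_y (f (x, y))%:E <= (C * g x)%:E) ->
  dint (fun z => if c z.1 then w z.1 * f z else 0)%R <=
  C%:E * \int[nu]_x (if c x then w x * g x else 0)%:E.
Proof.
move=> mc mw w0 mg g0 C0 nf fC; rewrite -ge0_integral_fctZ//; last 2 first.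
- by mfun.
- by move=> x; case: ifP => // _; exact: mulr_ge0.
apply: ge0_le_integral => //.
- move=> x _; apply: integral_ge0 => y _; rewrite lee_fin; case: ifP => // _.
  by case: nf => _ f0; exact: mulr_ge0.
- apply: (measurable_fun_fubini_tonelli_F
    (fun z : T * T => (if c z.1 then w z.1 * f z else 0)%:E)).
    apply/measurable_EFinP; apply: measurable_fun_ifT => //.
      exact: (measurableT_comp mc measurable_fst).
    apply: measurable_funM; last by case: nf.
    exact: (measurableT_comp mw measurable_fst).
  move=> z; rewrite lee_fin; case: ifP => // _.
  by case: nf => _ f0; exact: mulr_ge0.
- by apply/measurable_EFinP; mfun.
move=> x _ /=; case: ifPn => [cx|_]; last by rewrite integral0 mulr0.
case: nf => mf f0; rewrite ge0_integral_fctZ//; last exact: measurable_sec.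
rewrite mulrCA EFinM; apply: lee_wpmul2l; first by rewrite lee_fin.
exact: fC.
Qed.

Lemma dint_weight_eq (c : T -> bool) w f (g : T -> R) (C : R) :
  measurable_fun setT c -> measurable_fun setT w -> (forall x, (0 <= w x)%R) ->
  measurable_fun setT g -> (forall x, (0 <= g x)%R) -> (0 <= C)%R -> nnmf f ->
  (forall x, c x -> \int[nu]_y (f (x, y))%:E = (C * g x)%:E) ->
  dint (fun z => if c z.1 then w z.1 * f z else 0)%R =
  C%:E * \int[nu]_x (if c x then w x * g x else 0)%:E.
Proof.
move=> mc mw w0 mg g0 C0 nf fC; rewrite -ge0_integral_fctZ//; last 2 first.
- by mfun.
- by move=> x; case: ifP => // _; exact: mulr_ge0.
apply: eq_integral => x _ /=; case: ifPn => [cx|_]; last by rewrite integral0 mulr0.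
case: nf => mf f0; rewrite ge0_integral_fctZ//; last exact: measurable_sec.
by rewrite mulrCA EFinM fC.
Qed.

End double_integral.

Section ratio_finite.
Variables (R : realType) (e sigma : R).
Hypothesis e01 : 0 < e < 1.
Hypothesis sigma0 : 0 < sigma.
Implicit Types phi psi : R -> R.

Lemma ratio_integral_ge0 phi : (forall l, 0 <= phi l) -> (0 <= ratio_integral e sigma phi)%E.
Proof.
move=> phi0; apply: integral_ge0 => l _; rewrite lee_fin mulr_ge0 ?powR_ge0//.
by case: ifP.
Qed.

(** On the truncated range 1 - l is at least [e], so the singular factor is at most e^(-1 -
    sigma). *)
Lemma ratio_integral_lty phi (M : R) : measurable_fun setT phi -> (forall l, 0 <= phi l) ->
  (forall l, e <= l <= 1 -> phi l <= M) -> (ratio_integral e sigma phi < +oo)%E.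
Proof.
move=> mphi phi0 phiM; have /andP[e0 e1] := e01.
have M0 : 0 <= M by apply: le_trans (phi0 1) (phiM 1 _); rewrite lexx andbT ltW.
apply: (@le_lt_trans _ _ (\int[@lebesgue_measure R]_l (if (0 <= l) && (l <= 1) then
    M * e `^ (- 1 - sigma) else 0)%:E)%E); last first.
  by rewrite integral_itv_cst ?ltry// mulr_ge0 ?powR_ge0.
apply: ge0_integral_fct_le => [||  |l].
- exact: measurable_ratio.
- by move=> l; rewrite mulr_ge0 ?powR_ge0//; case: ifP.
- by mfun.
case: ifPn => [/andP[l1 l2]|_]; last first.
  by rewrite mul0r; case: ifP => // _; rewrite mulr_ge0 ?powR_ge0.
have l01 : (0 <= l) && (l <= 1).
  by rewrite (le_trans (ltW e0) l1)/= (le_trans l2)// gerBl ltW.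
have /andP[l0 l1'] := l01.
rewrite l01; apply: ler_pM => //; first exact: powR_ge0.
  by apply: phiM; rewrite l1.
have el : e <= 1 - l by rewrite lerBrDr addrC -lerBrDr.
have n (z : R) : z `^ (- 1 - sigma) = (z `^ (1 + sigma))^-1.
  by rewrite -powRN; congr (_ `^ _); ring.
rewrite !n lef_pV2 ?posrE ?powR_gt0 ?(lt_le_trans e0 el)//.
apply: ge0_ler_powR => //; rewrite ?nnegrE ?(ltW e0)//.
- by rewrite addr_ge0// ltW.
- exact: le_trans (ltW e0) el.
Qed.

Lemma ratio_integralD phi psi :
  measurable_fun setT phi -> (forall l, 0 <= phi l) ->
  measurable_fun setT psi -> (forall l, 0 <= psi l) ->
  (ratio_integral e sigma (fun l => phi l + psi l)%R =
   ratio_integral e sigma phi + ratio_integral e sigma psi)%E.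
Proof.
move=> m1 p1 m2 p2; rewrite /ratio_integral -ge0_integral_fctD; last 4 first.
- exact: measurable_ratio.
- by move=> l; rewrite mulr_ge0 ?powR_ge0//; case: ifP.
- exact: measurable_ratio.
- by move=> l; rewrite mulr_ge0 ?powR_ge0//; case: ifP.
apply: eq_integral => l _; case: ifP => _; last by rewrite !mul0r addr0.
by rewrite mulrDl.
Qed.

Lemma eq_ratio_integral phi psi : (forall l, 0 < l < 1 -> phi l = psi l) ->
  ratio_integral e sigma phi = ratio_integral e sigma psi.
Proof.
move=> pp; have /andP[e0 e1] := e01.
apply: eq_integral => l _; case: ifPn => // /andP[l1 l2].
rewrite pp// (lt_le_trans e0 l1)/=; apply: (le_lt_trans l2).
by rewrite gtrBl.
Qed.

End ratio_finite.

(** * The inequality on a slab *)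

Arguments rV_lebesgue R n : simpl never.

Section truncated.
Variables (R : realType) (n : nat) (p sigma tau : R).
Hypotheses (p1 : 1 < p) (sigma0 : 0 < sigma) (sigmap : sigma < p) (tau0 : 0 < tau).
Notation T := 'rV[R]_n.+2.
Notation mu := (rV_lebesgue R n.+2).
Implicit Types (x y : T) (l t : R).

Definition expo : R := (sigma - 1) / p.

Lemma expo_p : expo * p = sigma - 1.
Proof. by rewrite divfK// gt_eqF// (lt_trans ltr01). Qed.

(** A ratio known up to the factor [rho] then has its power known up to the same factor, and powers
    of ratios in [e, 1] are at most [e^-1]. *)
Lemma expo_le1 : - 1 <= expo <= 1.
Proof.
have P1 := p1; have S0 := sigma0; have SP := sigmap.
have p0 : 0 < p by rewrite (lt_trans ltr01).
by rewrite /expo ler_pdivlMr// ler_pdivrMr//; apply/andP; split; lra.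
Qed.

Let Q : R := (1 + 2 `^ (- tau)) / 2.

Let Q01 : 0 < Q < 1.
Proof.
have h1 : 2 `^ (- tau) < 1 :> R.
  rewrite powRN invf_lt1 ?powR_gt0// -[ltLHS](powRr0 (2 : R)).
  by rewrite /powR pnatr_eq0/= ltr_expR ltr_pM2r// ln_gt0// ltr1n.
have h0 : 0 < 2 `^ (- tau) :> R by rewrite powR_gt0.
by rewrite /Q; apply/andP; split; lra.
Qed.

(** Close enough to 1 for the losses caused by the thickness of the box, of order
    [rho `^ (3 p + 1)], to be outweighed by the averaging factor [Q]. *)
Definition rho : R := Q^-1 `^ (3 * p + 2)^-1.

Let p2 : 0 < 3 * p + 2. Proof. by have P1 := p1; lra. Qed.

(** The product is Q^(1 / (3 p + 2)). In the exponent, 3 p comes from (rho^3)^p in [picone_pair] and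
    1 from the factor [rho] of [integral_box_below]. *)
Lemma rho_pow : rho `^ (3 * p + 1) * Q < 1.
Proof.
have /andP[Q0 Q1] := Q01.
have iQ : 1 < Q^-1 by rewrite invf_gt1.
rewrite -[ltRHS](mulVf (lt0r_neq0 Q0)) ltr_pM2r// /rho -powRrM.
rewrite -[ltRHS]powRr1 ?(ltW (lt_trans ltr01 iQ))//.
rewrite /powR gt_eqF ?(lt_trans ltr01 iQ)// ltr_expR ltr_pM2r ?ln_gt0//.
by rewrite mulrC ltr_pdivrMr// mul1r ltrD2l ltr1n.
Qed.

Lemma rho12 : 1 < rho <= 2.
Proof.
have /andP[Q0 Q1] := Q01.
have iQ : 1 < Q^-1 by rewrite invf_gt1.
have iQ2 : Q^-1 <= 2.
  rewrite -[2]invrK lef_pV2 ?posrE ?invr_gt0// /Q.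
  by have := powR_gt0 (- tau) (ltr0n R 2); lra.
apply/andP; split; rewrite /rho.
  rewrite -[ltLHS](powRr0 (Q^-1)) /powR gt_eqF ?(lt_trans ltr01 iQ)//.
  by rewrite ltr_expR ltr_pM2r ?ln_gt0// invr_gt0.
apply: le_trans iQ2; rewrite -[leRHS]powRr1 ?(ltW (lt_trans ltr01 iQ))//.
apply: ler_powR; first exact: ltW.
by rewrite invf_le1//; have P1 := p1; lra.
Qed.

Let rho1 : 1 < rho. Proof. by have /andP[] := rho12. Qed.
Let rho0 : 0 < rho. Proof. exact: lt_trans rho1. Qed.

(** On the box ly / lx lies between 1 / (5 rho) and 1 / 5, so the parameter t lies between 5^(-
    expo) / rho and 5^(- expo) times rho. [t2] is the upper end; [t3] is a fixed parameter beyond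
    it, still at most rho^3 t. *)
Definition t2 : R := rho * 5 `^ (- expo).
Definition t3 : R := rho ^+ 2 * 5 `^ (- expo).

Let t20 : 0 < t2. Proof. by rewrite mulr_gt0// powR_gt0. Qed.
Let t23 : t2 < t3.
Proof. by rewrite /t2 /t3 ltr_pM2r ?powR_gt0// expr2 ltr_pMr. Qed.

Definition gain : R := picK p t2 - picK p t3.

Lemma gain_gt0 : 0 < gain.
Proof. by rewrite subr_gt0; exact: picK_decr. Qed.

Lemma box_ratio mx lx my ly : 0 < lx -> box rho mx lx my ly ->
  (ly / lx) `^ expo <= t2 /\ t3 <= rho ^+ 3 * (ly / lx) `^ expo.
Proof.
move=> lx0 /and4P[ly0 b1 b2 _].
have r1 := rho1; have r0 := rho0; have /andP[e1 e2] := expo_le1.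
have -> : (ly / lx) `^ expo = 5 `^ (- expo) * (lx / ly / 5) `^ (- expo).
  have -> : ly / lx = (5 * (lx / ly / 5))^-1 by field; rewrite !gt_eqF.
  have z50 : 0 <= 5 * (lx / ly / 5) by rewrite mulr_ge0// !divr_ge0// ltW.
  rewrite -[X in X `^ expo](powR_inv1 z50).
  by rewrite -powRrM mulN1r powRM// !divr_ge0// ltW.
set z := lx / ly / 5.
have z1 : 1 <= z by rewrite /z ler_pdivlMr// mul1r ler_pdivlMr.
have zr : z <= rho by rewrite /z ler_pdivrMr// ler_pdivrMr// (mulrC rho).
have z0 : 0 < z by lra.
have F : 0 < 5 `^ (- expo) :> R by rewrite powR_gt0.
split.
  rewrite /t2 mulrC ler_pM2r//; apply: le_trans zr.
  by rewrite -[leRHS](powRr1 (ltW z0)); apply: ler_powR => //; lra.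
rewrite /t3 [rho ^+ 3]exprSr -mulrA ler_pM2l ?exprn_gt0// mulrCA.
rewrite -[leLHS]mulr1 ler_pM2l//.
have : z `^ (- 1) <= z `^ (- expo) by apply: ler_powR => //; lra.
rewrite powR_inv1 ?(ltW z0)// => h.
apply: (@le_trans _ _ (rho * z^-1)); last by rewrite ler_pM2l.
by rewrite ler_pdivlMr// mul1r.
Qed.

(** On the box the horizontal distance is at most 3 ly and the vertical one at most 9 ly, as
    [5 * rho <= 10]; the distance is then at most 10 ly, and the powers of ly cancel. *)
Lemma bwt_le mx lx my ly : bwt sigma rho mx lx my ly <= 10 `^ (2 + sigma).
Proof.
rewrite /bwt; case: ifPn => [|_]; last exact: powR_ge0.
move=> /and4P[ly0 b1 b2 /andP[b3 b4]].
have /andP[r1 r2] := rho12; have s0 := sigma0.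
have h : (mx - my) ^+ 2 + (lx - ly) ^+ 2 <= (10 * ly) ^+ 2.
  have : (mx - my) ^+ 2 <= (3 * ly) ^+ 2.
    by rewrite -real_normK ?num_real// ler_sqr ?nnegrE// mulr_ge0// ltW.
  have : (lx - ly) ^+ 2 <= (9 * ly) ^+ 2.
    by rewrite ler_sqr ?nnegrE; nra.
  by rewrite !exprMn; have := sqr_ge0 ly; nra.
have ly10 : 0 < 10 * ly by rewrite mulr_gt0.
have h2 : ((mx - my) ^+ 2 + (lx - ly) ^+ 2) `^ (1 + sigma / 2) <= (10 * ly) `^ (2 + sigma).
  rewrite (_ : 2 + sigma = 2%:R * (1 + sigma / 2)); last by field.
  rewrite powRrM powR_mulrn ?(ltW ly10)//; apply: ge0_ler_powR => //.
  - by rewrite addr_ge0// divr_ge0// ltW.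
  - by rewrite nnegrE addr_ge0// sqr_ge0.
  - by rewrite nnegrE sqr_ge0.
apply: le_trans (ler_wpM2r (powR_ge0 _ _) h2) _.
rewrite powRM ?(ltW ly0)// -mulrA -powRD ?(gt_eqF ly0) ?implybT//.
rewrite (_ : 2 + sigma + (- 2 - sigma) = 0); last by ring.
by rewrite powRr0 mulr1.
Qed.

(** [phi1], [phi2] are the positive and negative parts of [picG] at the parameter l^expo, and
    [psi1], [psi2] those of [picK]; [phiD] is the numerator of the sharp constant. *)
Definition phi1 l : R := pospow p (1 - l `^ expo).
Definition phi2 l : R := pospow p (l `^ expo - 1).
Definition psi1 l : R := phi1 l * (l `^ expo) `^ (1 - p).
Definition psi2 l : R := phi2 l * (l `^ expo) `^ (1 - p).
Definition phiD l : R := `|1 - l `^ expo| `^ p.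

Let phi1_ge0 l : 0 <= phi1 l. Proof. exact: pospow_ge0. Qed.
Let phi2_ge0 l : 0 <= phi2 l. Proof. exact: pospow_ge0. Qed.
Let psi1_ge0 l : 0 <= psi1 l. Proof. by rewrite mulr_ge0 ?powR_ge0. Qed.
Let psi2_ge0 l : 0 <= psi2 l. Proof. by rewrite mulr_ge0 ?powR_ge0. Qed.
Let phiD_ge0 l : 0 <= phiD l. Proof. exact: powR_ge0. Qed.

Let mphi1 : measurable_fun setT phi1. Proof. by rewrite /phi1 /pospow; mfun. Qed.
Let mphi2 : measurable_fun setT phi2. Proof. by rewrite /phi2 /pospow; mfun. Qed.
Let mpsi1 : measurable_fun setT psi1. Proof. by rewrite /psi1 /phi1 /pospow; mfun. Qed.
Let mpsi2 : measurable_fun setT psi2. Proof. by rewrite /psi2 /phi2 /pospow; mfun. Qed.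
Lemma measurable_phiD : measurable_fun setT phiD. Proof. by rewrite /phiD; mfun. Qed.

(** Here the choice of [expo] matters: l^(sigma - 1) is the p-th power of t = l^expo, which turns
    t^(1 - p) into t. *)
Let psi_pow f l : 0 < l ->
  f * (l `^ expo) `^ (1 - p) * l `^ (sigma - 1) = f * l `^ expo.
Proof.
move=> l0; rewrite -mulrA -powRrM -powRD ?(gt_eqF l0) ?implybT//.
by congr (_ * _ `^ _); rewrite -expo_p; ring.
Qed.

Lemma continuous_pospow (z : R) : z != 0 -> {for z, continuous (pospow p)}.
Proof.
move=> z0; have [zn|zp] := ltP z 0.
  have c : {for z, continuous (fun=> 0 : R)} by exact: cvg_cst.
  rewrite /prop_for /continuous_at pospow_npos ?(ltW zn)//.
  apply: cvg_trans c; apply: near_eq_cvg; near=> w.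
  by rewrite pospow_npos// ltW//; near: w; exact: lt_nbhsl.
have {z0} zp' : 0 < z by rewrite lt_neqAle eq_sym z0.
have c : {for z, continuous (fun w => w `^ (p - 1))}.
  apply: differentiable_continuous; apply/derivable1_diffP.
  by apply: derivable_powR; rewrite in_itv/= andbT.
rewrite /prop_for /continuous_at pospow_nneg//.
apply: cvg_trans c; apply: near_eq_cvg; near=> w.
by rewrite pospow_nneg// ltW//; near: w; exact: lt_nbhsr.
Unshelve. all: end_near. Qed.

Let cpow a l : 0 < l -> {for l, continuous (fun l => l `^ a)}.
Proof.
move=> l0; apply: differentiable_continuous; apply/derivable1_diffP.
by apply: derivable_powR; rewrite in_itv/= andbT.
Qed.

Let pow_neq1 l : expo != 0 -> 0 < l < 1 -> l `^ expo != 1.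
Proof.
move=> a0 /andP[l0 l1]; rewrite powR_eq1 (lt_eqF l1) (negbTE a0) orbF/=.
by rewrite -leNgt ltW.
Qed.

(** For [expo = 0] the function is identically 0. Otherwise l^expo differs from 1 on ]0, 1[, and
    [pospow] is evaluated away from 0. *)
Let cphi1 l : 0 < l < 1 -> {for l, continuous phi1}.
Proof.
move=> l01; have [a0|a0] := eqVneq expo 0.
  have -> : phi1 = fun=> 0; last exact: cvg_cst.
  by apply/funext => z; rewrite /phi1 a0 powRr0 subrr pospow_npos.
have /andP[l0 l1] := l01.
apply: (@continuous_comp _ _ _ (fun l => 1 - l `^ expo) (pospow p)).
  by apply: continuousB; [exact: cvg_cst|exact: cpow].
by apply: continuous_pospow; rewrite subr_eq0 eq_sym pow_neq1.
Qed.

Let cphi2 l : 0 < l < 1 -> {for l, continuous phi2}.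
Proof.
move=> l01; have [a0|a0] := eqVneq expo 0.
  have -> : phi2 = fun=> 0; last exact: cvg_cst.
  by apply/funext => z; rewrite /phi2 a0 powRr0 subrr pospow_npos.
have /andP[l0 l1] := l01.
apply: (@continuous_comp _ _ _ (fun l => l `^ expo - 1) (pospow p)).
  by apply: continuousB; [exact: cpow|exact: cvg_cst].
by apply: continuous_pospow; rewrite subr_eq0 pow_neq1.
Qed.

Let cpp l : 0 < l < 1 -> {for l, continuous (fun l => (l `^ expo) `^ (1 - p))}.
Proof.
move=> /andP[l0 _]; have -> : (fun l => (l `^ expo) `^ (1 - p)) = (fun l => l `^ (expo * (1 - p))).
  by apply/funext => z; rewrite powRrM.
exact: cpow.
Qed.

Let cpsi1 l : 0 < l < 1 -> {for l, continuous psi1}.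
Proof. by move=> l01; apply: cvgM; [exact: cphi1|exact: cpp]. Qed.

Let cpsi2 l : 0 < l < 1 -> {for l, continuous psi2}.
Proof. by move=> l01; apply: cvgM; [exact: cphi2|exact: cpp]. Qed.

(** [l] is the ratio of the last coordinates of [y] and [x], and [X], [Y] are the
    values of the function at [x], [y]. *)
Lemma picone_pair X Y l c : 0 <= X -> 0 <= Y -> 0 < l ->
  (c = 0 \/ [/\ 0 <= c <= gain, l `^ expo <= t2 & t3 <= rho ^+ 3 * l `^ expo]) ->
  phi1 l * X `^ p + psi2 l * Y `^ p + c * Y `^ p <=
  `|X - Y| `^ p + phi2 l * X `^ p + psi1 l * Y `^ p
    + c * (rho ^+ 3) `^ p * l `^ (sigma - 1) * X `^ p.
Proof.
move=> X0 Y0 l0 H; have tl : 0 < l `^ expo by rewrite powR_gt0.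
have E : l `^ (sigma - 1) = (l `^ expo) `^ p by rewrite -powRrM expo_p.
have K : c * (Y `^ p - (rho ^+ 3) `^ p * (l `^ expo) `^ p * X `^ p) +
    picG p (l `^ expo) * X `^ p - picK p (l `^ expo) * Y `^ p <= `|X - Y| `^ p.
  case: H => [->|[c01 h2 h3]].
    by rewrite mul0r add0r; exact: picone.
  exact: (picone_gain p1 X0 Y0 tl h2 t23 h3 c01).
rewrite E; move: K; rewrite /picK /picG /psi1 /psi2 /phi1 /phi2.
lra.
Qed.

(** Normalized by [bwt_le], so that [gain0] times the box weight never exceeds [gain]. *)
Definition gain0 : R := gain * 10 `^ (- (2 + sigma)).

Lemma gain0_gt0 : 0 < gain0. Proof. by rewrite mulr_gt0 ?gain_gt0 ?powR_gt0. Qed.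

(** The total gain times 1 minus the ratio of loss to gain; [rho_pow] makes the last factor
    positive. *)
Definition rem_const : R := gain0 * (cker2 n sigma * (10 * (rho - 1))) *
  (1 - rho `^ (3 * p + 1) * Q).

Lemma rem_const_gt0 : 0 < rem_const.
Proof.
rewrite mulr_gt0 ?subr_gt0 ?rho_pow// mulr_gt0 ?gain0_gt0// mulr_gt0 ?cker2_gt0//.
by rewrite mulr_gt0// subr_gt0.
Qed.

Definition Uint (v : T -> R) : \bar R :=
  (\int[mu]_x (if (0 < lst x)%R then v x `^ p * lst x `^ (- sigma) else 0)%:E)%E.

Definition Wint (v : T -> R) : \bar R :=
  (\int[mu]_x (if (0 < lst x)%R then
    hw tau (prv x / lst x) * v x `^ p * lst x `^ (- sigma) else 0)%:E)%E.

Definition energy_fun (v : T -> R) (z : T * T) : R :=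
  if (0 < lst z.1) && (0 < lst z.2) then
    `|v z.1 - v z.2| `^ p * ker sigma z.1 z.2 else 0.

Lemma nnmf_energy (v : T -> R) : measurable_fun setT v -> nnmf (energy_fun v).
Proof.
move=> mv; split=> [|z]; last first.
  by rewrite /energy_fun; case: ifP => // _; rewrite mulr_ge0 ?powR_ge0 ?ker_ge0.
have ml : measurable_fun setT (@lst R n) by exact: measurable_xcoord.
have ml1 := measurableT_comp ml (@measurable_fst _ _ T T).
have ml2 := measurableT_comp ml (@measurable_snd _ _ T T).
have mv1 := measurableT_comp mv (@measurable_fst _ _ T T).
have mv2 := measurableT_comp mv (@measurable_snd _ _ T T).
have mk : measurable_fun setT (fun z : T * T => ker sigma z.1 z.2).
  rewrite /ker; apply: measurable_fun_powR.
  by apply: measurable_dist2; [exact: measurable_fst|exact: measurable_snd].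
rewrite /energy_fun; apply: measurable_fun_ifT => //.
  by apply: measurable_and; apply: measurable_fun_ltr.
apply: measurable_funM => //; apply: measurable_fun_powR.
by apply: measurable_fun_normr; apply: measurable_funB.
Qed.

Section main_estimate.
Variables (v : T -> R) (e : R).
Hypotheses (mv : measurable_fun setT v) (v0 : forall x, 0 <= v x).
Hypothesis e10 : 0 < e <= 10^-1.

Let e0 : 0 < e. Proof. by case/andP: e10. Qed.
Let e01 : 0 < e < 1.
Proof. by rewrite e0/=; case/andP: e10 => _ h; apply: le_lt_trans h _; rewrite invf_lt1// ltr1n. Qed.

Let ml : measurable_fun setT (@lst R n). Proof. exact: measurable_xcoord. Qed.
Let mp : measurable_fun setT (@prv R n). Proof. exact: measurable_xcoord. Qed.
Let ml1 : measurable_fun setT (fun z : T * T => lst z.1).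
Proof. exact: (measurableT_comp ml measurable_fst). Qed.
Let ml2 : measurable_fun setT (fun z : T * T => lst z.2).
Proof. exact: (measurableT_comp ml measurable_snd). Qed.
Let mp1 : measurable_fun setT (fun z : T * T => prv z.1).
Proof. exact: (measurableT_comp mp measurable_fst). Qed.
Let mp2 : measurable_fun setT (fun z : T * T => prv z.2).
Proof. exact: (measurableT_comp mp measurable_snd). Qed.
Let mv1 : measurable_fun setT (fun z : T * T => v z.1).
Proof. exact: (measurableT_comp mv measurable_fst). Qed.
Let mv2 : measurable_fun setT (fun z : T * T => v z.2).
Proof. exact: (measurableT_comp mv measurable_snd). Qed.
Let mker : measurable_fun setT (fun z : T * T => ker sigma z.1 z.2).
Proof.
rewrite /ker; apply: measurable_fun_powR.
by apply: measurable_dist2; [exact: measurable_fst|exact: measurable_snd].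
Qed.
Let mil : measurable_fun setT (fun x : T => (lst x)^-1).
Proof. by apply: (measurableT_comp (@measurable_inv R)). Qed.
Let mil1 : measurable_fun setT (fun z : T * T => (lst z.1)^-1).
Proof. by apply: (measurableT_comp (@measurable_inv R)). Qed.
Let mil2 : measurable_fun setT (fun z : T * T => (lst z.2)^-1).
Proof. by apply: (measurableT_comp (@measurable_inv R)). Qed.
Let mc : measurable_fun setT (fun x : T => 0 < lst x).
Proof. by mfun. Qed.
Let mvp : measurable_fun setT (fun x : T => v x `^ p). Proof. by mfun. Qed.
Let mls : measurable_fun setT (fun x : T => lst x `^ (- sigma)). Proof. by mfun. Qed.
Let mhv : measurable_fun setT (fun x : T => hw tau (prv x / lst x) * v x `^ p).
Proof. by rewrite /hw; mfun. Qed.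

Let slab (z : T * T) : bool :=
  (e * lst z.1 <= lst z.2) && (lst z.2 <= (1 - e) * lst z.1).

Let shape (phi : R -> R) (z : T * T) : R :=
  (if slab z then phi (lst z.2 / lst z.1) else 0) * ker sigma z.1 z.2.

Let bk (z : T * T) : R :=
  bwt sigma rho (prv z.1) (lst z.1) (prv z.2) (lst z.2) * ker sigma z.1 z.2.

(** The kernel of the loss: the value of [v] that it multiplies is taken at [x], but [hw] is still
    evaluated at [y]. *)
Let bkh (z : T * T) : R :=
  bwt sigma rho (prv z.1) (lst z.1) (prv z.2) (lst z.2) *
    (hw tau (prv z.2 / lst z.2) * (lst z.2 / lst z.1) `^ (sigma - 1)) * ker sigma z.1 z.2.

Let Jf (z : T * T) : R := if (0 < lst z.1) && slab z then
  `|v z.1 - v z.2| `^ p * ker sigma z.1 z.2 else 0.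

Let nshape (phi : R -> R) : measurable_fun setT phi -> (forall l, 0 <= phi l) -> nnmf (shape phi).
Proof.
move=> mphi phi0; split=> [|z]; last first.
  by rewrite mulr_ge0 ?ker_ge0//; case: ifP.
have m : measurable_fun setT (fun z : T * T => phi (lst z.2 / lst z.1)).
  by apply: (measurableT_comp mphi); mfun.
by rewrite /shape /slab; mfun.
Qed.

Let nbk : nnmf bk.
Proof.
split=> [|z]; last by rewrite mulr_ge0 ?ker_ge0 ?bwt_ge0.
by rewrite /bk; apply: measurable_funM => //; exact: measurable_bwt.
Qed.

Let nbkh : nnmf bkh.
Proof.
split=> [|z]; last first.
  by rewrite !mulr_ge0 ?ker_ge0 ?bwt_ge0 ?powR_ge0// ltW// hw_gt0.
rewrite /bkh; apply: measurable_funM => //.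
apply: measurable_funM; first exact: measurable_bwt.
by rewrite /hw; mfun.
Qed.

Let nJf : nnmf Jf.
Proof.
split=> [|z]; first by rewrite /Jf /slab; mfun.
by rewrite /Jf; case: ifP => // _; rewrite mulr_ge0 ?powR_ge0 ?ker_ge0.
Qed.

Let Bx phi (z : T * T) : R := if 0 < lst z.1 then v z.1 `^ p * shape phi z else 0.
Let By phi (z : T * T) : R := if 0 < lst z.2 then v z.2 `^ p * shape phi z else 0.
Let Gx (z : T * T) : R := if 0 < lst z.1 then v z.1 `^ p * bkh z else 0.
Let Gy (z : T * T) : R := if 0 < lst z.2 then
  hw tau (prv z.2 / lst z.2) * v z.2 `^ p * bk z else 0.

Let slab_pos z : slab z -> 0 < lst z.2 -> 0 < lst z.1.
Proof.
move=> /andP[s1 s2] z2; have E1 : 0 < 1 - e by rewrite subr_gt0; case/andP: e01.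
by rewrite -(pmulr_rgt0 _ E1) (lt_le_trans z2).
Qed.

Let slab_pos' z : slab z -> 0 < lst z.1 -> 0 < lst z.2.
Proof. by move=> /andP[s1 s2] z1; rewrite (lt_le_trans _ s1)// mulr_gt0. Qed.

(** From lx <= 5 rho ly <= 10 ly and ly <= lx / 5; this is where [e <= 10^-1] enters. *)
Let box_slab z : box rho (prv z.1) (lst z.1) (prv z.2) (lst z.2) ->
  0 < lst z.1 /\ slab z.
Proof.
move=> /and4P[z2 b1 b2 _]; have /andP[r1 r2] := rho12; have /andP[E0 E1] := e10.
have z1 : 0 < lst z.1 by apply: lt_le_trans b1; rewrite mulr_gt0.
split=> //; apply/andP; split.
  have h1 : e * lst z.1 <= 10^-1 * lst z.1 by rewrite ler_pM2r.
  have h2 : 5 * rho * lst z.2 <= 10 * lst z.2 by rewrite ler_pM2r//; lra.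
  by lra.
have h1 : e * lst z.1 <= 10^-1 * lst z.1 by rewrite ler_pM2r.
by lra.
Qed.

(** [picone_pair] times the kernel, with [c] equal to [gain0] times box weight times [hw]. Negative
    terms are moved across so that each term can be integrated separately. *)
Let pointwise z : Bx phi1 z + By psi2 z + gain0 * Gy z <=
  Jf z + Bx phi2 z + By psi1 z + gain0 * (rho ^+ 3) `^ p * Gx z.
Proof.
(* Off the slab every term on the left is 0, the gain included because the box lies in the slab. *)
have [/andP[z1 s]|ns] := boolP ((0 < lst z.1) && slab z); last first.
  have b0 : bwt sigma rho (prv z.1) (lst z.1) (prv z.2) (lst z.2) = 0.
    rewrite /bwt ifF//; apply/negbTE; apply: contra ns => /box_slab[-> ->//].
  have sh0 phi : (0 < lst z.1) || (0 < lst z.2) -> shape phi z = 0.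
    move=> z12; rewrite /shape ifF ?mul0r//; apply/negbTE; apply: contra ns => s.
    by rewrite s andbT; case/orP: z12 => //; exact: slab_pos.
  have Bx0 phi : Bx phi z = 0.
    by rewrite /Bx; case: ifP => // z1; rewrite sh0 ?z1// mulr0.
  have By0 phi : By phi z = 0.
    by rewrite /By; case: ifP => // z2; rewrite sh0 ?z2 ?orbT// mulr0.
  rewrite !Bx0 !By0 /Gy /bk /Gx /bkh b0 !mul0r !mulr0 !if_same !mulr0 !addr0.
  by case: nJf.
have z2 := slab_pos' s z1.
rewrite /Bx /By /Gx /Gy /Jf /bk /bkh /shape z1 z2 s/=.
set k := ker _ _ _; set b := bwt _ _ _ _ _ _; set h := hw _ _; set l := lst z.2 / lst z.1.
have k0 : 0 <= k by exact: ker_ge0.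
have l0 : 0 < l by rewrite divr_gt0.
(* Outside the box [c] is 0 and plain Picone is used; inside, [bwt_le] and [hw <= 1] bound it by
   [gain]. *)
have C : gain0 * b * h = 0 \/ [/\ 0 <= gain0 * b * h <= gain, l `^ expo <= t2 &
    t3 <= rho ^+ 3 * l `^ expo].
  have [B|B] := boolP (box rho (prv z.1) (lst z.1) (prv z.2) (lst z.2)); last first.
    by left; rewrite /b /bwt (negbTE B) mulr0 mul0r.
  right; have [h1 h2] := box_ratio z1 B; split=> //.
  have h0 : 0 < h by exact: hw_gt0.
  have b0 : 0 <= b by exact: bwt_ge0.
  have gb : 0 <= gain0 * b by apply: mulr_ge0 => //; exact: ltW gain0_gt0.
  apply/andP; split; first by apply: mulr_ge0 => //; exact: ltW h0.
  have hle : h <= 1 by exact: hw_le1.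
  apply: (@le_trans _ _ (gain0 * b)).
    by apply: ler_piMr.
  have q : 10 `^ (- (2 + sigma)) * b <= 1.
    by rewrite powRN mulrC ler_pdivrMr ?powR_gt0// mul1r; exact: bwt_le.
  by rewrite /gain0 -mulrA; apply: ler_piMr => //; exact: ltW gain_gt0.
have := ler_wpM2r k0 (picone_pair (v0 z.1) (v0 z.2) l0 C).
rewrite !mulrDl => H.
have e1 : gain0 * b * h * v z.2 `^ p * k = gain0 * (h * v z.2 `^ p * (b * k)) by ring.
have e2 : gain0 * b * h * (rho ^+ 3) `^ p * l `^ (sigma - 1) * v z.1 `^ p * k =
  gain0 * (rho ^+ 3) `^ p * (v z.1 `^ p * (b * (h * l `^ (sigma - 1)) * k)) by ring.
rewrite e1 e2 in H.
rewrite [v z.1 `^ p * (phi1 l * k)]mulrCA [v z.2 `^ p * (psi2 l * k)]mulrCA.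
rewrite [v z.1 `^ p * (phi2 l * k)]mulrCA [v z.2 `^ p * (psi1 l * k)]mulrCA.
by rewrite !mulrA in H *.
Qed.

Let dintBx (phi : R -> R) (r : R) : measurable_fun setT phi -> (forall l, 0 <= phi l) -> 0 <= r ->
  ratio_integral e sigma phi = r%:E ->
  dint mu (Bx phi) = ((cker n sigma * r)%:E * Uint v)%E.
Proof.
move=> mphi phi0 r0 rE.
apply: (@dint_weight_eq _ _ _ mu (fun x => 0 < lst x) (fun x => v x `^ p) (shape phi)
  (fun x => lst x `^ (- sigma)) (cker n sigma * r) mc mvp _ mls).
- by move=> x; exact: powR_ge0.
- by move=> x; exact: powR_ge0.
- by rewrite mulr_ge0 ?(ltW (cker_gt0 n sigma0)).
- exact: nshape.
move=> x x0; have H := integral_ker_below sigma0 e01 x0 mphi phi0.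
by rewrite [LHS]H rE -EFinM mulrAC.
Qed.

Let dintBy (phi : R -> R) (r : R) : measurable_fun setT phi -> (forall l, 0 <= phi l) -> 0 <= r ->
  (forall l, 0 < l < 1 -> {for l, continuous phi}) ->
  ratio_integral e sigma (fun l => phi l * l `^ (sigma - 1)) = r%:E ->
  dint mu (By phi) = ((cker n sigma * r)%:E * Uint v)%E.
Proof.
move=> mphi phi0 r0 cphi rE.
have nB : nnmf (By phi).
  have [m1 m2] := nshape mphi phi0; split=> [|z].
    by rewrite /By; mfun.
  by rewrite /By; case: ifP => // _; rewrite mulr_ge0 ?powR_ge0.
rewrite dint_swap//.
apply: (@dint_weight_eq _ _ _ mu (fun x => 0 < lst x) (fun x => v x `^ p)
  (fun z => shape phi (z.2, z.1)) (fun x => lst x `^ (- sigma)) (cker n sigma * r)) => //.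
- by move=> x; exact: powR_ge0.
- by move=> x; exact: powR_ge0.
- by rewrite mulr_ge0 ?(ltW (cker_gt0 n sigma0)).
- by apply: nnmf_swap; exact: nshape.
move=> x x0; have H := integral_ker_above sigma0 e01 x0 mphi phi0 cphi.
by rewrite [LHS]H rE -EFinM mulrAC.
Qed.

Let kY : R := cker2 n sigma * (10 * (rho - 1)).

Let kY0 : 0 <= kY.
Proof. by rewrite mulr_ge0 ?(ltW (cker2_gt0 n sigma0))// mulr_ge0// subr_ge0 ltW. Qed.

Let nGy : nnmf Gy.
Proof.
have [m1 m2] := nbk; split=> [|z].
  have m : measurable_fun setT (fun z : T * T => hw tau (prv z.2 / lst z.2)).
    by rewrite /hw; mfun.
  by rewrite /Gy; mfun.
rewrite /Gy; case: ifP => // _; apply: mulr_ge0 => //; apply: mulr_ge0; last exact: powR_ge0.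
by rewrite ltW// hw_gt0.
Qed.

Let nGx : nnmf Gx.
Proof.
have [m1 m2] := nbkh; split=> [|z]; first by rewrite /Gx; mfun.
by rewrite /Gx; case: ifP => // _; rewrite mulr_ge0 ?powR_ge0.
Qed.

(** Integrating in [x] first, [hw] and [v] depend on [y] only and factor out. *)
Let dintGy : dint mu Gy = (kY%:E * Wint v)%E.
Proof.
rewrite dint_swap//.
apply: (@dint_weight_eq _ _ _ mu (fun x => 0 < lst x)
  (fun x => hw tau (prv x / lst x) * v x `^ p)
  (fun z => bk (z.2, z.1)) (fun x => lst x `^ (- sigma)) kY mc mhv _ mls _ kY0).
- by move=> x; rewrite mulr_ge0 ?powR_ge0// ltW// hw_gt0.
- by move=> x; exact: powR_ge0.
- exact: nnmf_swap nbk.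
by move=> x x0; exact: (integral_box_above sigma0 rho12 x0).
Qed.

Let dintGx : (dint mu Gx <= (kY * (rho * Q))%:E * Wint v)%E.
Proof.
have /andP[Q0 _] := Q01.
have -> : Wint v = (\int[mu]_x (if (0 < lst x)%R then
    v x `^ p * (hw tau (prv x / lst x) * lst x `^ (- sigma)) else 0)%:E)%E.
  by apply: eq_integral => x _; case: ifP => // _; congr (_%:E); ring.
apply: (@dint_weight_le _ _ _ mu (fun x => 0 < lst x) (fun x => v x `^ p) bkh
  (fun x => hw tau (prv x / lst x) * lst x `^ (- sigma)) (kY * (rho * Q))) => //.
- by move=> x; exact: powR_ge0.
- by rewrite /hw; mfun.
- by move=> x; rewrite mulr_ge0 ?powR_ge0// ltW// hw_gt0.
- by rewrite mulr_ge0// mulr_ge0// ltW.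
by move=> x x0; exact: (integral_box_below sigma0 rho12 tau0 x0).
Qed.

Let nBx (phi : R -> R) : measurable_fun setT phi -> (forall l, 0 <= phi l) -> nnmf (Bx phi).
Proof.
move=> mphi phi0; have [m1 m2] := nshape mphi phi0; split=> [|z].
  by rewrite /Bx; mfun.
by rewrite /Bx; case: ifP => // _; rewrite mulr_ge0 ?powR_ge0.
Qed.

Let nBy (phi : R -> R) : measurable_fun setT phi -> (forall l, 0 <= phi l) -> nnmf (By phi).
Proof.
move=> mphi phi0; have [m1 m2] := nshape mphi phi0; split=> [|z].
  by rewrite /By; mfun.
by rewrite /By; case: ifP => // _; rewrite mulr_ge0 ?powR_ge0.
Qed.

(** On the slab the second point is strictly lower, so the slab and its transpose are disjoint, and
    the energy is symmetric. *)
Let dintJ_energy : (2%:E * dint mu Jf <= dint mu (energy_fun v))%E.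
Proof.
have nE := nnmf_energy mv.
have nJ' := nnmf_swap nJf.
have -> : (2%:E * dint mu Jf = dint mu Jf + dint mu (fun z => Jf (z.2, z.1)))%E.
  by rewrite -(dint_swap mu nJf) -[in RHS](mul1e (dint mu Jf)) -ge0_muleDl// -EFinD.
rewrite -(dintD mu nJf nJ'); apply: dint_le => //; first exact: nnmfD.
move=> z; rewrite /Jf /energy_fun /=.
have E1 : 1 - e < 1 by rewrite gtrBl.
have [/andP[a1 s1]|_] := boolP ((0 < lst z.1) && slab z);
  have [/andP[a2 s2]|_] := boolP ((0 < lst z.2) && slab (z.2, z.1)).
- exfalso; move: s1 s2 => /andP[_ /=s1] /andP[_ /=s2].
  have h1 : (1 - e) * lst z.1 < lst z.1 by rewrite gtr_pMl.
  have h2 : (1 - e) * lst z.2 < lst z.2 by rewrite gtr_pMl.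
  by have := lt_trans (le_lt_trans s1 h1) (le_lt_trans s2 h2); rewrite ltxx.
- by rewrite a1 (slab_pos' s1 a1)/= addr0.
- by rewrite a2 (slab_pos' s2 a2)/= add0r distrC kerC.
- by rewrite addr0; case: ifP => // _; rewrite mulr_ge0 ?powR_ge0 ?ker_ge0.
Qed.

(** [picG_eq] integrated over the ratio, with all terms on the side where they are added. The Hardy
    term is the surplus [phiD]. *)
Let ratio_balance : (ratio_integral e sigma phi1 +
    ratio_integral e sigma (fun l => (phi2 l * l `^ expo)%R) =
  ratio_integral e sigma phi2 +
    ratio_integral e sigma (fun l => (phi1 l * l `^ expo)%R) +
  ratio_integral e sigma phiD)%E.
Proof.
have mle : measurable_fun setT (fun l : R => l `^ expo) by mfun.
have m1 : measurable_fun setT (fun l => phi1 l * l `^ expo) by exact: measurable_funM.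
have m2 : measurable_fun setT (fun l => phi2 l * l `^ expo) by exact: measurable_funM.
have g1 (l : R) : 0 <= phi1 l * l `^ expo by rewrite mulr_ge0 ?powR_ge0.
have g2 (l : R) : 0 <= phi2 l * l `^ expo by rewrite mulr_ge0 ?powR_ge0.
have m3 : measurable_fun setT (fun l => phi2 l + phi1 l * l `^ expo).
  exact: measurable_funD.
have g3 (l : R) : 0 <= phi2 l + phi1 l * l `^ expo by rewrite addr_ge0.
have D1 := ratio_integralD e sigma mphi1 phi1_ge0 m2 g2.
have D2 := ratio_integralD e sigma mphi2 phi2_ge0 m1 g1.
have D3 := ratio_integralD e sigma m3 g3 measurable_phiD phiD_ge0.
have X : ratio_integral e sigma (fun l => phi1 l + phi2 l * l `^ expo) =
    ratio_integral e sigma (fun l => phi2 l + phi1 l * l `^ expo + phiD l).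
  apply: eq_ratio_integral => // l /andP[l0 l1].
  have tl : 0 < l `^ expo by rewrite powR_gt0.
  have -> : phiD l = phi1 l - phi2 l - (phi1 l - phi2 l) * l `^ expo.
    rewrite /phiD picG_eq// /picK /picG -/(phi1 l) -/(phi2 l) -mulrA.
    rewrite -powRD ?(gt_eqF tl) ?implybT// subrK powRr1//; exact: ltW.
  by ring.
exact: etrans (esym D1) (etrans X (etrans D3 (congr1 (fun w => w + _)%E D2))).
Qed.

(** [pointwise] is integrated; multiples of [Uint v] then stand on both sides and cancel up to the
    surplus of [ratio_balance]. Finiteness of [Uint v] and of the truncated ratio integrals allows
    this cancellation in the reals. *)
Lemma hardy_truncated : (Uint v < +oo)%E ->
  ((2 * cker n sigma)%:E * ratio_integral e sigma phiD * Uint v +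
    (2 * rem_const)%:E * Wint v <= dint mu (energy_fun v))%E.
Proof.
move=> Ulty.
have /andP[Q0 Q1] := Q01; have /andP[E0 E1] := e01.
(* One bound for all the ratio functions below: l^expo is at most [e^-1] on [e, 1], since |expo| <=
   1. *)
have fin (f : R -> R) : measurable_fun setT f -> (forall l, 0 <= f l) ->
    (forall l, e <= l <= 1 -> f l <= pospow p (1 + e^-1) * (1 + e^-1)) ->
    exists2 r : R, 0 <= r & ratio_integral e sigma f = r%:E.
  move=> mf f0 fM; exists (fine (ratio_integral e sigma f)).
    by rewrite fine_ge0// ratio_integral_ge0.
  rewrite fineK// ge0_fin_numE ?ratio_integral_ge0//.
  exact: (ratio_integral_lty e01 sigma0 mf f0 fM).
have ie : 1 <= e^-1 by rewrite invf_ge1// ltW.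
have lle (l : R) : e <= l <= 1 -> 0 <= l `^ expo <= e^-1.
  move=> /andP[l1 l2]; rewrite powR_ge0/=.
  have l0 : 0 < l := lt_le_trans E0 l1.
  have /andP[a1 a2] := expo_le1.
  apply: (@le_trans _ _ (l `^ (- 1))).
    by apply: ger_powR => //; rewrite l0.
  by rewrite powR_inv1 ?(ltW l0)// lef_pV2.
have pe0 : 0 <= pospow p (1 + e^-1) by exact: pospow_ge0.
have f1M (l : R) : e <= l <= 1 -> phi1 l <= pospow p (1 + e^-1).
  by move=> /lle/andP[h1 h2]; apply: pospow_le => //; lra.
have f2M (l : R) : e <= l <= 1 -> phi2 l <= pospow p (1 + e^-1).
  by move=> /lle/andP[h1 h2]; apply: pospow_le => //; lra.
have big1 : pospow p (1 + e^-1) <= pospow p (1 + e^-1) * (1 + e^-1).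
  by rewrite ler_peMr//; lra.
have [r1 r10 r1E] : exists2 r : R, 0 <= r & ratio_integral e sigma phi1 = r%:E.
  by apply: fin => // l /f1M h; exact: le_trans big1.
have [r2 r20 r2E] : exists2 r : R, 0 <= r & ratio_integral e sigma phi2 = r%:E.
  by apply: fin => // l /f2M h; exact: le_trans big1.
have mle : measurable_fun setT (fun l : R => l `^ expo) by mfun.
have [q1 q10 q1E] : exists2 r : R, 0 <= r &
    ratio_integral e sigma (fun l => phi1 l * l `^ expo) = r%:E.
  apply: fin => [||l h]; [exact: measurable_funM|by move=> l; rewrite mulr_ge0 ?powR_ge0|].
  have /andP[h1 h2] := lle _ h.
  by apply: ler_pM => //; [exact: f1M|lra].
have [q2 q20 q2E] : exists2 r : R, 0 <= r &
    ratio_integral e sigma (fun l => phi2 l * l `^ expo) = r%:E.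
  apply: fin => [||l h]; [exact: measurable_funM|by move=> l; rewrite mulr_ge0 ?powR_ge0|].
  have /andP[h1 h2] := lle _ h.
  by apply: ler_pM => //; [exact: f2M|lra].
have [rd rd0 rdE] : exists2 r : R, 0 <= r & ratio_integral e sigma phiD = r%:E.
  apply: fin => [|//|l h]; first exact: measurable_phiD.
  have /andP[h1 h2] := lle _ h.
  rewrite pospow_nneg; last by lra.
  have e11 : 0 <= 1 + e^-1 by lra.
  rewrite mulrC mulr_powRB1//; last exact: lt_trans p1.
  apply: ge0_ler_powR; rewrite ?nnegrE//; first by rewrite ltW// (lt_trans ltr01).
  by rewrite ler_norml; apply/andP; split; lra.
have R1 : ratio_integral e sigma (fun l => psi1 l * l `^ (sigma - 1)) = q1%:E.
  by rewrite -q1E; apply: eq_ratio_integral => // l /andP[l0 _]; exact: psi_pow.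
have R2 : ratio_integral e sigma (fun l => psi2 l * l `^ (sigma - 1)) = q2%:E.
  by rewrite -q2E; apply: eq_ratio_integral => // l /andP[l0 _]; exact: psi_pow.
have bal : r1 + q2 = r2 + q1 + rd.
  apply: EFin_inj; rewrite !EFinD -r1E -r2E -q1E -q2E -rdE.
  exact: ratio_balance.
have U0 : (0 <= Uint v)%E.
  by apply: integral_ge0 => x _; rewrite lee_fin; case: ifP => // _; rewrite mulr_ge0 ?powR_ge0.
have W0 : (0 <= Wint v)%E.
  apply: integral_ge0 => x _; rewrite lee_fin; case: ifP => // _.
  by rewrite !mulr_ge0 ?powR_ge0// ltW// hw_gt0.
(* Since [hw] is at most 1; it makes the remainder integral finite too. *)
have WU : (Wint v <= Uint v)%E.
  apply: ge0_integral_fct_le => [||  |x].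
  - by mfun.
  - by move=> x; case: ifP => // _; rewrite !mulr_ge0 ?powR_ge0// ltW// hw_gt0.
  - by mfun.
  case: ifP => // _; rewrite ler_wpM2r ?powR_ge0// ler_piMl ?powR_ge0//.
  exact: hw_le1.
have [U UE] : exists U : R, Uint v = U%:E.
  by exists (fine (Uint v)); rewrite fineK// ge0_fin_numE.
have [W WE] : exists W : R, Wint v = W%:E.
  exists (fine (Wint v)); rewrite fineK// ge0_fin_numE//.
  exact: le_lt_trans WU Ulty.
have U0' : 0 <= U by rewrite -lee_fin -UE.
have W0' : 0 <= W by rewrite -lee_fin -WE.
have g0 := ltW gain0_gt0.
have th0 : 0 <= gain0 * (rho ^+ 3) `^ p by rewrite mulr_ge0 ?powR_ge0.
have key : (dint mu (Bx phi1) + dint mu (By psi2) + gain0%:E * dint mu Gy <=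
  dint mu Jf + dint mu (Bx phi2) + dint mu (By psi1)
    + (gain0 * (rho ^+ 3) `^ p)%:E * dint mu Gx)%E.
  have n1 := nBx mphi1 phi1_ge0; have n2 := nBx mphi2 phi2_ge0.
  have n3 := nBy mpsi1 psi1_ge0; have n4 := nBy mpsi2 psi2_ge0.
  have n5 := nnmfZ g0 nGy; have n6 := nnmfZ th0 nGx.
  have n7 := nnmfD n1 n4; have n8 := nnmfD nJf n2; have n9 := nnmfD n8 n3.
  rewrite -(dintZ _ g0 nGy) -(dintZ _ th0 nGx).
  rewrite -(dintD _ n1 n4) -(dintD _ n7 n5) -(dintD _ nJf n2) -(dintD _ n8 n3).
  rewrite -(dintD _ n9 n6); apply: dint_le; [exact: nnmfD|exact: nnmfD|].
  exact: pointwise.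
have C0 := ltW (cker_gt0 n sigma0).
rewrite (dintBx mphi1 phi1_ge0 r10 r1E) (dintBy mpsi2 psi2_ge0 q20 cpsi2 R2) in key.
rewrite (dintBx mphi2 phi2_ge0 r20 r2E) (dintBy mpsi1 psi1_ge0 q10 cpsi1 R1) in key.
rewrite dintGy in key.
have key2 := le_trans key (leeD2l _ (lee_wpmul2l _ dintGx)).
have {key2} key3 := key2 th0.
apply: le_trans dintJ_energy; rewrite rdE.
have J0 : (0 <= dint mu Jf)%E by exact: dint_ge0.
move: key3 J0; rewrite UE WE; case: (dint mu Jf) => [J| |]//; last first.
  by move=> _ _; rewrite gt0_muley ?leey// lte_fin.
rewrite -!EFinM -!EFinD !lee_fin => H _.
have rp : (rho ^+ 3) `^ p * rho = rho `^ (3 * p + 1).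
  rewrite -powR_mulrn ?(ltW rho0)// -powRrM powRD ?(gt_eqF rho0) ?implybT//.
  by rewrite powRr1// ltW.
have H2 : cker n sigma * (r1 + q2) * U + gain0 * (kY * W) <=
    J + cker n sigma * (r2 + q1) * U + gain0 * kY * ((rho ^+ 3) `^ p * rho) * Q * W by lra.
rewrite rp bal in H2; rewrite /rem_const -/kY; lra.
Qed.

End main_estimate.

End truncated.

(** * Measurability and integrability of compactly supported functions *)

Section measurability_rV.
Variable R : realType.

(** The sigma-algebra is generated by the coordinates, so open sets are written as countable unions
    of the cubes with rational center and radius 1 / (k + 1) that they contain. *)
Lemma open_measurable_rV n (A : set 'rV[R]_n) : open A -> measurable A.
Proof.
move=> oA.
pose B (z : 'rV[rat]_n * nat) : set 'rV[R]_n :=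
  [set x | forall i, ball (ratr (z.1 ord0 i) : R) z.2.+1%:R^-1 (x ord0 i)].
have mB z : measurable (B z).
  rewrite (_ : B z = \bigcap_(i in [set: 'I_n]) (@rV_coors R n i @^-1`
      (ball (ratr (z.1 ord0 i) : R) z.2.+1%:R^-1))); last first.
    by apply/seteqP; split => x /= Bx => [i _|i]; exact: Bx.
  apply: fin_bigcap_measurable => // i _.
  rewrite -[X in measurable X]setTI; apply: measurable_rV_coors => //.
  exact: measurable_ball.
rewrite (_ : A = \bigcup_z (if `[< B z `<=` A >] then B z else set0)); last first.
  apply/seteqP; split => [x Ax|x [z _]]; last by case: ifPn => // /asboolP; exact.
  have /nbhs_ballP[e /= e0 xeA] : nbhs x A by exact: open_nbhs_nbhs.
  (* A cube of radius below e / 2 that contains [x] stays within distance e of [x]. *)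
  have [k ke] : exists k : nat, k.+1%:R^-1 < e / 2.
    exists (Num.truncn (e / 2)^-1); rewrite invf_plt ?posrE ?divr_gt0//.
    exact: truncnS_gt.
  have k0 : 0 < k.+1%:R^-1 :> R by rewrite invr_gt0.
  have rq i : {q : rat | ball (ratr q : R) k.+1%:R^-1 (x ord0 i)}.
    apply: cid; have [|q] := @rat_in_itvoo R (x ord0 i - k.+1%:R^-1) (x ord0 i).
      by rewrite gtrBl.
    rewrite in_itv/= => /andP[q1 q2]; exists q.
    rewrite /ball/= ltr_norml; move: (ratr q : R) (k.+1%:R^-1) q1 q2 k0 => r a q1 q2 k0.
    by apply/andP; split; lra.
  exists (\row_i sval (rq i), k) => //.
  have Bx : B (\row_i sval (rq i), k) x by move=> i /=; rewrite mxE; exact: (svalP (rq i)).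
  rewrite asboolT// => y By; apply: xeA; split=> // i j; rewrite !ord1.
  have := By j; have := Bx j; rewrite /ball/= => b1 b2.
  rewrite (_ : x 0 j - y 0 j = - (ratr ((\row_i sval (rq i)) 0 j) - x 0 j) +
    (ratr ((\row_i sval (rq i)) 0 j) - y 0 j)); last by ring.
  apply: (le_lt_trans (ler_normD _ _)); rewrite normrN.
  apply: (lt_le_trans (ltrD b1 b2)).
  by rewrite [leRHS]splitr lerD// ltW.
apply: countable_bigcupT_measurable => [|z]; first exact: countableP.
by case: ifP.
Qed.

Lemma continuous_xcoord n k : continuous (fun x : 'rV[R]_n => xcoord x k).
Proof.
have [[i E]|E] : (exists i, forall x : 'rV[R]_n, xcoord x k = x ord0 i) \/
    forall x : 'rV[R]_n, xcoord x k = 0.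
- by rewrite /xcoord; case: insubP => [i _ _|_]; [left; exists i|right].
- by rewrite (funext E); exact: coord_continuous.
- by rewrite (funext E); exact: cst_continuous.
Qed.

Lemma open_half_space n : open (half_space R n).
Proof.
apply: (@open_comp _ _ (fun x : 'rV[R]_n => xcoord x n) [set t | 0 < t]).
  by move=> x _; exact: continuous_xcoord.
exact: open_gt.
Qed.

(** Superlevel sets at a >= 0 are open, being cut out of an open set by a continuous function; at a
    < 0 the complement of the half-space is added. *)
Lemma measurable_half_space_fun n (u : 'rV[R]_n -> R) :
  {within half_space R n, continuous u} ->
  measurable_fun setT (fun x => if 0 < xcoord x n then u x else 0).
Proof.
have oH := @open_half_space n; rewrite continuous_open_subspace// => cu.
pose O (a : R) := half_space R n `&` u @^-1` `]a, +oo[%classic.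
have mO a : measurable (O a).
  apply: open_measurable_rV; rewrite openE => x [Hx ux]; apply: filterI.
    exact: open_nbhs_nbhs.
  apply: (cu x); first by rewrite inE.
  by apply: open_nbhs_nbhs; split=> //; exact: interval_open.
apply: (measurability _ (RGenOInfty.measurableE R)).
move=> _ [_ [a ->] <-]; rewrite setTI.
have [a0|a0] := ltP a 0.
  rewrite (_ : _ @^-1` _ = O a `|` ~` half_space R n).
    by apply: measurableU => //; apply: measurableC; exact: open_measurable_rV.
  apply/seteqP; split=> x; rewrite /O /half_space/= !in_itv/= !andbT.
    by case: ifPn => [x0 ax|x0 _]; [left|right; exact/negP].
  by case: ifPn => [x0 [[]//|]|_ _].
rewrite [X in measurable X](_ : _ = O a)//.
apply/seteqP; split=> x; rewrite /O /half_space/= !in_itv/= !andbT.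
  by case: ifPn => // _; rewrite ltNge a0.
by move=> [->].
Qed.

Lemma compact_bound n (A : set 'rV[R]_n) (f : 'rV[R]_n -> R) : compact A ->
  {within A, continuous f} -> exists2 M : R, 0 < M & forall x, A x -> `|f x| <= M.
Proof.
move=> cA cf; have /compact_bounded bf := continuous_compact cf cA.
have [M M0 fM] := pinfty_ex_gt0 bf.
by exists M => // x Ax; apply: fM; exists x.
Qed.

Lemma compact_coord_bound n (A : set 'rV[R]_n) : compact A ->
  exists2 L : R, 0 < L & forall x, A x -> forall i, `|x ord0 i| <= L.
Proof.
move=> /compact_bounded bA; have [L L0 AL] := pinfty_ex_gt0 bA.
exists L => // x /AL xL i; apply: le_trans xL.
rewrite /Num.norm/= mx_normrE.
exact: (le_bigmax _ (fun ij : 'I_1 * 'I_n => `|x ij.1 ij.2|) (ord0, i)).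
Qed.

Notation leb := (@lebesgue_measure R).
Let chi (L t : R) : R := if - L <= t <= L then 1 else 0.

Let chi_ge0 L t : 0 <= chi L t. Proof. by rewrite /chi; case: ifP. Qed.
Let mchi L : measurable_fun setT (chi L). Proof. by rewrite /chi; mfun. Qed.

(** Induction on the dimension: each prepended coordinate contributes the factor 2 L, and only the
    last one carries [g]. *)
Lemma integral_cube_lty n (L : R) (g : R -> R) : 0 <= L ->
  measurable_fun setT g -> (forall t, 0 <= g t) ->
  (\int[leb]_t (chi L t * g t)%:E < +oo)%E ->
  (\int[rV_lebesgue R n.+1]_x
     ((\prod_(i < n.+1) chi L (x ord0 i)) * g (xcoord x n.+1))%:E < +oo)%E.
Proof.
move=> L0 mg g0 gfin.
pose F m (x : 'rV[R]_m) := (\prod_(i < m) chi L (x ord0 i)) * g (xcoord x m).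
have mF m : measurable_fun setT (F m).
  apply: measurable_funM.
    by apply: measurable_prod => i _; exact: (measurableT_comp (mchi L) (measurable_rV_coors i)).
  exact: (measurableT_comp mg (@measurable_xcoord R m m)).
have F0 m x : 0 <= F m x by rewrite mulr_ge0// prodr_ge0.
rewrite -[X in (X < _)%E]/(\int[rV_lebesgue R n.+1]_x (F n.+1 x)%:E)%E.
elim: n => [|n IH].
  rewrite ge0_integral_rVS; last 2 first.
  - by apply/measurable_EFinP; exact: mF.
  - by move=> x; rewrite lee_fin F0.
  rewrite (_ : integral _ _ _ = \int[leb]_t (chi L t * g t)%:E)%E//.
  apply: eq_integral => t _; rewrite integral_rV0; last first.
    apply/measurable_EFinP; apply: (measurableT_comp (mF 1)).
    by apply: (measurableT_comp (@measurable_rV_cons R 0)); exact: pair1_measurable.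
  by rewrite /F big_ord_recl big_ord0 mulr1 rV_cons0 xcoord_cons1.
rewrite ge0_integral_rVS; last 2 first.
- by apply/measurable_EFinP; exact: mF.
- by move=> x; rewrite lee_fin F0.
have [r rE] : exists r : R, (\int[rV_lebesgue R n.+1]_x (F n.+1 x)%:E = r%:E)%E.
  exists (fine (\int[rV_lebesgue R n.+1]_x (F n.+1 x)%:E)%E).
  by rewrite fineK// ge0_fin_numE//; apply: integral_ge0 => x _; rewrite lee_fin.
have r0 : 0 <= r by rewrite -lee_fin -rE; apply: integral_ge0 => x _; rewrite lee_fin.
rewrite (_ : integral _ _ _ = \int[leb]_t (if (- L <= t) && (t <= L) then r else 0)%:E)%E.
  by rewrite integral_itv_cst ?ltry//; lra.
apply: eq_integral => t _.
transitivity (\int[rV_lebesgue R n.+1]_x (chi L t * F n.+1 x)%:E)%E.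
  apply: eq_integral => x _; rewrite /F big_ord_recl rV_cons0 xcoord_cons/= -mulrA.
  by under eq_bigr do rewrite rV_consS.
have Z := ge0_integral_fctZ (rV_lebesgue R n.+1) (chi_ge0 L t) (mF n.+1) (F0 n.+1).
rewrite [LHS]Z rE -EFinM /chi; case: ifP => _; first by rewrite mul1r.
by rewrite mul0r.
Qed.

(** Two uses are intended: [b = sigma] when sigma < 1, and [b = 0] for a support at positive
    distance from the boundary. *)
Lemma Uint_lty n (p sigma : R) (v : 'rV[R]_n.+2 -> R) (L B b : R) :
  measurable_fun setT v -> (forall x, 0 <= v x) ->
  0 < p -> 0 < L -> 0 <= B -> b < 1 ->
  (forall x, 0 < lst x -> v x != 0 -> (forall i, `|x ord0 i| <= L) /\
    v x `^ p * lst x `^ (- sigma) <= B * lst x `^ (- b)) ->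
  (Uint p sigma v < +oo)%E.
Proof.
move=> mv v0 p0 L0 B0 b1 H.
pose g (t : R) := if 0 < t then B * t `^ (- b) else 0.
have mg : measurable_fun setT g by rewrite /g; mfun.
have g0 t : 0 <= g t by rewrite /g; case: ifP => // _; rewrite mulr_ge0 ?powR_ge0.
have ml : measurable_fun setT (@lst R n) by exact: measurable_xcoord.
pose G (x : 'rV[R]_n.+2) := (\prod_(i < n.+2) chi L (x ord0 i)) * g (xcoord x n.+2).
apply: (@le_lt_trans _ _ (\int[rV_lebesgue R n.+2]_x (G x)%:E)%E).
  apply: ge0_integral_fct_le => [||  |x].
  - by mfun.
  - by move=> x; case: ifP => // _; rewrite mulr_ge0 ?powR_ge0.
  - apply: measurable_funM; last exact: (measurableT_comp mg ml).
    by apply: measurable_prod => i _; exact: (measurableT_comp (mchi L) (measurable_rV_coors i)).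
  have G0 : 0 <= G x by rewrite mulr_ge0// prodr_ge0.
  case: ifPn => // x0; have [vx|vx] := eqVneq (v x) 0.
    by rewrite vx powR0 ?gt_eqF// mul0r.
  have [xL le] := H x x0 vx; apply: (le_trans le).
  rewrite /G /g -/(lst x) x0 big1 ?mul1r// => i _.
  by have := xL i; rewrite /chi ler_norml => ->.
apply: integral_cube_lty => //; first exact: ltW.
apply: (@le_lt_trans _ _ (\int[leb]_t (B * (if 0 < t <= L then t `^ (- b) else 0))%:E)%E).
  apply: ge0_integral_fct_le => [||  |t].
  - exact: (measurable_funM (mchi L) mg).
  - by move=> t; apply: mulr_ge0.
  - by mfun.
  rewrite /chi /g; have [t0|t0] := ltP 0 t; last by rewrite mulr0 mulr0.
  case: ifPn => [/andP[_ ->]|_]; first by rewrite mul1r.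
  by rewrite mul0r mulr_ge0//; case: ifP => // _; exact: powR_ge0.
rewrite ge0_integral_fctZ//.
- by rewrite lte_mul_pinfty//; apply: integral_powR_lty => //; lra.
- by mfun.
- by move=> t; case: ifP => // _; exact: powR_ge0.
Qed.

End measurability_rV.

(** * Removing the truncation *)

Section limit.
Variables (R : realType) (n : nat) (p sigma tau : R).
Hypotheses (p1 : 1 < p) (sigma0 : 0 < sigma) (sigmap : sigma < p) (tau0 : 0 < tau).
Notation T := 'rV[R]_n.+2.
Notation mu := (rV_lebesgue R n.+2).
Notation leb := (@lebesgue_measure R).

Definition sharp_fun (t : R) : R :=
  `|1 - t `^ ((sigma - 1) / p)| `^ p / (1 - t) `^ (1 + sigma).

(** The shift by 10 keeps [eps k] within the range allowed by [hardy_truncated]. *)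
Let eps (k : nat) : R := (k + 10)%:R^-1.

Let eps_bnd k : 0 < eps k <= 10^-1.
Proof.
rewrite /eps invr_gt0 ltr0n addn_gt0 orbT/= lef_pV2 ?posrE ?ltr0n ?addn_gt0 ?orbT//.
by rewrite ler_nat leq_addl.
Qed.

Lemma ratio_integral_cvg :
  ratio_integral (eps k) sigma (phiD p sigma) @[k --> \oo] -->
  (\int[leb]_(t in `]0%R, 1%R[) (sharp_fun t)%:E)%E.
Proof.
pose F (k : nat) : set R := `[eps k, 1 - eps k]%classic.
have -> : (fun k => ratio_integral (eps k) sigma (phiD p sigma)) =
    (fun k => \int[leb]_(t in F k) (sharp_fun t)%:E)%E.
  apply/funext => k; rewrite [RHS]integral_mkcond; apply: eq_integral => t _.
  rewrite patchE (_ : (t \in F k) = (eps k <= t) && (t <= 1 - eps k)); last first.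
    by rewrite /F mem_setE in_itv.
  case: ifP => _; last by rewrite mul0r.
  rewrite /sharp_fun /phiD /expo -powRN; congr (_ * _ `^ _)%:E.
  by rewrite opprD.
have -> : `]0%R, 1%R[%classic = \bigcup_k F k.
  apply/seteqP; split=> [t|t [k _]]; rewrite /F/= !in_itv/=.
    move=> /andP[t0 t1].
    (* The index exceeds both inverses, so [eps N] is below [t] and below [1 - t]. *)
    pose N := Num.truncn (t^-1 + (1 - t)^-1); exists N => //=.
    have h : t^-1 + (1 - t)^-1 < (N + 10)%:R.
      by apply: lt_le_trans (truncnS_gt _) _; rewrite ler_nat -addn1 leq_add2l.
    have i0 : 0 < t^-1 by rewrite invr_gt0.
    have i1 : 0 < (1 - t)^-1 by rewrite invr_gt0 subr_gt0.
    rewrite in_itv/=; apply/andP; split.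
      by rewrite /eps invf_ple ?posrE ?ltr0n ?addn_gt0 ?orbT//; lra.
    have : eps N <= 1 - t.
      by rewrite /eps invf_ple ?posrE ?ltr0n ?addn_gt0 ?orbT ?subr_gt0//; lra.
    by lra.
  by move=> /andP[t0 t1]; have /andP[e0 _] := eps_bnd k; apply/andP; split; lra.
apply: ge0_nondecreasing_set_cvg_integral => [i j ij|i|i|i t _].
- apply/subsetPset => t; rewrite /F/= !in_itv/= => /andP[t0 t1].
  have : eps j <= eps i.
    by rewrite /eps lef_pV2 ?posrE ?ltr0n ?addn_gt0 ?orbT// ler_nat leq_add2r.
  by move=> h; apply/andP; split; lra.
- exact: measurable_itv.
- apply/measurable_EFinP; apply: measurable_funTS; rewrite /sharp_fun.
  have -> : (fun t : R => `|1 - t `^ ((sigma - 1) / p)| `^ p / (1 - t) `^ (1 + sigma)) =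
    (fun t : R => `|1 - t `^ ((sigma - 1) / p)| `^ p * (1 - t) `^ (- (1 + sigma))).
    by apply/funext => t; rewrite powRN.
  by mfun.
- by rewrite lee_fin divr_ge0 ?powR_ge0.
Qed.

Variable v : T -> R.
Hypotheses (mv : measurable_fun setT v) (v0 : forall x, 0 <= v x).

Lemma Uint_ge0 : (0 <= Uint p sigma v)%E.
Proof.
apply: integral_ge0 => x _; rewrite lee_fin; case: ifP => // _.
by rewrite mulr_ge0 ?powR_ge0.
Qed.

Lemma Wint_ge0 : (0 <= Wint p sigma tau v)%E.
Proof.
apply: integral_ge0 => x _; rewrite lee_fin; case: ifP => // _.
apply: mulr_ge0; last exact: powR_ge0.
by rewrite mulr_ge0 ?powR_ge0// ltW// hw_gt0.
Qed.

(** Finiteness of the limiting ratio integral is derived: with finite energy and positive [Uint],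
    the truncated inequalities bound all ratio integrals by one real, which the limit inherits. *)
Lemma hardy_limit : (Uint p sigma v < +oo)%E ->
  ((2 * cker n sigma)%:E * (\int[leb]_(t in `]0%R, 1%R[) (sharp_fun t)%:E) *
      Uint p sigma v +
    (2 * rem_const n p sigma tau)%:E * Wint p sigma tau v <=
   dint mu (energy_fun p sigma v))%E.
Proof.
move=> Ufin; have H k := hardy_truncated p1 sigma0 sigmap tau0 mv v0 (eps_bnd k) Ufin.
have := ratio_integral_cvg; set I := integral _ _ _ => cvI.
have r0 k : (0 <= ratio_integral (eps k) sigma (phiD p sigma))%E.
  by apply: ratio_integral_ge0 => t; exact: powR_ge0.
have C0 : 0 < 2 * cker n sigma by rewrite mulr_gt0// cker_gt0.
have I0 : (0 <= I)%E.
  by apply: integral_ge0 => t _; rewrite lee_fin divr_ge0 ?powR_ge0.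
have G0 : 0 < 2 * rem_const n p sigma tau by rewrite mulr_gt0 ?rem_const_gt0.
have U0 := Uint_ge0; have W0 := Wint_ge0.
have [u uE] : exists u : R, Uint p sigma v = u%:E.
  by exists (fine (Uint p sigma v)); rewrite fineK// ge0_fin_numE.
(* If [Uint] is 0, the product with the ratio integral is 0 whatever the latter is, and one
   truncated inequality is enough. *)
move: H U0; rewrite uE lee_fin le_eqVlt => H /orP[/eqP u0|u0].
  by have := H 0; rewrite -u0 !mule0.
set W := ((2 * _)%:E * Wint _ _ _ _)%E in H *.
have W0' : (0 <= W)%E by rewrite mule_ge0// lee_fin ltW.
have E0 : (0 <= dint mu (energy_fun p sigma v))%E.
  apply: le_trans (H 0); rewrite adde_ge0// mule_ge0 ?lee_fin ?(ltW u0)//.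
  by rewrite mule_ge0// lee_fin ltW.
move: (dint _ _) E0 H => [E| |]//= E0 H; last by rewrite leey.
have [w wE] : exists w : R, W = w%:E.
  have : (W <= E%:E)%E.
    apply: le_trans (H 0); rewrite lee_paddl// mule_ge0 ?lee_fin ?(ltW u0)//.
    by rewrite mule_ge0// lee_fin ltW.
  by case: (W) W0' => // w _ _; exists w.
rewrite wE in H *.
have cu0 : 0 < 2 * cker n sigma * u by exact: mulr_gt0.
have rB k : (ratio_integral (eps k) sigma (phiD p sigma) <=
    ((E - w) / (2 * cker n sigma * u))%:E)%E.
  move: (H k) (r0 k); case: (ratio_integral _ _ _) => [r| |]//.
    rewrite -!EFinM -EFinD !lee_fin => h _.
    rewrite ler_pdivlMr// lerBrDr; apply: le_trans h.
    by rewrite lerD2r (_ : r * _ = 2 * cker n sigma * r * u)//; ring.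
  by rewrite gt0_muley ?lte_fin// gt0_mulye ?lte_fin.
have IB : (I <= ((E - w) / (2 * cker n sigma * u))%:E)%E.
  by apply: cvge_le cvI; apply: nearW.
case: I I0 IB {cvI} => [i| |]// _.
rewrite -!EFinM -EFinD !lee_fin ler_pdivlMr// lerBrDr.
by rewrite (_ : i * _ = 2 * cker n sigma * i * u)//; ring.
Qed.

End limit.

(** * From the two function classes to the estimate *)

Section application.
Variables (R : realType) (n : nat) (p sigma : R).
Hypotheses (p1 : 1 < p) (sigma0 : 0 < sigma).
Notation T := 'rV[R]_n.+2.
Notation mu := (rV_lebesgue R n.+2).
Notation H := (half_space R n.+2).

Let inH (x : T) : (x \in H) = (0 < lst x).
Proof. by apply/idP/idP; rewrite inE. Qed.

Lemma integral_half_space (f : T -> R) : (\int[mu]_(x in H) (f x)%:E =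
  \int[mu]_x (if (0 < lst x)%R then f x else 0)%:E)%E.
Proof.
rewrite [LHS]integral_mkcond; apply: eq_integral => x _.
by rewrite patchE inH; case: ifP.
Qed.

Lemma kernelE (x y : T) :
  enorm (x - y) `^ (n.+2%:R + sigma) = dist2 x y `^ kexp n sigma.
Proof.
rewrite enorm_dist2 -powR12_sqrt ?dist2_ge0// -powRrM; congr (_ `^ _).
by rewrite /kexp mulrC.
Qed.

Lemma energy_half_space (u : T -> R) :
  (\int[mu]_(x in H) \int[mu]_(y in H)
     (`|u x - u y| `^ p / enorm (x - y) `^ (n.+2%:R + sigma))%:E =
   dint mu (energy_fun p sigma (fun x => if 0 < lst x then u x else 0)%R))%E.
Proof.
rewrite [LHS]integral_mkcond; apply: eq_integral => x _.
rewrite patchE inH /energy_fun; case: ifPn => x0; last first.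
  transitivity (\int[mu]_y 0)%E; first by rewrite integral0.
  by apply: eq_integral => y _.
rewrite [LHS]integral_half_space; apply: eq_integral => y _ /=.
by case: ifPn => // y0; rewrite kernelE -powRN.
Qed.

(** The reverse triangle inequality; it reduces the theorem to the nonnegative functions that Picone
    requires. *)
Lemma energy_norm (u : T -> R) : measurable_fun setT u ->
  (dint mu (energy_fun p sigma (fun x => `|u x|)%R) <= dint mu (energy_fun p sigma u))%E.
Proof.
move=> mu'; apply: dint_le.
- by apply: nnmf_energy; exact: measurable_fun_normr.
- exact: nnmf_energy.
move=> z; rewrite /energy_fun; case: ifP => // _.
rewrite ler_wpM2r ?ker_ge0//; apply: ge0_ler_powR; rewrite ?nnegrE//.
  by rewrite ltW// (lt_trans ltr01).
exact: ler_dist_dist.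
Qed.

(** The theorem's weight is l^(-sigma) (1 + (m / l)^2)^(-tau / 2), and max(1, |m / l|)^2 <= 1 + (m /
    l)^2. *)
Lemma target_weight (tau l m V : R) : 0 < tau -> 0 < l -> 0 <= V ->
  V / (l `^ (sigma - tau) * (m ^+ 2 + l ^+ 2) `^ (tau / 2)) <=
  hw tau (m / l) * V * l `^ (- sigma).
Proof.
move=> tau0 l0 V0; rewrite mulrAC [X in _ <= X]mulrC; apply: ler_wpM2l => //.
have M0 : 0 < Num.max 1 `|m / l| by rewrite lt_max ltr01.
rewrite /hw !powRN -invfM lef_pV2 ?posrE ?mulr_gt0 ?powR_gt0//; last first.
  by rewrite ltr_wpDl ?sqr_ge0// exprn_gt0.
rewrite (_ : sigma = (sigma - tau) + tau); last by ring.
rewrite powRD ?(gt_eqF l0) ?implybT// (_ : sigma - tau + tau - tau = sigma - tau); last by ring.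
rewrite mulrCA ler_pM2l ?powR_gt0// -powRM ?(ltW l0) ?(ltW M0)//.
rewrite {1}(_ : tau = 2%:R * (tau / 2)); last by field.
rewrite powRrM powR_mulrn ?mulr_ge0 ?(ltW l0) ?(ltW M0)//.
apply: ge0_ler_powR; rewrite ?nnegrE ?sqr_ge0 ?addr_ge0 ?sqr_ge0 ?divr_ge0 ?(ltW tau0)//.
rewrite exprMn; have [h|h] := leP `|m / l| 1.
  by rewrite expr1n mul1r lerDr sqr_ge0.
rewrite -exprMn normrM normfV (gtr0_norm l0) divfK ?gt_eqF//.
by rewrite real_normK ?num_real// lerDl sqr_ge0.
Qed.

(** Either the compact support lies in the open half-space, where 1 / l is bounded on it, or sigma <
    1 and l^(-sigma) is integrable up to the boundary. *)
Lemma Uint_Cc (Om : set T) (u : T -> R) : H `<=` Om -> Cc Om u ->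
  (Om `<=` H \/ sigma < 1) ->
  measurable_fun setT (fun x => if 0 < lst x then u x else 0) ->
  (Uint p sigma (fun x => `|if 0 < lst x then u x else 0|)%R < +oo)%E.
Proof.
move=> HOm [cu cK KOm] cas mw; pose K := fun_support Om u.
have p0 : 0 < p by rewrite (lt_trans ltr01).
have inK x : 0 < lst x -> `|if 0 < lst x then u x else 0| != 0 -> K x.
  by move=> x0; rewrite x0 normr_eq0 => ux; apply: subset_closure; split=> //; exact: HOm.
have [M M0 uM] := compact_bound cK (continuous_subspaceW KOm cu).
have [L L0 KL] := compact_coord_bound cK.
have pM x : 0 < lst x -> K x -> `|if 0 < lst x then u x else 0| `^ p <= M `^ p.
  move=> x0 Kx; rewrite x0; apply: ge0_ler_powR; rewrite ?nnegrE ?(ltW p0) ?(ltW M0)//.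
  exact: uM.
have mv : measurable_fun setT (fun x => `|if 0 < lst x then u x else 0|).
  exact: measurable_fun_normr.
case: cas => [OmH|s1]; last first.
  apply: (@Uint_lty _ _ _ _ _ L (M `^ p) sigma) => //; first exact: powR_ge0.
  move=> x x0 ux; have Kx := inK _ x0 ux; split; first exact: KL.
  by apply: ler_wpM2r; [exact: powR_ge0|exact: pM].
have [D D0 KD] : exists2 D : R, 0 < D & forall x, K x -> `|(lst x)^-1| <= D.
  apply: compact_bound => //; apply: continuous_in_subspaceT => x; rewrite inE => Kx.
  apply: continuousV; last exact: continuous_xcoord.
  by rewrite gt_eqF//; exact: (OmH _ (KOm _ Kx)).
apply: (@Uint_lty _ _ _ _ _ L (M `^ p * D `^ sigma) 0) => //.
  by rewrite mulr_ge0 ?powR_ge0.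
move=> x x0 ux; have Kx := inK _ x0 ux; split; first exact: KL.
rewrite oppr0 powRr0 mulr1; apply: ler_pM; rewrite ?powR_ge0//; first exact: pM.
rewrite -(mulN1r sigma) powRrM powR_inv1 ?(ltW x0)//.
apply: ge0_ler_powR; rewrite ?nnegrE ?invr_ge0 ?(ltW x0) ?(ltW sigma0) ?(ltW D0)//.
by apply: le_trans (KD _ Kx); exact: ler_norm.
Qed.

End application.

Theorem theorem1 (R : realType) (d : nat) (s p tau : R) :
  0 < s < 1 -> 1 < p -> (2 <= d)%N ->
  (2 <= p -> 0 < tau < p * (s * p + 1) / (2 * (p - 1))) ->
  (p < 2 -> 0 < tau < 2 * Num.min (s * p) 1) ->
  exists2 C : R, 0 < C &
    forall u : 'rV[R]_d -> R,
      (1 <= s * p /\ Cc (half_space R d) u) \/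
      (s * p < 1 /\ Cc (closure (half_space R d)) u) ->
      (hardy_const d s p *
         (\int[rV_lebesgue R d]_(x in half_space R d)
            (`|u x| `^ p / xcoord x d `^ (s * p))%:E) +
       C%:E *
         (\int[rV_lebesgue R d]_(x in half_space R d)
            (`|u x| `^ p /
              (xcoord x d `^ (s * p - tau) *
               (xcoord x d.-1 ^+ 2 + xcoord x d ^+ 2) `^ (tau / 2)))%:E)
       <=
       \int[rV_lebesgue R d]_(x in half_space R d)
         \int[rV_lebesgue R d]_(y in half_space R d)
           (`|u x - u y| `^ p / enorm (x - y) `^ (d%:R + s * p))%:E)%E.
Proof.
move=> /andP[s0 s1] p1 d2 taup tauq.
have p0 : 0 < p by rewrite (lt_trans ltr01).
have tau0 : 0 < tau.
  by have [/taup|/tauq] := leP 2 p => /andP[].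
have sigma0 : 0 < s * p by rewrite mulr_gt0.
have sigmap : s * p < p by rewrite gtr_pMl.
case: d d2 => [|[|n]]// _.
exists (2 * rem_const n p (s * p) tau); first by rewrite mulr_gt0 ?rem_const_gt0.
move=> u Hu; set H := half_space R n.+2.
(* Both function classes are treated at once through a domain [Om] that lies between the half-space
   and its closure. *)
have [Om [HOm COm cas]] : exists Om, [/\ H `<=` Om, Cc Om u & Om `<=` H \/ s * p < 1].
  case: Hu => [[_ C]|[s1' C]]; first by exists H; split=> //; left.
  by exists (closure H); split=> //; [exact: subset_closure|right].
pose w (x : 'rV[R]_n.+2) := if 0 < lst x then u x else 0.
pose v x := `|w x|.
have mw : measurable_fun setT w.
  apply: measurable_half_space_fun; case: COm => cu _ _.
  exact: continuous_subspaceW cu.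
have mv : measurable_fun setT v by exact: measurable_fun_normr.
have v0 x : 0 <= v x by exact: normr_ge0.
have Ufin : (Uint p (s * p) v < +oo)%E by exact: (Uint_Cc p1 sigma0 HOm COm cas mw).
have E1 : (\int[rV_lebesgue R n.+2]_(x in H)
    (`|u x| `^ p / xcoord x n.+2 `^ (s * p))%:E = Uint p (s * p) v)%E.
  rewrite integral_half_space; apply: eq_integral => x _.
  by rewrite /v /w; case: ifP => // _; rewrite powRN.
have E2 : (\int[rV_lebesgue R n.+2]_(x in H) (`|u x| `^ p /
     (xcoord x n.+2 `^ (s * p - tau) *
     (xcoord x n.+2.-1 ^+ 2 + xcoord x n.+2 ^+ 2) `^ (tau / 2)))%:E
    <= Wint p (s * p) tau v)%E.
  have ml : measurable_fun setT (@lst R n) by exact: measurable_xcoord.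
  have mp : measurable_fun setT (@prv R n) by exact: measurable_xcoord.
  have mil : measurable_fun setT (fun x : 'rV[R]_n.+2 => (lst x)^-1).
    exact: (measurableT_comp (@measurable_inv R)).
  rewrite integral_half_space.
  have -> : (fun x : 'rV[R]_n.+2 => (if 0 < lst x then `|u x| `^ p /
     (xcoord x n.+2 `^ (s * p - tau) *
     (xcoord x n.+2.-1 ^+ 2 + xcoord x n.+2 ^+ 2) `^ (tau / 2)) else 0)%:E) =
    (fun x : 'rV[R]_n.+2 => (if 0 < lst x then v x `^ p * (lst x `^ (- (s * p - tau)) *
     (prv x ^+ 2 + lst x ^+ 2) `^ (- (tau / 2))) else 0)%:E).
    by apply/funext => x; rewrite /v /w; case: ifP => // _; rewrite !powRN invfM.
  apply: ge0_integral_fct_le => [||  |x].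
  - by mfun.
  - by move=> x; case: ifP => // _; rewrite !mulr_ge0 ?powR_ge0.
  - by rewrite /hw; mfun.
  case: ifP => // x0; rewrite (powRN _ (s * p - tau)) (powRN _ (tau / 2)) -invfM.
  by apply: target_weight => //; exact: powR_ge0.
(* With d = n + 2: (d - 1) / 2 = (n + 1) / 2 and [kexp] minus (n + 1) / 2 is (1 + s p) / 2, the
   Gamma argument of the constant. *)
have E3 : hardy_const n.+2 s p = ((2 * cker n (s * p))%:E *
    \int[lebesgue_measure]_(t in `]0%R, 1%R[) (sharp_fun p (s * p) t)%:E)%E.
  rewrite /hardy_const /cker /kernel_const; congr (_%:E * _)%E.
  rewrite -mulrA; congr (_ * (_ `^ _ * (Gamma _ / _))).
    by rewrite -[n.+2%:R]natr1 addrK.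
  by rewrite /kexp -[n.+2%:R]natr1; field.
rewrite E1 E3 energy_half_space.
apply: le_trans (energy_norm (s * p) p1 mw).
have L := hardy_limit p1 sigma0 sigmap tau0 mv v0 Ufin.
refine (le_trans _ L).
by apply: leeD2l; apply: lee_wpmul2l => //; rewrite lee_fin mulr_ge0// ltW ?rem_const_gt0.
Qed.
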